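(* Let $G$ be an abelian group and $\mathbb{F}$ a field. (1) If $\mathcal{B}$ is a $G$-graded-central-simple algebra over $\mathbb{F}$, then there exist a subgroup $H$ of $G$, an algebra $\mathcal{A}$ graded by $\overline{G}=G/H$ which is central simple as an ungraded algebra, and $\tau\in\mathrm{Z}^2_{\mathrm{sym}}(G,\mathbb{F}^\times)$ such that $\mathcal{B}\simeq_G L^\tau_\pi(\mathcal{A})$, where $\pi:G\to\overline{G}$ is the canonical projection. (2) Conversely, if $H\le G$, $\mathcal{A}$ is a central simple $\overline{G}=G/H$-graded algebra and $\tau\in\mathrm{Z}^2_{\mathrm{sym}}(G,\mathbb{F}^\times)$, then $L^\tau_\pi(\mathcal{A})$ is $G$-graded-central-simple and $C(L^\tau_\pi(\mathcal{A}))\simeq_G\mathbb{F}^{\tau'}H$, where $\tau'=\tau|_{H\times H}$. (3) For $i=1,2$ let $H_i\le G$, $\pi_i:G\to G/H_i$ the canonical projection, $\mathcal{A}_i$ a central simple $G/H_i$-graded algebra, and $\tau_i\in\mathrm{Z}^2_{\mathrm{sym}}(G,\mathbb{F}^\times)$. Then $L^{\tau_1}_{\pi_1}(\mathcal{A}_1)\simeq_G L^{\tau_2}_{\pi_2}(\mathcal{A}_2)$ if and only if $H_1=H_2=:H$ (so $\pi_1=\pi_2=:\pi:G\to\overline{G}=G/H$) and there exists $\mu\in\mathrm{Z}^2_{\mathrm{sym}}(\overline{G},\mathbb{F}^\times)$ such that $[\tau_1]=\pi^*([\mu])[\tau_2]$ in $\mathrm{H}^2_{\mathrm{sym}}(G,\mathbb{F}^\times)$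 and $\mathcal{A}_1^\mu\simeq_{\overline{G}}\mathcal{A}_2$.
   Context: Algebras are arbitrary (nonassociative, possibly infinite-dimensional) algebras over $\mathbb{F}$. A $G$-grading is a decomposition $\mathcal{A}=\bigoplus_g\mathcal{A}_g$ with $\mathcal{A}_g\mathcal{A}_h\subseteq\mathcal{A}_{gh}$; $\simeq_G$ denotes graded isomorphism. Centroid: $C(\mathcal{A})=\{c\in\mathrm{End}_{\mathbb{F}}(\mathcal{A})\mid c(xy)=c(x)y=xc(y)\}$, $C(\mathcal{A})_g=\{c\in C(\mathcal{A}): c\mathcal{A}_{g'}\subseteq\mathcal{A}_{gg'}\ \forall g'\}$. An algebra is central simple if it is simple and its centroid is $\mathbb{F}1$. A $G$-graded algebra is graded-simple if $\mathcal{A}^2=\mathcal{A}$ and there are no proper nonzero graded ideals, graded-central if $C(\mathcal{A})_e=\mathbb{F}1$, graded-central-simple if both; for such algebras $C(\mathcal{A})=\bigoplus_gC(\mathcal{A})_g$ is $G$-graded. Symmetric $2$-cocycles $\mathrm{Z}^2_{\mathrm{sym}}(A,\mathbb{F}^\times)$: maps $\tau:A\times A\to\mathbb{F}^\times$ with $\tau(a_1,a_2)\tau(a_1a_2,a_3)=\tau(a_1,a_2a_3)\tau(a_2,a_3)$ and $\tau(a_1,a_2)=\tau(a_2,a_1)$; coboundaries $\mathrm{d}\gamma(a_1,a_2)=\gamma(a_1)\gamma(a_2)\gamma(a_1a_2)^{-1}$; $\mathrm{H}^2_{\mathrm{sym}}=\mathrm{Z}^2_{\mathrm{sym}}/\mathrm{B}^2$.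 For $\pi:G\to\overline{G}$, $\pi^*:\mathrm{H}^2_{\mathrm{sym}}(\overline{G},\mathbb{F}^\times)\to\mathrm{H}^2_{\mathrm{sym}}(G,\mathbb{F}^\times)$, $[\mu]\mapsto[\mu\circ(\pi\times\pi)]$. The $\tau$-twist $\mathcal{A}^\tau$ of a graded algebra is the same graded space with multiplication $x*y=\tau(g_1,g_2)xy$ for $x\in\mathcal{A}_{g_1},y\in\mathcal{A}_{g_2}$. The twisted group algebra $\mathbb{F}^{\tau'}H$ is the $\tau'$-twist of the group algebra $\mathbb{F}H$ with its natural grading (viewed as $G$-graded with support $H$). For $H\le G$, $\pi:G\to\overline{G}=G/H$, $g\mapsto\bar g$, and a $\overline{G}$-graded algebra $\mathcal{A}$, the loop algebra is the $G$-graded subalgebra $L_\pi(\mathcal{A})=\bigoplus_{g\in G}\mathcal{A}_{\bar g}\otimes g$ of $\mathcal{A}\otimes_{\mathbb{F}}\mathbb{F}G$ (degree of $\mathcal{A}_{\bar g}\otimes g$ is $g$), and $L^\tau_\pi(\mathcal{A}):=(L_\pi(\mathcal{A}))^\tau$ for $\tau\in\mathrm{Z}^2_{\mathrm{sym}}(G,\mathbb{F}^\times)$. *)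

(* Defs.v *)
From HB Require Import structures.
From mathcomp Require Import all_boot all_order all_algebra.
From Stdlib Require Import IndefiniteDescription ClassicalDescription FunctionalExtensionality PropExtensionality.
Set Implicit Arguments. Unset Strict Implicit. Unset Printing Implicit Defensive.
Import GRing.Theory.
Local Open Scope ring_scope.

Definition asbool (P : Prop) : bool :=
  if excluded_middle_informative P then true else false.
Lemma asboolP (P : Prop) : reflect P (asbool P).
Proof. rewrite /asbool; case: excluded_middle_informative => h; by constructor. Qed.

Section ClassicalChoice.
Variable T : Type.
Definition cfind (P : pred T) (n : nat) : option T :=
  match excluded_middle_informative (exists x, P x) with
  | left h => Some (proj1_sig (constructive_indefinite_description _ h))
  | right _ => None end.
Lemma cfind_correct P n x : cfind P n = Some x -> P x.
Proof.
rewrite /cfind; case: excluded_middle_informative => // h [<-].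
by case: constructive_indefinite_description.
Qed.
Lemma cfind_complete (P : pred T) : (exists x, P x) -> exists n, cfind P n.
Proof. by move=> h; exists 0%N; rewrite /cfind; case: excluded_middle_informative. Qed.
Lemma cfind_ext (P Q : pred T) : P =1 Q -> cfind P =1 cfind Q.
Proof. by move=> /functional_extensionality ->. Qed.
End ClassicalChoice.

Section FunSpace.
Variables (R : pzRingType) (T : Type) (V : lmodType R).
Definition funT := T -> V.
Lemma funT_eqP : Equality.axiom (fun f g : funT => asbool (f = g)).
Proof. by move=> f g; apply: (iffP (asboolP _)). Qed.
HB.instance Definition _ := hasDecEq.Build funT funT_eqP.
HB.instance Definition _ := hasChoice.Build funT
  (@cfind_correct funT) (@cfind_complete funT) (@cfind_ext funT).
Definition fzero : funT := fun _ => 0.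
Definition fopp (f : funT) : funT := fun x => - f x.
Definition fadd (f g : funT) : funT := fun x => f x + g x.
Definition fscale (a : R) (f : funT) : funT := fun x => a *: f x.
Lemma faddA : associative fadd.
Proof. by move=> f g h; apply: functional_extensionality => x; rewrite /fadd addrA. Qed.
Lemma faddC : commutative fadd.
Proof. by move=> f g; apply: functional_extensionality => x; rewrite /fadd addrC. Qed.
Lemma fadd0 : left_id fzero fadd.
Proof. by move=> f; apply: functional_extensionality => x; rewrite /fadd add0r. Qed.
Lemma faddN : left_inverse fzero fopp fadd.
Proof. by move=> f; apply: functional_extensionality => x; rewrite /fadd /fopp addNr. Qed.
HB.instance Definition _ := GRing.isZmodule.Build funT faddA faddC fadd0 faddN.
Lemma fscaleA a b (f : funT) : fscale a (fscale b f) = fscale (a * b) f.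
Proof. by apply: functional_extensionality => x; rewrite /fscale scalerA. Qed.
Lemma fscale1 : left_id 1 fscale.
Proof. by move=> f; apply: functional_extensionality => x; rewrite /fscale scale1r. Qed.
Lemma fscaleDr : right_distributive fscale +%R.
Proof. by move=> a f g; apply: functional_extensionality => x; rewrite /fscale /= /fadd scalerDr. Qed.
Lemma fscaleDl (f : funT) : {morph fscale^~ f : a b / a + b}.
Proof. by move=> a b; apply: functional_extensionality => x; rewrite /fscale /= /fadd scalerDl. Qed.
HB.instance Definition _ := GRing.Zmodule_isLmodule.Build R funT fscaleA fscale1 fscaleDr fscaleDl.
End FunSpace.

Section Span.
Variables (F : fieldType) (V : lmodType F) (P : pred V).
Definition inspan (v : V) : Prop :=
  forall Q : pred V, 0 \in Q -> (forall a x y, x \in Q -> y \in Q -> a *: x + y \in Q) ->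
    {subset P <= Q} -> v \in Q.
Definition spanP : pred V := fun v => asbool (inspan v).
Lemma spanP_closed : subsemimod_closed spanP.
Proof.
have h0 : 0 \in spanP by rewrite unfold_in; apply/asboolP => Q.
have hl a x y : x \in spanP -> y \in spanP -> a *: x + y \in spanP.
  rewrite !unfold_in => /asboolP hx /asboolP hy; apply/asboolP => Q Q0 QL QP.
  by apply: (QL); [exact: (hx Q Q0 QL QP) | exact: (hy Q Q0 QL QP)].
split; [split=> // x y hx hy|].
  by rewrite -(scale1r x); apply: hl.
by move=> a x hx; rewrite -(addr0 (a *: x)); apply: hl.
Qed.
HB.instance Definition _ := GRing.isSubmodClosed.Build F V spanP spanP_closed.
Record spanT := SpanT { sp_val : V; sp_valP : sp_val \in spanP }.
HB.instance Definition _ := [isSub for sp_val].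
HB.instance Definition _ := [Choice of spanT by <:].
HB.instance Definition _ := [SubChoice_isSubLmodule of spanT by <:].
End Span.


Record subgrp (G : zmodType) := SubGrp {
  sg_pred : pred G;
  sg0 : 0 \in sg_pred;
  sgB : forall x y, x \in sg_pred -> y \in sg_pred -> x - y \in sg_pred }.

(* the quotient group G/H, elements are chosen coset representatives *)
Section Quotient.
Variables (G : zmodType) (H : subgrp G).
Local Notation Hp := (sg_pred H).
Lemma sgN x : x \in Hp -> - x \in Hp.
Proof. by move=> hx; rewrite -sub0r; apply: sgB => //; apply: sg0. Qed.
Lemma sgD x y : x \in Hp -> y \in Hp -> x + y \in Hp.
Proof. by move=> hx hy; rewrite -(opprK y); apply: sgB => //; apply: sgN. Qed.
Lemma qrep_ex x : exists y, x - y \in Hp.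
Proof. by exists x; rewrite subrr sg0. Qed.
Definition qrep (x : G) : G := xchoose (qrep_ex x).
Lemma qrepP x : x - qrep x \in Hp.
Proof. exact: (xchooseP (qrep_ex x)). Qed.
Lemma qrep_eq x y : x - y \in Hp -> qrep x = qrep y.
Proof.
move=> hxy; apply: eq_xchoose => z; apply/idP/idP => h.
  have -> : y - z = (x - z) - (x - y) by rewrite [RHS]addrC opprB addrA subrK.
  exact: sgB.
have -> : x - z = (x - y) + (y - z) by rewrite addrA subrK.
exact: sgD.
Qed.
Lemma qrepK x : qrep (qrep x) = qrep x.
Proof. by apply: qrep_eq; rewrite -opprB; apply: sgN; apply: qrepP. Qed.
Record quot := Quot { q_val : G; q_valP : qrep q_val == q_val }.
HB.instance Definition _ := [isSub for q_val].
HB.instance Definition _ := [Choice of quot by <:].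
Definition qproj (x : G) : quot := @Quot (qrep x) (introT eqP (qrepK x)).
Lemma qproj_val (a : quot) : qproj (q_val a) = a.
Proof. by case: a => v hv; apply: val_inj => /=; apply/eqP. Qed.
Lemma qproj_eq x y : x - y \in Hp -> qproj x = qproj y.
Proof. by move=> h; apply: val_inj => /=; apply: qrep_eq. Qed.
Lemma qprojDl x y : qproj (qrep x + y) = qproj (x + y).
Proof.
apply: qproj_eq; rewrite opprD addrACA subrr addr0 -opprB.
by apply: sgN; apply: qrepP.
Qed.
Definition qzero : quot := qproj 0.
Definition qopp (a : quot) : quot := qproj (- q_val a).
Definition qadd (a b : quot) : quot := qproj (q_val a + q_val b).
Lemma qaddA : associative qadd.
Proof.
move=> a b c; rewrite /qadd /= qprojDl [q_val a + _]addrC qprojDl.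
by rewrite addrC addrA.
Qed.
Lemma qaddC : commutative qadd.
Proof. by move=> a b; rewrite /qadd addrC. Qed.
Lemma qadd0 : left_id qzero qadd.
Proof. by move=> a; rewrite /qadd /= qprojDl add0r qproj_val. Qed.
Lemma qaddN : left_inverse qzero qopp qadd.
Proof. by move=> a; rewrite /qadd /= qprojDl addNr. Qed.
HB.instance Definition _ := GRing.isZmodule.Build quot qaddA qaddC qadd0 qaddN.
End Quotient.

(* Graded (nonassociative, possibly infinite-dimensional) algebras.         *)
(* A G-graded algebra is given by its underlying F-vector space, its        *)
(* product, and the family (A_g)_g of homogeneous components; the algebra   *)
(* axioms (bilinearity, A = (+)_g A_g, A_g A_h <= A_{g+h}) are is_galg.     *)
(* Groups are abelian and written additively (e = 0, gh = g + h).          *)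
Record galg (F : fieldType) (G : Type) := GAlg {
  gcar : lmodType F;
  gmul : gcar -> gcar -> gcar;
  gcomp : G -> pred gcar }.
Arguments gcar {F G} g : rename.
Arguments gmul {F G} g _ _ : rename.
Arguments gcomp {F G} g _ : rename.

Section GradedNotions.
Local Unset Implicit Arguments.
Context {F : fieldType} {G : zmodType}.

Definition subspace {V : lmodType F} (P : pred V) : Prop :=
  0 \in P /\ forall a x y, x \in P -> y \in P -> a *: x + y \in P.

Definition bilinear_mul (A : galg F G) : Prop :=
  (forall a x y z, gmul A (a *: x + y) z = a *: gmul A x z + gmul A y z) /\
  (forall a x y z, gmul A z (a *: x + y) = a *: gmul A z x + gmul A z y).

Definition is_grading (A : galg F G) : Prop :=
  (forall g, subspace (gcomp A g)) /\
  (forall x : gcar A, exists (s : seq G) (f : G -> gcar A),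
      (forall g, f g \in gcomp A g) /\ x = \sum_(g <- s) f g) /\
  (forall (s : seq G) (f : G -> gcar A), uniq s -> (forall g, f g \in gcomp A g) ->
      \sum_(g <- s) f g = 0 -> forall g, g \in s -> f g = 0) /\
  (forall g h x y, x \in gcomp A g -> y \in gcomp A h -> gmul A x y \in gcomp A (g + h)).

Definition is_galg (A : galg F G) : Prop := bilinear_mul A /\ is_grading A.

Definition is_ideal (A : galg F G) (I : pred (gcar A)) : Prop :=
  subspace I /\ forall x y, x \in I -> gmul A x y \in I /\ gmul A y x \in I.
Definition is_graded_subspace (A : galg F G) (I : pred (gcar A)) : Prop :=
  forall x, x \in I -> exists (s : seq G) (f : G -> gcar A),
    (forall g, f g \in gcomp A g /\ f g \in I) /\ x = \sum_(g <- s) f g.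

Definition sq_full (A : galg F G) : Prop :=
  forall x : gcar A, exists s : seq (F * gcar A * gcar A),
    x = \sum_(p <- s) p.1.1 *: gmul A p.1.2 p.2.
Definition nonzero (A : galg F G) : Prop := exists x : gcar A, x != 0.

Definition simple (A : galg F G) : Prop :=
  nonzero A /\ sq_full A /\
  forall I : pred (gcar A), is_ideal A I -> (forall x, x \in I -> x = 0) \/ (forall x, x \in I).
Definition graded_simple (A : galg F G) : Prop :=
  nonzero A /\ sq_full A /\
  forall I : pred (gcar A), is_ideal A I -> is_graded_subspace A I ->
    (forall x, x \in I -> x = 0) \/ (forall x, x \in I).

Definition is_centroid (A : galg F G) (c : gcar A -> gcar A) : Prop :=
  (forall a x y, c (a *: x + y) = a *: c x + c y) /\
  (forall x y, c (gmul A x y) = gmul A (c x) y /\ c (gmul A x y) = gmul A x (c y)).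
Definition centroid_deg (A : galg F G) (g : G) (c : gcar A -> gcar A) : Prop :=
  forall g' x, x \in gcomp A g' -> c x \in gcomp A (g + g').

Definition central (A : galg F G) : Prop :=
  forall c : gcar A -> gcar A, is_centroid A c -> exists a : F, forall x, c x = a *: x.
Definition graded_central (A : galg F G) : Prop :=
  forall c : gcar A -> gcar A, is_centroid A c -> centroid_deg A 0 c -> exists a : F, forall x, c x = a *: x.

Definition central_simple (A : galg F G) : Prop := simple A /\ central A.
Definition graded_central_simple (A : galg F G) : Prop :=
  graded_simple A /\ graded_central A.

Definition giso (A B : galg F G) : Prop :=
  exists phi : gcar A -> gcar B,
    (forall a x y, phi (a *: x + y) = a *: phi x + phi y) /\ bijective phi /\
    (forall x y, phi (gmul A x y) = gmul B (phi x) (phi y)) /\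
    (forall g x, x \in gcomp A g -> phi x \in gcomp B g) /\
    (forall g y, y \in gcomp B g -> exists2 x, x \in gcomp A g & phi x = y).

Definition sym2cocycle (t : G -> G -> F) : Prop :=
  (forall a b, t a b != 0) /\
  (forall a b c, t a b * t (a + b) c = t a (b + c) * t b c) /\
  (forall a b, t a b = t b a).
Definition cohomologous (t1 t2 : G -> G -> F) : Prop :=
  exists gam : G -> F, (forall a, gam a != 0) /\
    forall a b, t1 a b = t2 a b * (gam a * gam b / gam (a + b)).

(* the tau-twist A^tau: x * y = tau(g1,g2) xy on homogeneous elements, *)
(* extended bilinearly via (a chosen) homogeneous decomposition         *)
Definition gdec {A : galg F G} (x : gcar A) : seq G * (G -> gcar A) :=
  match excluded_middle_informative
    (exists p : seq G * (G -> gcar A), uniq p.1 /\ (forall g, p.2 g \in gcomp A g) /\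
        x = \sum_(g <- p.1) p.2 g) with
  | left h => proj1_sig (constructive_indefinite_description _ h)
  | right _ => ([::], fun _ => 0) end.
Definition twist (A : galg F G) (t : G -> G -> F) : galg F G :=
  @GAlg F G (gcar A)
    (fun x y => \sum_(g <- (gdec x).1) \sum_(h <- (gdec y).1)
                  t g h *: gmul A ((gdec x).2 g) ((gdec y).2 h))
    (gcomp A).

(* finitely supported functions G -> V model V (x) FG *)
Definition fsupp {V : lmodType F} (f : G -> V) : seq G :=
  match excluded_middle_informative (exists s : seq G, forall g, f g != 0 -> g \in s) with
  | left h => undup (proj1_sig (constructive_indefinite_description _ h))
  | right _ => [::] end.
Definition fdelta {V : lmodType F} (g : G) (v : V) : funT G V :=
  fun k => if k == g then v else 0.
Definition conv {V : lmodType F} (m : V -> V -> V) (f f' : funT G V) : funT G V :=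
  fun k => \sum_(g <- fsupp f) \sum_(h <- fsupp f')
             (if g + h == k then m (f g) (f' h) else 0).

(* loop algebra L_pi(A) = (+)_g A_{pi g} (x) g  inside  A (x) FG *)
Section Loop.
Context {Gb : zmodType}.
Variables (pi : G -> Gb) (A : galg F Gb).
Definition loop_gen : pred (funT G (gcar A)) :=
  fun f => asbool (exists g v, v \in gcomp A (pi g) /\ f = fdelta g v).
Definition loop_car : lmodType F := spanT loop_gen.
Definition loop_mul (x y : loop_car) : loop_car :=
  insubd 0 (conv (gmul A) (sp_val x) (sp_val y)).
Definition loop_comp (g : G) : pred loop_car :=
  fun x => asbool ((forall k, k != g -> sp_val x k = 0) /\ sp_val x g \in gcomp A (pi g)).
Definition loop : galg F G := @GAlg F G loop_car loop_mul loop_comp.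
End Loop.
Definition tloop {Gb : zmodType} (pi : G -> Gb) (A : galg F Gb) (t : G -> G -> F) :=
  twist (loop pi A) t.

Section GroupAlg.
Variable H : subgrp G.
Definition grp_gen : pred (funT G F^o) :=
  fun f => asbool (exists g (a : F^o), g \in sg_pred H /\ f = fdelta g a).
Definition grp_car : lmodType F := spanT grp_gen.
Definition grp_mul (x y : grp_car) : grp_car :=
  insubd 0 (conv *%R (sp_val x) (sp_val y)).
Definition grp_comp (g : G) : pred grp_car :=
  fun x => asbool ((forall k, k != g -> sp_val x k = 0) /\
                   (g \in sg_pred H \/ sp_val x g = 0)).
Definition grpalg : galg F G := @GAlg F G grp_car grp_mul grp_comp.
End GroupAlg.
(* restriction tau' = tau|_{H x H} (extended by 1, values outside H x H are never used) *)
Definition restr (H : subgrp G) (t : G -> G -> F) : G -> G -> F :=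
  fun a b => if (a \in sg_pred H) && (b \in sg_pred H) then t a b else 1.
Definition tgrpalg (H : subgrp G) (t' : G -> G -> F) : galg F G := twist (grpalg H) t'.

Section CentroidAlg.
Variable A : galg F G.
Definition cent_gen : pred (funT (gcar A) (gcar A)) := fun c => asbool (is_centroid A c).
Definition cent_car : lmodType F := spanT cent_gen.
Definition cent_mul (c d : cent_car) : cent_car :=
  insubd 0 ((sp_val c \o sp_val d) : funT (gcar A) (gcar A)).
Definition cent_comp (g : G) : pred cent_car :=
  fun c => asbool (centroid_deg A g (sp_val c)).
Definition centroid_alg : galg F G := @GAlg F G cent_car cent_mul cent_comp.
End CentroidAlg.

End GradedNotions.

(* Main.v *)
(* A homogeneous nonzero element of the centroid of a graded-simple algebra B has a graded
   ideal as kernel and as image, so it is invertible; hence C(B) is a twisted group algebra of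
   its support H. Its cocycle extends from H to G (adjoining one generator at a time, by Zorn),
   and after twisting B by the inverse of the extension the group H acts on B by centroid
   elements; identifying the components in each H-coset along this action yields a G/H-graded
   algebra A with B isomorphic to the twisted loop algebra of A. A homogeneous centroid element
   of degree k of A lifts to one of degree k + H of the loop algebra, so C(A) = F, and a shortest
   nonzero element of an ideal of A must be homogeneous, since otherwise moving one of its
   components to another would produce a centroid element of nonzero degree.
   Conversely a degree k centroid element of the loop algebra of a central simple A comes from
   a centroid element of A, hence is a multiple of a(x)g |-> t(k,g) a(x)(k+g) and vanishes unless
   k is in H. An isomorphism of loop algebras rescales these elements by a function on H, which
   trivialises t1/t2 modulo cocycles inflated from G/H. *)
Require Import Defs.
From HB Require Import structures.
From mathcomp Require Import all_boot all_order all_algebra.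
From mathcomp Require Import ring.
From mathcomp Require wochoice.
From Stdlib Require Import IndefiniteDescription ClassicalDescription FunctionalExtensionality.
Import GRing.Theory.
Local Open Scope ring_scope.
Set Implicit Arguments. Unset Strict Implicit. Unset Printing Implicit Defensive.

(** The twist of a loop algebra uses a cocycle on all of [G], whereas the centroid of [B] supplies
    one only on its support [H]; hence the extension from [H] to [G]. It exists over every field:
    symmetric classes form Ext(-, F^x), and restriction of Ext to a subgroup is onto because Ext^2
    vanishes over the integers. The algebras need not have a unit, so a centroid element is not
    multiplication by an element of the algebra. The role of the unit falls to A A = A: linear
    identities are checked on products, where a centroid element can be moved to either factor.
    Homogeneous decompositions are only known to exist, so linear maps are given degree by degree
    and glued. Cocycles are not normalised, so the constant [t 0 0] appears wherever a shift by 0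
    should be the identity. *)

Lemma fun_choice (T U : Type) (R : T -> U -> Prop) :
  (forall x, exists y, R x y) -> exists f : T -> U, forall x, R x (f x).
Proof.
move=> h; exists (fun x => proj1_sig (constructive_indefinite_description _ (h x))).
by move=> x; case: constructive_indefinite_description.
Qed.

(** * Linear maps, subspaces and sums over enlarged lists *)

Section LinearMaps.
Variable F : fieldType.
Implicit Types U V : lmodType F.

Definition lin_on U V (P : pred U) (f : U -> V) :=
  forall a x y, x \in P -> y \in P -> f (a *: x + y) = a *: f x + f y.
Definition lin U V (f : U -> V) := forall a x y, f (a *: x + y) = a *: f x + f y.

Lemma lin_lin_on U V (P : pred U) (f : U -> V) : lin f -> lin_on P f.
Proof. by move=> h a x y _ _; apply: h. Qed.

Lemma lin_on0 U V (P : pred U) (f : U -> V) : 0 \in P -> lin_on P f -> f 0 = 0.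
Proof.
move=> P0 h; have := h 1 0 0 P0 P0.
by rewrite scaler0 addr0 scale1r => /eqP; rewrite -subr_eq subrr eq_sym => /eqP.
Qed.

Lemma lin_onZ U V (P : pred U) (f : U -> V) a x :
  0 \in P -> lin_on P f -> x \in P -> f (a *: x) = a *: f x.
Proof.
by move=> P0 h xP; rewrite -{1}[a *: x]addr0 h // (lin_on0 P0 h) addr0.
Qed.

Section Lin.
Variables (U V : lmodType F) (f : U -> V).
Hypothesis fL : lin f.
Lemma lin0 : f 0 = 0.
Proof. exact: (@lin_on0 U V predT f isT (lin_lin_on fL)). Qed.
Lemma linZ a x : f (a *: x) = a *: f x.
Proof. by rewrite -[a *: x]addr0 fL lin0 addr0. Qed.
Lemma linD x y : f (x + y) = f x + f y.
Proof. by rewrite -[x]scale1r fL !scale1r. Qed.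
Lemma linN x : f (- x) = - f x.
Proof. by rewrite -scaleN1r linZ scaleN1r. Qed.
Lemma linB x y : f (x - y) = f x - f y.
Proof. by rewrite linD linN. Qed.
Lemma lin_sum (I : Type) (r : seq I) (P : pred I) (h : I -> U) :
  f (\sum_(i <- r | P i) h i) = \sum_(i <- r | P i) f (h i).
Proof. exact: (big_morph f linD lin0). Qed.
End Lin.

Section Subspaces.
Variables (V : lmodType F) (P : pred V).
Hypothesis sP : subspace P.
Lemma sub0s : 0 \in P. Proof. by case: sP. Qed.
Lemma subZs a x : x \in P -> a *: x \in P.
Proof. by move=> h; rewrite -[a *: x]addr0; apply: sP.2 => //; apply: sub0s. Qed.
Lemma subDs x y : x \in P -> y \in P -> x + y \in P.
Proof. by move=> hx hy; rewrite -[x]scale1r; apply: sP.2. Qed.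
Lemma subBs x y : x \in P -> y \in P -> x - y \in P.
Proof. by move=> hx hy; apply: subDs => //; rewrite -scaleN1r; apply: subZs. Qed.
Lemma sub_sums (I : eqType) (r : seq I) (Q : pred I) (h : I -> V) :
  (forall i, i \in r -> Q i -> h i \in P) -> \sum_(i <- r | Q i) h i \in P.
Proof.
by move=> hP; rewrite big_seq_cond; elim/big_ind: _ => [|x y|i /andP[]]; [apply: sub0s|apply: subDs|apply: hP].
Qed.
End Subspaces.

Lemma big_extend (I : eqType) (V : zmodType) (s S : seq I) (h : I -> V) :
  uniq s -> uniq S -> {subset s <= S} ->
  \sum_(i <- S) (if i \in s then h i else 0) = \sum_(i <- s) h i.
Proof.
move=> us uS sS; rewrite -big_mkcond -big_filter; apply: perm_big.
apply: uniq_perm => //; first exact: filter_uniq.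
by move=> i; rewrite mem_filter; case: (boolP (i \in s)) => //= /sS ->.
Qed.

Lemma big_single (I : eqType) (V : zmodType) (s : seq I) (i : I) (h : I -> V) :
  uniq s -> \sum_(j <- s) (if j == i then h j else 0) = if i \in s then h i else 0.
Proof.
move=> us; rewrite -big_mkcond; case: ifP => hi; first by rewrite (big_rem i) //= eqxx big_seq_cond
  big1 ?addr0 // => j /andP[]; rewrite mem_rem_uniq // inE => /andP[/negbTE ->].
by rewrite big_seq_cond big_pred0 // => j; apply/negP => /andP[js /eqP e]; rewrite -e js in hi.
Qed.
End LinearMaps.

(** * Homogeneous decompositions, projections and twists *)

Section GradedTheory.
Variables (F : fieldType) (G : zmodType) (A : galg F G).
Hypothesis gA : is_grading A.

Lemma comp_sub g : subspace (gcomp A g). Proof. by case: gA. Qed.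
Local Hint Resolve comp_sub : core.
Lemma comp0 g : 0 \in gcomp A g. Proof. exact: sub0s. Qed.
Local Hint Resolve comp0 : core.
Lemma comp_mul g h x y :
  x \in gcomp A g -> y \in gcomp A h -> gmul A x y \in gcomp A (g + h).
Proof. by case: gA => _ [_ [_ hm]]; apply: hm. Qed.

Lemma gdecP (x : gcar A) : [/\ uniq (gdec x).1, forall g, (gdec x).2 g \in gcomp A g &
  x = \sum_(g <- (gdec x).1) (gdec x).2 g].
Proof.
rewrite /gdec; case: excluded_middle_informative => [h|[]].
  by case: constructive_indefinite_description => /= p [? [? ?]].
case: gA => _ [/(_ x) [s [f [hf ->]]] _].
(* The spanning axiom allows repeated degrees; repetitions become integer multiples, which stay in
   the component. *)
exists (undup s, fun g => f g *+ count_mem g s) => /=; split; first exact: undup_uniq.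
split=> [g|]; first by rewrite -scaler_nat; apply: subZs.
rewrite -(big_undup_iterop_count _ s); apply: eq_bigr => g _.
by [].
Qed.

Lemma grading_direct (s : seq G) (f : G -> gcar A) : uniq s ->
  (forall g, f g \in gcomp A g) -> \sum_(g <- s) f g = 0 -> forall g, g \in s -> f g = 0.
Proof. by case: gA => _ [_ [h _]]; apply: h. Qed.

Section Glue.
Variables (V : lmodType F) (phi : G -> gcar A -> V).
(** The linear map that restricts to [phi g] on the component of degree [g]. Each [phi g] has to be
    linear on that component only, so it may involve cocycle values depending on [g]. Projections
    and twisted products are of this form. *)
Definition glue (x : gcar A) : V := \sum_(g <- (gdec x).1) phi g ((gdec x).2 g).
Hypothesis phiL : forall g, lin_on (gcomp A g) (phi g).

Let phi0 g : phi g 0 = 0. Proof. exact: (lin_on0 (comp0 g) (@phiL g)). Qed.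

(** The decomposition chosen by [gdec] is arbitrary. Extended by 0 to a common list of degrees, any
    two decompositions agree termwise because the sum is direct. *)
Lemma glue_sum (s : seq G) (f : G -> gcar A) : uniq s ->
  (forall g, f g \in gcomp A g) ->
  glue (\sum_(g <- s) f g) = \sum_(g <- s) phi g (f g).
Proof.
move=> us fA; rewrite /glue; set x := \sum_(g <- s) f g.
have [us' fA' xE] := gdecP x.
move: (gdec x).1 (gdec x).2 us' fA' xE => s' f' us' fA' xE.
pose S := undup (s ++ s').
have uS : uniq S by rewrite undup_uniq.
have sS : {subset s <= S} by move=> g; rewrite mem_undup mem_cat => ->.
have sS' : {subset s' <= S} by move=> g; rewrite mem_undup mem_cat orbC => ->.
rewrite -(big_extend (fun g => phi g (f g)) us uS sS).
rewrite -(big_extend (fun g => phi g (f' g)) us' uS sS').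
pose e t (k : G -> gcar A) g := if g \in (t : seq G) then k g else 0.
have eA t k g : (forall g, k g \in gcomp A g) -> e t k g \in gcomp A g.
  by move=> h; rewrite /e; case: ifP.
have h0 : \sum_(g <- S) (e s f g - e s' f' g) = 0.
  by rewrite sumrB !big_extend // -xE subrr.
rewrite [LHS]big_seq [RHS]big_seq; apply: eq_bigr => g gS.
have := grading_direct uS _ h0 gS.
rewrite /= => /(_ (fun g => subBs (comp_sub g) (eA s f g fA) (eA s' f' g fA'))) /subr0_eq.
by rewrite /e; do 2 case: ifP => _; [move=> ->|move=> ->|move=> <-|]; rewrite ?phi0.
Qed.

Lemma glueH g x : x \in gcomp A g -> glue x = phi g x.
Proof.
move=> xg; pose f h := if h == g then x else 0.
have -> : x = \sum_(h <- [:: g]) f h by rewrite big_seq1 /f eqxx.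
rewrite glue_sum // ?big_seq1 // => h; rewrite /f; case: eqP => // ->.
by [].
Qed.

Lemma glue_lin : lin glue.
Proof.
move=> a x y; have [us fA xE] := gdecP x; have [us' fA' yE] := gdecP y.
rewrite {2 3}/glue.
move: (gdec x).1 (gdec x).2 (gdec y).1 (gdec y).2 us fA xE us' fA' yE.
move=> s f s' f' us fA -> us' fA' -> {x y}.
pose S := undup (s ++ s').
have uS : uniq S by rewrite undup_uniq.
have sS : {subset s <= S} by move=> g; rewrite mem_undup mem_cat => ->.
have sS' : {subset s' <= S} by move=> g; rewrite mem_undup mem_cat orbC => ->.
pose e t (k : G -> gcar A) g := if g \in (t : seq G) then k g else 0.
have eA t k g : (forall g, k g \in gcomp A g) -> e t k g \in gcomp A g.
  by move=> h; rewrite /e; case: ifP.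
rewrite -(big_extend f us uS sS) -(big_extend f' us' uS sS').
rewrite -(big_extend (fun g => phi g (f g)) us uS sS).
rewrite -(big_extend (fun g => phi g (f' g)) us' uS sS').
rewrite !scaler_sumr -!big_split /= glue_sum //.
  apply: eq_bigr => g _; rewrite phiL; [|exact: (eA s f)|exact: (eA s' f')].
  by do 2 case: ifP => _; rewrite ?phi0.
by move=> g; apply: (comp_sub g).2; [exact: (eA s f)|exact: (eA s' f')].
Qed.
End Glue.

Lemma homog_ind (Q : gcar A -> Prop) : Q 0 -> (forall x y, Q x -> Q y -> Q (x + y)) ->
  (forall g x, x \in gcomp A g -> Q x) -> forall x, Q x.
Proof.
move=> Q0 QD QH x; have [_ fA ->] := gdecP x.
by elim/big_ind: _ => // g _; apply: QH (fA g).
Qed.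

Lemma lin_ext (V : lmodType F) (f1 f2 : gcar A -> V) : lin f1 -> lin f2 ->
  (forall g x, x \in gcomp A g -> f1 x = f2 x) -> f1 =1 f2.
Proof.
move=> l1 l2; apply: homog_ind => [|x y h1 h2]; first by rewrite (lin0 l1) (lin0 l2).
by rewrite (linD l1) (linD l2) h1 h2.
Qed.

Definition proj (g : G) : gcar A -> gcar A := glue (fun h x => if h == g then x else 0).

Let proj_lin_on g h : lin_on (gcomp A h) (fun x : gcar A => if h == g then x else 0).
Proof. by move=> a x y _ _; case: ifP => // _; rewrite scaler0 addr0. Qed.

Lemma proj_lin g : lin (proj g).
Proof. exact/glue_lin/proj_lin_on. Qed.

Lemma projH g h x : x \in gcomp A h -> proj g x = if h == g then x else 0.
Proof. exact/glueH/proj_lin_on. Qed.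

Lemma projE g x : x \in gcomp A g -> proj g x = x.
Proof. by move=> /projH ->; rewrite eqxx. Qed.

Lemma proj_ne g h x : x \in gcomp A h -> h != g -> proj g x = 0.
Proof. by move=> /projH -> /negbTE ->. Qed.

Lemma proj_in g x : proj g x \in gcomp A g.
Proof.
elim/homog_ind: x => [|x y hx hy|h x xh]; first by rewrite (lin0 (proj_lin g)).
  by rewrite (linD (proj_lin g)); apply: subDs.
by rewrite (projH g xh); case: eqP => [<-|].
Qed.

Lemma proj_out g x : g \notin (gdec x).1 -> proj g x = 0.
Proof.
move=> hg; rewrite /proj /glue big_seq big1 // => h hs.
by case: eqP => // e; rewrite -e hs in hg.
Qed.

Lemma sum_proj x : x = \sum_(g <- (gdec x).1) proj g x.
Proof.
have [us fA e] := gdecP x; rewrite {1}e; rewrite big_seq [RHS]big_seq.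
apply: eq_bigr => g gs; rewrite /proj /glue (bigD1_seq g) //= eqxx.
by rewrite big1 ?addr0 // => h /negbTE ->.
Qed.

Lemma proj_ext x y : (forall g, proj g x = proj g y) -> x = y.
Proof.
move=> h; apply/subr0_eq; rewrite (sum_proj (x - y)) big1 // => g _.
by rewrite (linB (proj_lin g)) h subrr.
Qed.

Lemma glue_proj (V : lmodType F) (phi : G -> gcar A -> V) x :
  (forall g, lin_on (gcomp A g) (phi g)) ->
  glue phi x = \sum_(g <- (gdec x).1) phi g (proj g x).
Proof.
move=> phiL; rewrite {1}(sum_proj x) glue_sum //; first by case: (gdecP x).
by move=> g; apply: proj_in.
Qed.

Lemma comp_disjoint g h x : x \in gcomp A g -> x \in gcomp A h -> g != h -> x = 0.
Proof. by move=> xg xh gh; rewrite -(projE xg) (proj_ne xh) // eq_sym. Qed.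

Lemma homog_nonzero (x : gcar A) : x != 0 -> exists g y, y \in gcomp A g /\ y != 0.
Proof.
move=> x0; case: (excluded_middle_informative (exists g, proj g x != 0)) => [[g hg]|h].
  by exists g, (proj g x); split=> //; apply: proj_in.
case/eqP: x0; apply: proj_ext => g; rewrite (lin0 (proj_lin g)).
by apply/eqP/negP => /negP hg; case: h; exists g.
Qed.

Section Mul.
Hypothesis bA : bilinear_mul A.

Lemma gmull_lin y : lin (fun x => gmul A x y). Proof. by move=> a x z; apply: bA.1. Qed.
Lemma gmulr_lin x : lin (gmul A x). Proof. by move=> a y z; apply: bA.2. Qed.
Definition gmul0l y := lin0 (gmull_lin y).
Definition gmul0r x := lin0 (gmulr_lin x).
Definition gmulZl y := linZ (gmull_lin y).
Definition gmulZr x := linZ (gmulr_lin x).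
Definition gmulDl y := linD (gmull_lin y).
Definition gmulDr x := linD (gmulr_lin x).

(** Right multiplication by an element of degree [h] translates degrees by [h], and translation is
    injective, so distinct components never merge. *)
Lemma proj_mulr g h x y : y \in gcomp A h -> proj (g + h) (gmul A x y) = gmul A (proj g x) y.
Proof.
move=> yh; elim/homog_ind: x => [|x x' e e'|k x xk].
- by rewrite gmul0l !(lin0 (proj_lin _)) gmul0l.
- by rewrite gmulDl !(linD (proj_lin _)) gmulDl e e'.
rewrite (projH _ xk) (projH _ (comp_mul xk yh)) (inj_eq (addIr h)).
by case: ifP => //; rewrite gmul0l.
Qed.

Lemma proj_mull g h x y : x \in gcomp A g -> proj (g + h) (gmul A x y) = gmul A x (proj h y).
Proof.
move=> xg; elim/homog_ind: y => [|y y' e e'|k y yk].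
- by rewrite gmul0r !(lin0 (proj_lin _)) gmul0r.
- by rewrite gmulDr !(linD (proj_lin _)) gmulDr e e'.
rewrite (projH _ yk) (projH _ (comp_mul xg yk)) (inj_eq (addrI g)).
by case: ifP => //; rewrite gmul0r.
Qed.

Section Twist.
Variable t : G -> G -> F.

(** The double sum of [twist] is convertible to an iterated [glue], so bilinearity and independence
    of the decompositions are inherited from there. *)
Lemma twist_mulE x y : gmul (twist A t) x y =
  glue (fun g x => glue (fun h y => t g h *: gmul A x y) y) x.
Proof. by []. Qed.

Let inner_lin g x h : lin_on (gcomp A h) (fun y => t g h *: gmul A x y).
Proof. by move=> a y z _ _; rewrite bA.2 scalerDr !scalerA mulrC. Qed.

Let outer_lin y g : lin_on (gcomp A g) (fun x => glue (fun h y => t g h *: gmul A x y) y).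
Proof.
move=> a x z _ _; rewrite /glue scaler_sumr -big_split /=; apply: eq_bigr => h _.
by rewrite bA.1 scalerDr !scalerA mulrC.
Qed.

Lemma twist_mulH g h x y : x \in gcomp A g -> y \in gcomp A h ->
  gmul (twist A t) x y = t g h *: gmul A x y.
Proof.
move=> xg yh; rewrite twist_mulE (glueH (outer_lin y) xg).
by rewrite (glueH (inner_lin g x) yh).
Qed.

Lemma twist_galg : is_galg (twist A t).
Proof.
split; first split=> a x y z.
- exact: (glue_lin (outer_lin z)).
- rewrite !twist_mulE /glue scaler_sumr -big_split /=; apply: eq_bigr => g _.
  exact: (glue_lin (inner_lin g _)).
case: (gA) => h1 [h2 [h3 h4]]; split=> //; split=> //; split=> // g h x y xg yh.
by rewrite (twist_mulH xg yh); exact: (subZs (comp_sub _) _ (h4 _ _ _ _ xg yh)).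
Qed.
End Twist.
End Mul.
End GradedTheory.
Arguments proj {F G} A g x : rename.

(** * Graded isomorphisms and centroid elements given degree by degree *)

Section GradedMaps.
Variables (F : fieldType) (G : zmodType).
Implicit Types A B : galg F G.

Lemma giso_sym A B : giso A B -> giso B A.
Proof.
move=> [f [fL [[f' fK f'K] [fM [fA fB]]]]]; exists f'; split=> [a x y|].
  by apply: (can_inj fK); rewrite fL !f'K.
split; first by exists f.
split=> [x y|]; first by apply: (can_inj fK); rewrite fM !f'K.
split=> [g y /fB [x xg <-]|g x xg]; first by rewrite fK.
by exists (f x); [apply: fA|rewrite fK].
Qed.

(** Bijectivity is checked degree by degree: the images of the components of an element lie in
    different degrees, so if their sum vanishes then so does each one. *)
Lemma giso_intro A B (phi : G -> gcar A -> gcar B) : is_galg A -> is_galg B ->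
  (forall g, lin_on (gcomp A g) (phi g)) ->
  (forall g x, x \in gcomp A g -> phi g x \in gcomp B g) ->
  (forall g x, x \in gcomp A g -> phi g x = 0 -> x = 0) ->
  (forall g y, y \in gcomp B g -> exists2 x, x \in gcomp A g & phi g x = y) ->
  (forall g h x y, x \in gcomp A g -> y \in gcomp A h ->
     phi (g + h) (gmul A x y) = gmul B (phi g x) (phi h y)) ->
  giso A B.
Proof.
move=> [bA gA] [bB gB] phiL phiA phiI phiS phiM.
pose f := glue phi; have fL : lin f by exact: glue_lin.
have fH g x : x \in gcomp A g -> f x = phi g x by exact: glueH.
have fI : injective f.
  move=> x y e; apply/subr0_eq; set z := x - y.
  have : f z = 0 by rewrite (linB fL) e subrr.
  rewrite /f (glue_proj gA) // => h0; rewrite (sum_proj gA z) big_seq big1 // => g gs.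
  apply: (phiI g); first exact: proj_in.
  have [us _ _] := gdecP gA z.
  exact: (grading_direct gB us (fun g => phiA g _ (proj_in gA g z)) h0 gs).
have fS y : exists x, f x = y.
  elim/(homog_ind gB): y => [|_ _ [x <-] [x' <-]|g y /phiS [x xg <-]].
  - by exists 0; rewrite (lin0 fL).
  - by exists (x + x'); rewrite (linD fL).
  - by exists x; apply: fH.
have [f' f'K] := fun_choice fS.
exists f; split=> //; split; first by exists f' => // x; apply: fI; rewrite f'K.
split=> [x y|].
  elim/(homog_ind gA): x => [|x x' e e'|g x xg].
  - by rewrite (gmul0l bA) (lin0 fL) (gmul0l bB).
  - by rewrite (gmulDl bA) !(linD fL) (gmulDl bB) e e'.
  elim/(homog_ind gA): y => [|y y' e e'|h y yh].
  - by rewrite (gmul0r bA) (lin0 fL) (gmul0r bB).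
  - by rewrite (gmulDr bA) !(linD fL) (gmulDr bB) e e'.
  by rewrite (fH _ _ (comp_mul gA xg yh)) (fH _ _ xg) (fH _ _ yh) phiM.
split=> [g x xg|g y /phiS [x xg <-]]; first by rewrite (fH _ _ xg); apply: phiA.
by exists x => //; apply: fH.
Qed.

Section Centroid.
Variable A : galg F G.
Hypothesis gA : is_galg A.
Let bA : bilinear_mul A. Proof. by case: gA. Qed.
Let grA : is_grading A. Proof. by case: gA. Qed.

Lemma cent_intro (phi : G -> gcar A -> gcar A) :
  (forall g, lin_on (gcomp A g) (phi g)) ->
  (forall g h x y, x \in gcomp A g -> y \in gcomp A h ->
     phi (g + h) (gmul A x y) = gmul A (phi g x) y /\
     phi (g + h) (gmul A x y) = gmul A x (phi h y)) ->
  is_centroid A (glue phi).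
Proof.
move=> phiL phiM; have fL : lin (glue phi) by exact: glue_lin.
have fH g x : x \in gcomp A g -> glue phi x = phi g x by exact: glueH.
split=> // x y.
elim/(homog_ind grA): x => [|x x' [e1 e2] [e1' e2']|g x xg].
- by rewrite !(gmul0l bA) (lin0 fL) !(gmul0l bA).
- by rewrite !(gmulDl bA) !(linD fL) !(gmulDl bA) -e1 -e1' -e2 -e2'.
elim/(homog_ind grA): y => [|y y' [e1 e2] [e1' e2']|h y yh].
- by rewrite !(gmul0r bA) (lin0 fL) !(gmul0r bA).
- by rewrite !(gmulDr bA) !(linD fL) !(gmulDr bA) -e1 -e1' -e2 -e2'.
by rewrite (fH _ _ (comp_mul grA xg yh)) (fH _ _ xg) (fH _ _ yh); apply: phiM.
Qed.

Lemma cent_lin (c : gcar A -> gcar A) : is_centroid A c -> lin c.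
Proof. by case. Qed.

(** The part of degree [k] of [c]. In general [c] is not a finite sum of these; [centroid_fin]
    supplies finiteness for loop algebras. *)
Definition centroid_component (c : gcar A -> gcar A) (k : G) := glue (fun g (x : gcar A) => proj A (k + g) (c x)).

Let centroid_component_lin_on c k g : lin c -> lin_on (gcomp A g) (fun x : gcar A => proj A (k + g) (c x)).
Proof. by move=> cL a x y _ _; rewrite cL (proj_lin grA). Qed.

Lemma centroid_componentH c k g x : lin c -> x \in gcomp A g -> centroid_component c k x = proj A (k + g) (c x).
Proof. by move=> cL xg; rewrite /centroid_component (glueH grA _ xg) // => h; apply: centroid_component_lin_on. Qed.

Lemma centroid_component_cent c k : is_centroid A c -> is_centroid A (centroid_component c k).
Proof.
move=> hc; have cL := cent_lin hc; case: hc => _ cM.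
apply: cent_intro => [g|g h x y xg yh]; first exact: centroid_component_lin_on.
by split; [rewrite (cM x y).1 addrA (proj_mulr grA bA)
          |rewrite (cM x y).2 addrCA (proj_mull grA bA)].
Qed.

Lemma centroid_component_deg c k : lin c -> centroid_deg A k (centroid_component c k).
Proof. by move=> cL g x xg; rewrite (centroid_componentH _ cL xg); apply: proj_in. Qed.
End Centroid.

(** The condition A A = A as an induction principle: a linear statement may be checked on
    products. *)
Lemma sq_fullP A : bilinear_mul A -> sq_full A <->
  (forall Q : gcar A -> Prop, Q 0 -> (forall a x y, Q x -> Q y -> Q (a *: x + y)) ->
     (forall x y, Q (gmul A x y)) -> forall x, Q x).
Proof.
move=> bA; split=> [h Q Q0 QL QM x|].
  have [s ->] := h x; elim: s => [|p s IH]; first by rewrite big_nil.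
  by rewrite big_cons; apply: QL.
apply => [|a x y [s ->] [s' ->]|x y].
- by exists [::]; rewrite big_nil.
- exists ([seq (a * p.1.1, p.1.2, p.2) | p <- s] ++ s').
  rewrite big_cat big_map /= scaler_sumr; congr (_ + _).
  by apply: eq_bigr => p _; rewrite scalerA.
- by exists [:: (1, x, y)]; rewrite big_seq1 scale1r.
Qed.
End GradedMaps.

(** * Finitely supported functions: the common model of loop, group and base algebras *)

Lemma big_supp (I : eqType) (V : zmodType) (s s' : seq I) (h : I -> V) :
  uniq s -> uniq s' -> (forall i, h i != 0 -> i \in s) -> (forall i, h i != 0 -> i \in s') ->
  \sum_(i <- s) h i = \sum_(i <- s') h i.
Proof.
move=> us us' hs hs'; rewrite (bigID (fun i => h i != 0)) [RHS](bigID (fun i => h i != 0)) /=.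
rewrite [X in _ + X]big1 ?[X in _ = _ + X]big1 => [|i /negbNE/eqP //|i /negbNE/eqP //].
rewrite !addr0 -big_filter -[RHS]big_filter; apply: perm_big; apply: uniq_perm.
- exact: filter_uniq.
- exact: filter_uniq.
by move=> i; rewrite !mem_filter; case: eqP => //= /eqP hi; rewrite hs ?hs'.
Qed.

Section FunAlg.
Variables (F : fieldType) (G : zmodType) (V : lmodType F) (m : V -> V -> V).
Variables (P : G -> pred V) (gen : pred (funT G V)) (comp : G -> pred (spanT gen)).
Hypothesis P_sub : forall g, subspace (P g).
Hypothesis genE : forall f, f \in gen -> exists g v, v \in P g /\ f = fdelta g v.
Hypothesis genI : forall g v, v \in P g -> fdelta g v \in spanP gen.
Hypothesis compE : forall g x, x \in comp g <->
  (forall k, k != g -> sp_val x k = 0) /\ sp_val x g \in P g.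
Hypothesis mL : forall y, lin (fun x => m x y).
Hypothesis mR : forall x, lin (m x).
Hypothesis mP : forall g h x y, x \in P g -> y \in P h -> m x y \in P (g + h).

Definition finsupp (f : funT G V) := exists s : seq G, forall g, f g != 0 -> g \in s.

Lemma fsuppP (f : funT G V) : finsupp f -> uniq (fsupp f) /\ forall g, f g != 0 -> g \in fsupp f.
Proof.
rewrite /fsupp => hf; case: excluded_middle_informative => // h; split; first exact: undup_uniq.
by case: constructive_indefinite_description => s hs g /= /hs; rewrite mem_undup.
Qed.

Lemma fsumE (I : Type) (r : seq I) (h : I -> funT G V) k :
  (\sum_(i <- r) h i) k = \sum_(i <- r) h i k.
Proof. by elim: r => [|i r IH]; rewrite ?big_nil ?big_cons //= -IH. Qed.

Lemma fdelta_id (g : G) (v : V) : fdelta g v g = v. Proof. by rewrite /fdelta eqxx. Qed.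
Lemma fdelta_ne (g k : G) (v : V) : k != g -> fdelta g v k = 0.
Proof. by rewrite /fdelta => /negbTE ->. Qed.

Lemma fdelta_sum (s : seq G) (f : funT G V) : uniq s -> (forall g, f g != 0 -> g \in s) ->
  f = \sum_(g <- s) fdelta g (f g).
Proof.
move=> us hs; apply: functional_extensionality => k; rewrite fsumE.
rewrite (eq_bigr (fun g => if g == k then f g else 0)); last first.
  by move=> g _; rewrite /fdelta eq_sym.
by rewrite big_single //; case: ifP => // /negbT; apply: contraNeq => /hs.
Qed.

(** Finite support and values in [P] cut out a subspace containing the generators, so [inspan] can
    be instantiated at it; conversely such a function is a finite sum of delta functions. *)
Lemma mem_fspan f : f \in spanP gen <-> finsupp f /\ forall g, f g \in P g.
Proof.
split=> [|[[s hs] fP]].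
  rewrite unfold_in => /asboolP h.
  pose Q : pred (funT G V) := fun f => asbool (finsupp f /\ forall g, f g \in P g).
  suff /asboolP : f \in Q by [].
  apply: h => [|a x y|].
  - by apply/asboolP; split=> [|g]; [exists [::] => g; rewrite eqxx|apply: sub0s].
  - move=> /asboolP [[s hs] xP] /asboolP [[s' hs'] yP]; apply/asboolP.
    split=> [|g]; last exact: (P_sub g).2.
    exists (s ++ s') => g; rewrite mem_cat; change (a *: x g + y g != 0 -> (g \in s) || (g \in s')).
    have [->|/hs -> //] := eqVneq (x g) 0; rewrite scaler0 add0r => /hs' ->.
    by rewrite orbT.
  - move=> _ /genE [g [v [vP ->]]]; apply/asboolP; split=> [|k].
      by exists [:: g] => k; rewrite inE; apply: contraNT => /fdelta_ne ->.
    by rewrite /fdelta; case: eqP => [->|_] //; apply: sub0s.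
have -> : f = \sum_(g <- undup s) fdelta g (f g).
  by apply: fdelta_sum; rewrite ?undup_uniq // => g /hs; rewrite mem_undup.
by apply: rpred_sum => g _; apply: genI.
Qed.

Lemma sp_supp (x : spanT gen) : finsupp (sp_val x).
Proof. by case/mem_fspan: (sp_valP x). Qed.
Lemma sp_in (x : spanT gen) g : sp_val x g \in P g.
Proof. by case/mem_fspan: (sp_valP x). Qed.
Lemma sp_inj : injective (@sp_val F (funT G V) gen).
Proof. exact: val_inj. Qed.
Lemma sp_ext (x y : spanT gen) : (forall g, sp_val x g = sp_val y g) -> x = y.
Proof. by move=> h; apply/sp_inj/functional_extensionality. Qed.
Lemma sp_lin : lin (@sp_val F (funT G V) gen). Proof. by []. Qed.
Lemma sp_at_lin g : lin (fun x : spanT gen => sp_val x g). Proof. by []. Qed.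

(** [fsupp] returns an unspecified list for each function, so convolutions can be compared only
    after moving them to common lists; the extra terms vanish by bilinearity of [m]. *)
Lemma conv_wide (s s' : seq G) (f f' : funT G V) k : finsupp f -> finsupp f' ->
  uniq s -> uniq s' -> (forall g, f g != 0 -> g \in s) -> (forall g, f' g != 0 -> g \in s') ->
  conv m f f' k = \sum_(g <- s) \sum_(h <- s') (if g + h == k then m (f g) (f' h) else 0).
Proof.
move=> /fsuppP [u1 h1] /fsuppP [u2 h2] us us' hs hs'; rewrite /conv.
have m0 g h : m (f g) (f' h) != 0 -> f g != 0 /\ f' h != 0.
  move=> hm; split; apply: contraNneq hm => ->; first by rewrite (lin0 (mL _)).
  by rewrite (lin0 (mR _)).
have inn g : \sum_(h <- fsupp f') (if g + h == k then m (f g) (f' h) else 0) =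
    \sum_(h <- s') (if g + h == k then m (f g) (f' h) else 0).
  by apply: big_supp => // h; case: ifP => [_ /m0 []|_]; rewrite ?eqxx // => _; auto.
rewrite (eq_bigr _ (fun g _ => inn g)); apply: big_supp => // g hg.
  apply: h1; apply: contraNneq hg => e; rewrite big1 // => h _.
  by rewrite e (lin0 (mL _)) if_same.
apply: hs; apply: contraNneq hg => e; rewrite big1 // => h _.
by rewrite e (lin0 (mL _)) if_same.
Qed.

Lemma conv_in (x y : spanT gen) : conv m (sp_val x) (sp_val y) \in spanP gen.
Proof.
apply/mem_fspan; split=> [|k]; last first.
  apply: (sub_sums (P_sub k)) => g _ _; apply: (sub_sums (P_sub k)) => h _ _.
  by case: eqP => [<-|_]; [apply: mP; apply: sp_in|apply: sub0s].
exists [seq g + h | g <- fsupp (sp_val x), h <- fsupp (sp_val y)] => k; apply: contraNT => hk.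
rewrite /conv big_seq big1 // => g gs; rewrite big_seq big1 // => h hs.
by case: eqP => // e; case/negP: hk; rewrite -e; apply: allpairs_f.
Qed.

Definition funalg : galg F G :=
  @GAlg F G (spanT gen) (fun x y => insubd 0 (conv m (sp_val x) (sp_val y))) comp.

Lemma fmulE (x y : gcar funalg) : sp_val (gmul funalg x y) = conv m (sp_val x) (sp_val y).
Proof. exact: (insubdK 0 (conv_in x y)). Qed.

Definition fun_delta (g : G) (v : V) : spanT gen := insubd (0 : spanT gen) (fdelta g v).

Lemma fun_deltaE g v : v \in P g -> sp_val (fun_delta g v) = fdelta g v.
Proof. by move=> vP; apply: (insubdK (0 : spanT gen)); apply: genI. Qed.

Lemma fun_delta_at g v : v \in P g -> sp_val (fun_delta g v) g = v.
Proof. by move=> /fun_deltaE ->; apply: fdelta_id. Qed.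

Lemma fun_delta_lin g : lin_on (P g) (fun_delta g).
Proof.
move=> a x y xP yP; apply: sp_ext => k.
rewrite fun_deltaE; last exact: (P_sub g).2.
rewrite -[RHS]/(a *: sp_val (fun_delta g x) k + sp_val (fun_delta g y) k) !fun_deltaE // /fdelta.
by case: ifP => // _; rewrite scaler0 addr0.
Qed.

Lemma fun_delta_comp g v : v \in P g -> fun_delta g v \in gcomp funalg g.
Proof.
move=> vP; apply/compE; rewrite (fun_deltaE vP) fdelta_id; split=> // k.
exact: fdelta_ne.
Qed.

Lemma fun_compE g (x : gcar funalg) : x \in gcomp funalg g -> x = fun_delta g (sp_val x g).
Proof.
move=> /compE [h hP]; apply: sp_ext => k; rewrite (fun_deltaE hP) /fdelta.
by case: eqP => [->|/eqP /h].
Qed.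

Lemma fun_delta_mul g h v w : v \in P g -> w \in P h ->
  gmul funalg (fun_delta g v) (fun_delta h w) = fun_delta (g + h) (m v w).
Proof.
move=> vP wP; apply: sp_ext => k; rewrite fmulE (fun_deltaE (mP vP wP)).
rewrite (@conv_wide [:: g] [:: h]) //; try exact: sp_supp.
- by rewrite !big_seq1 !fun_delta_at // /fdelta eq_sym.
- by move=> g'; rewrite (fun_deltaE vP) inE; apply: contraNT => /fdelta_ne ->.
- by move=> g'; rewrite (fun_deltaE wP) inE; apply: contraNT => /fdelta_ne ->.
Qed.

Lemma funalg_galg : is_galg funalg.
Proof.
have sub2 (x y : spanT gen) : exists s : seq G, [/\ uniq s, forall g, sp_val x g != 0 -> g \in s
    & forall g, sp_val y g != 0 -> g \in s].
  have [s hs] := sp_supp x; have [s' hs'] := sp_supp y; exists (undup (s ++ s')).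
  split=> [|g /hs h|g /hs' h]; first exact: undup_uniq.
    by rewrite mem_undup mem_cat h.
  by rewrite mem_undup mem_cat h orbT.
have supL a (x y : spanT gen) (s : seq G) : (forall g, sp_val x g != 0 -> g \in s) ->
    (forall g, sp_val y g != 0 -> g \in s) -> forall g, sp_val (a *: x + y) g != 0 -> g \in s.
  move=> hx hy g; change (a *: sp_val x g + sp_val y g != 0 -> g \in s).
  have [->|/hx -> //] := eqVneq (sp_val x g) 0; rewrite scaler0 add0r; exact: hy.
split; [split=> a x y z|split; [|split; [|split]]].
- apply: sp_ext => k; rewrite -[RHS]/(a *: sp_val (gmul funalg x z) k + sp_val (gmul funalg y z) k).
  rewrite !fmulE; have [s [us sx sy]] := sub2 x y; have [s' [us' sz _]] := sub2 z z.
  rewrite !(@conv_wide s s') //; try exact: sp_supp; try exact: supL.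
  rewrite scaler_sumr -big_split; apply: eq_bigr => g _ /=.
  rewrite scaler_sumr -big_split; apply: eq_bigr => h _ /=.
  by case: ifP => _; [exact: mL|rewrite scaler0 addr0].
- apply: sp_ext => k; rewrite -[RHS]/(a *: sp_val (gmul funalg z x) k + sp_val (gmul funalg z y) k).
  rewrite !fmulE; have [s [us sx sy]] := sub2 x y; have [s' [us' sz _]] := sub2 z z.
  rewrite !(@conv_wide s' s) //; try exact: sp_supp; try exact: supL.
  rewrite scaler_sumr -big_split; apply: eq_bigr => g _ /=.
  rewrite scaler_sumr -big_split; apply: eq_bigr => h _ /=.
  by case: ifP => _; [exact: mR|rewrite scaler0 addr0].
- move=> g; split=> [|a x y /compE [hx xP] /compE [hy yP]]; apply/compE.
    by split=> //; apply: sub0s.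
  split=> [k kg|]; last exact: (P_sub g).2.
  by rewrite sp_at_lin hx // hy // scaler0 addr0.
- move=> x; have [s [us hs _]] := sub2 x x.
  exists s, (fun g => fun_delta g (sp_val x g)); split=> [g|]; first exact/fun_delta_comp/sp_in.
  apply: sp_inj; rewrite {1}(fdelta_sum us hs) (lin_sum sp_lin).
  by apply: eq_bigr => g _; rewrite fun_deltaE //; apply: sp_in.
- move=> s f us fP s0 g gs; rewrite (fun_compE (fP g)).
  suff -> : sp_val (f g) g = 0 by apply: sp_ext => k; rewrite fun_deltaE ?(sub0s (P_sub g)) // /fdelta if_same.
  have : sp_val (\sum_(g <- s) f g) g = 0 by rewrite s0.
  rewrite (lin_sum (sp_at_lin g)) (bigD1_seq g) //= big1 ?addr0 // => k kg.
  by case/compE: (fP k) => /(_ g) -> //; rewrite eq_sym.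
- move=> g h x y xg yh; rewrite (fun_compE xg) (fun_compE yh) fun_delta_mul; try exact: sp_in.
  by apply: fun_delta_comp; apply: mP; apply: sp_in.
Qed.
End FunAlg.

(** * The quotient map and identities for symmetric cocycles *)

Section QuotientMap.
Variables (G : zmodType) (H : subgrp G).
Local Notation pi := (qproj H).

Lemma qprojD x y : pi (x + y) = pi x + pi y.
Proof.
rewrite -[RHS]/(pi (qrep H x + qrep H y)) qprojDl [x + qrep H y]addrC qprojDl.
by rewrite addrC.
Qed.

Lemma qproj_eqE x y : (pi x == pi y) = (x - y \in sg_pred H).
Proof.
apply/eqP/idP => [[e]|]; last exact: qproj_eq.
have -> : x - y = (x - qrep H x) - (y - qrep H y) by rewrite e opprB addrA subrK.
by apply: sgB; apply: qrepP.
Qed.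

Lemma qproj0E x : (pi x == 0) = (x \in sg_pred H).
Proof. by rewrite -[0]/(pi 0) qproj_eqE subr0. Qed.

Lemma qproj0 x : x \in sg_pred H -> pi x = 0.
Proof. by rewrite -qproj0E => /eqP. Qed.

Lemma qproj_sub_val x : x - q_val (pi x) \in sg_pred H.
Proof. by rewrite -qproj_eqE qproj_val. Qed.
End QuotientMap.

Section Cocycle.
Variables (F : fieldType) (G : zmodType) (t : G -> G -> F).
Hypothesis tC : sym2cocycle t.
Lemma coc_neq0 a b : t a b != 0. Proof. by case: tC. Qed.
Lemma cocA a b c : t a b * t (a + b) c = t a (b + c) * t b c.
Proof. by case: tC => _ []. Qed.
Lemma coc_sym a b : t a b = t b a. Proof. by case: tC => _ []. Qed.
Lemma coc0r a : t a 0 = t 0 0.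
Proof.
have := cocA a 0 0; rewrite !addr0 => /(mulfI _); apply; exact: coc_neq0.
Qed.
(** This and [coc_shiftr] say that multiplication by the basis element of degree [a] of a twisted
    group algebra can be moved onto the left or the right factor of a product. *)
Lemma coc_shiftl a b c : t a b * t (a + b) c = t b c * t a (b + c).
Proof. by rewrite cocA mulrC. Qed.
Lemma coc_shiftr a b c : t a c * t b (a + c) = t b c * t a (b + c).
Proof. by rewrite -[RHS]coc_shiftl [t a b]coc_sym [a + b]addrC coc_shiftl. Qed.
Lemma coc0l a : t 0 a = t 0 0. Proof. by rewrite coc_sym coc0r. Qed.
End Cocycle.

(** * Twisted loop algebras in coordinates *)

Section LoopBasics.
Variables (F : fieldType) (G Gb : zmodType) (pi : G -> Gb).
Hypothesis piD : {morph pi : x y / x + y}.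
Variable A : galg F Gb.
Hypothesis gA : is_galg A.
Let P (g : G) : pred (gcar A) := gcomp A (pi g).
Let gen := loop_gen pi A.
Let P_sub g : subspace (P g). Proof. exact: (comp_sub (proj2 gA)). Qed.
Let genE f : f \in gen -> exists g v, v \in P g /\ f = fdelta g v.
Proof. by move=> /asboolP. Qed.
Let genI g v : v \in P g -> fdelta g v \in spanP gen.
Proof.
move=> vP; rewrite unfold_in; apply/asboolP => Q _ _; apply.
by rewrite unfold_in; apply/asboolP; exists g, v.
Qed.
Let compE g (x : spanT gen) : x \in loop_comp pi A g <->
  (forall k, k != g -> sp_val x k = 0) /\ sp_val x g \in P g.
Proof. by rewrite unfold_in; split=> [/asboolP|h]; last exact/asboolP. Qed.
Let mP g h x y : x \in P g -> y \in P h -> gmul A x y \in P (g + h).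
Proof. by rewrite /P piD; apply: comp_mul; case: gA. Qed.

Lemma loop_galg : is_galg (loop pi A).
Proof.
apply: (@funalg_galg _ _ _ (gmul A) P) => //.
- exact: gmull_lin (proj1 gA).
- exact: gmulr_lin (proj1 gA).
Qed.

Variable t : G -> G -> F.
Local Notation L := (tloop pi A t).

Lemma tloop_galg : is_galg L.
Proof. by case: loop_galg => h1 h2; apply: twist_galg. Qed.

Definition loop_at (x : gcar L) (g : G) : gcar A := sp_val (x : spanT gen) g.
Definition loop_delta (g : G) (v : gcar A) : gcar L := insubd (0 : spanT gen) (fdelta g v).

Lemma loop_at_lin g : lin (fun x => loop_at x g). Proof. by []. Qed.
Lemma loop_at_in x g : loop_at x g \in gcomp A (pi g).
Proof. exact: (sp_in P_sub genE genI). Qed.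
Lemma loop_at_ext x y : (forall g, loop_at x g = loop_at y g) -> x = y.
Proof. exact: sp_ext. Qed.
Lemma loop_at_ldl g k v : v \in gcomp A (pi g) -> loop_at (loop_delta g v) k = if k == g then v else 0.
Proof. by move=> vP; rewrite /loop_at (fun_deltaE genI vP). Qed.
Lemma loop_delta_at g v : v \in gcomp A (pi g) -> loop_at (loop_delta g v) g = v.
Proof. by move=> vP; rewrite loop_at_ldl // eqxx. Qed.
Lemma loop_delta_lin g : lin_on (gcomp A (pi g)) (loop_delta g).
Proof. exact: (fun_delta_lin P_sub genI). Qed.
Lemma loop_deltaZ g a v : v \in gcomp A (pi g) -> loop_delta g (a *: v) = a *: loop_delta g v.
Proof. exact: (lin_onZ _ (sub0s (P_sub g)) (@loop_delta_lin g)). Qed.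
Lemma loop_delta0 g : loop_delta g 0 = 0.
Proof. exact: (lin_on0 (sub0s (P_sub g)) (@loop_delta_lin g)). Qed.
Lemma loop_delta_comp g v : v \in gcomp A (pi g) -> loop_delta g v \in gcomp L g.
Proof. exact: (fun_delta_comp (gmul A) genI compE). Qed.
Lemma loop_comp_at g x k : x \in gcomp L g -> k != g -> loop_at x k = 0.
Proof. by move=> /compE [h _] /h. Qed.
Lemma loop_compE g x : x \in gcomp L g -> x = loop_delta g (loop_at x g).
Proof. exact: (fun_compE genI compE). Qed.
Lemma loop_delta_mul g h v w : v \in gcomp A (pi g) -> w \in gcomp A (pi h) ->
  gmul L (loop_delta g v) (loop_delta h w) = t g h *: loop_delta (g + h) (gmul A v w).
Proof.
move=> vP wP; case: loop_galg => b1 g1.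
rewrite (twist_mulH g1 b1 _ (loop_delta_comp vP) (loop_delta_comp wP)); congr (_ *: _).
exact: (fun_delta_mul (loop_comp pi A) P_sub genE genI (gmull_lin (proj1 gA))
  (gmulr_lin (proj1 gA)) mP vP wP).
Qed.
Lemma loop_at_proj g x : proj L g x = loop_delta g (loop_at x g).
Proof.
case: tloop_galg => bL grL; elim/(homog_ind grL): x => [|x y ex ey|h x xh].
- by rewrite (lin0 (proj_lin grL g)) loop_delta0.
- rewrite (linD (proj_lin grL g)) ex ey -[in RHS](scale1r x) loop_at_lin loop_delta_lin ?scale1r //.
    exact: loop_at_in.
  exact: loop_at_in.
rewrite (projH grL g xh); case: eqP => [<-|/eqP ne]; first exact: loop_compE.
by rewrite (loop_comp_at xh) 1?eq_sym // loop_delta0.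
Qed.
End LoopBasics.

(** * Centroid and graded simplicity of the loop algebra of a central simple algebra *)

Section LoopCentroid.
Variables (F : fieldType) (G : zmodType) (H : subgrp G) (A : galg F (quot H)) (t : G -> G -> F).
Hypothesis gA : is_galg A.
Hypothesis tC : sym2cocycle t.
Local Notation pi := (qproj H).
Local Notation L := (tloop pi A t).
Local Notation piD := (@qprojD G H).
Local Notation dl := (@loop_delta F G _ pi A t).
Let bA : bilinear_mul A := proj1 gA.
Let grA : is_grading A := proj2 gA.
Let gL : is_galg L := tloop_galg piD gA t.
Let bL : bilinear_mul L := proj1 gL.
Let grL : is_grading L := proj2 gL.

Lemma mem_shift k g v : k \in sg_pred H -> v \in gcomp A (pi g) -> v \in gcomp A (pi (k + g)).
Proof. by move=> kH; rewrite qprojD (qproj0 kH) add0r. Qed.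

(** The action of the basis element of degree [k] of the twisted group algebra. It makes sense for
    [k] in [H], as [g] and [k + g] then index the same component of [A]. *)
Definition loop_shift (k : G) : gcar L -> gcar L := glue (fun g x => t k g *: dl (k + g) (loop_at x g)).

Let loop_shift_lin_on k : k \in sg_pred H ->
  forall g, lin_on (gcomp L g) (fun x => t k g *: dl (k + g) (loop_at x g)).
Proof.
move=> kH g a x y _ _; rewrite loop_at_lin (loop_delta_lin gA); last 2 first.
- by apply: mem_shift => //; apply: loop_at_in.
- by apply: mem_shift => //; apply: loop_at_in.
by rewrite scalerDr !scalerA mulrC.
Qed.

Lemma loop_shift_lin k : k \in sg_pred H -> lin (loop_shift k).
Proof. by move=> kH; apply: glue_lin => // g; apply: loop_shift_lin_on. Qed.

Lemma loop_shift_dl k g v : k \in sg_pred H -> v \in gcomp A (pi g) -> loop_shift k (dl g v) = t k g *: dl (k + g) v.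
Proof.
move=> kH vg; rewrite /loop_shift (glueH grL (loop_shift_lin_on kH) (loop_delta_comp t vg)).
by rewrite loop_delta_at.
Qed.

Lemma loop_shift_cent k : k \in sg_pred H -> is_centroid L (loop_shift k).
Proof.
move=> kH; apply: cent_intro => // [g|g h x y xg yh]; first exact: loop_shift_lin_on.
have xA := loop_at_in gA x g; have yA := loop_at_in gA y h.
have xyA := comp_mul grA xA yA.
rewrite (loop_compE xg) (loop_compE yh) !loop_delta_at // (loop_delta_mul piD) // (linZ (loop_at_lin _)).
rewrite loop_delta_at ?qprojD // (loop_deltaZ gA); last by rewrite addrA !qprojD (qproj0 kH) add0r.
rewrite (gmulZl bL) (gmulZr bL) !(loop_delta_mul piD) //; last 2 first.
- exact: mem_shift.
- exact: mem_shift.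
rewrite !scalerA !addrA [g + k]addrC; split; congr (_ *: _).
  by rewrite [RHS](coc_shiftl tC) mulrC.
by rewrite [RHS](coc_shiftr tC) mulrC.
Qed.

Lemma loop_shift_deg k : k \in sg_pred H -> centroid_deg L k (loop_shift k).
Proof.
move=> kH g x xg; rewrite (loop_compE xg) loop_shift_dl //; last exact: loop_at_in.
apply: (subZs (comp_sub grL _)); apply: loop_delta_comp; apply: mem_shift => //; exact: loop_at_in.
Qed.

Lemma loop_shift_mul k l x : k \in sg_pred H -> l \in sg_pred H ->
  loop_shift k (loop_shift l x) = t k l *: loop_shift (k + l) x.
Proof.
move=> kH lH; have klH := sgD kH lH; move: x; apply: (lin_ext grL).
- by move=> a x y; rewrite !loop_shift_lin.
- by move=> a x y; rewrite loop_shift_lin // scalerDr !scalerA mulrC.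
move=> g x xg; rewrite (loop_compE xg); have xA := loop_at_in gA x g.
rewrite !loop_shift_dl // (linZ (loop_shift_lin kH)) loop_shift_dl //; last exact: mem_shift.
by rewrite !scalerA addrA (coc_shiftl tC).
Qed.

Lemma loop_shift0 x : loop_shift 0 x = t 0 0 *: x.
Proof.
move: x; apply: (lin_ext grL); first by apply: loop_shift_lin; apply: sg0.
  by move=> a x y; rewrite scalerDr !scalerA mulrC.
move=> g x xg; rewrite (loop_compE xg); have xA := loop_at_in gA x g.
by rewrite loop_shift_dl ?sg0 // add0r (coc0l tC).
Qed.

(** [loop_shift (- k)] is a left inverse up to the nonzero scalar [t (- k) k * t 0 0]. *)
Lemma loop_shift_inj k : k \in sg_pred H -> injective (loop_shift k).
Proof.
move=> kH x y e; have := congr1 (loop_shift (- k)) e.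
rewrite !loop_shift_mul ?sgN // addNr !loop_shift0 !scalerA => /(scalerI _); apply.
by rewrite mulf_neq0 // coc_neq0.
Qed.

Hypothesis csA : central_simple A.

Let sqA := proj1 (sq_fullP bA) (proj1 (proj2 (proj1 csA))).

Section Homogeneous.
Variables (c : gcar L -> gcar L) (k : G).
Hypotheses (cC : is_centroid L c) (cD : centroid_deg L k c).
Let cL : lin c := cent_lin cC.

(** The effect of [c] on coefficients, with [t k g] divided out. By the shift identities the cocycle
    then drops out of the centroid relations, which become [D_mul]. *)
Let D g a : gcar A := (t k g)^-1 *: loop_at (c (dl g a)) (k + g).

Let D_in g a : D g a \in gcomp A (pi (k + g)).
Proof. by apply: (subZs (comp_sub grA _)); apply: loop_at_in. Qed.

Let c_dl g a : a \in gcomp A (pi g) -> c (dl g a) = t k g *: dl (k + g) (D g a).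
Proof.
move=> ag; rewrite (loop_compE (cD (loop_delta_comp t ag))) -(loop_deltaZ gA) //.
by rewrite scalerA divff ?scale1r // coc_neq0.
Qed.

Let D_lin g : lin_on (gcomp A (pi g)) (D g).
Proof.
move=> a x y xg yg; rewrite /D (loop_delta_lin gA) // cL loop_at_lin scalerDr !scalerA.
by rewrite [_^-1 * a]mulrC.
Qed.

Let D_mul g h a b : a \in gcomp A (pi g) -> b \in gcomp A (pi h) ->
  D (g + h) (gmul A a b) = gmul A (D g a) b /\ D (g + h) (gmul A a b) = gmul A a (D h b).
Proof.
move=> ag bh; have abP : gmul A a b \in gcomp A (pi (g + h)) by rewrite qprojD; apply: comp_mul.
have n1 := coc_neq0 tC g h; have n2 := coc_neq0 tC k (g + h).
have E1 := (proj2 cC (dl g a) (dl h b)).1; have E2 := (proj2 cC (dl g a) (dl h b)).2.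
have Dab1 : gmul A (D g a) b \in gcomp A (pi (k + (g + h))).
  by rewrite addrA qprojD; apply: comp_mul.
have Dab2 : gmul A a (D h b) \in gcomp A (pi (k + (g + h))).
  by rewrite addrCA qprojD; apply: comp_mul.
move: E1 E2; rewrite (loop_delta_mul piD) // (linZ cL) !c_dl //.
rewrite (gmulZl bL) (gmulZr bL) !(loop_delta_mul piD) // -addrA [g + (k + h)]addrCA !scalerA.
move=> /(congr1 (fun x => loop_at x (k + (g + h)))) E1 /(congr1 (fun x => loop_at x (k + (g + h)))) E2.
move: E1 E2; rewrite !(linZ (loop_at_lin _)) !loop_delta_at //.
rewrite (coc_shiftl tC k) (coc_shiftr tC k).
by move=> /(scalerI (mulf_neq0 n1 n2)) <- /(scalerI (mulf_neq0 n1 n2)) <-.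
Qed.

(* [D g] depends on [g] only modulo [H]: [A_(pi g)] is spanned by products [x y], and
   [D g (x y) = D h x y] for any lift [h] of the degree of [x]. *)
Let D_shift g g' a : pi g = pi g' -> a \in gcomp A (pi g) -> D g a = D g' a.
Proof.
move=> e ag; rewrite -(projE grA ag); move: a {ag}.
have DpL h : lin (fun a => D h (proj A (pi h) a)).
  by move=> a x y; rewrite (proj_lin grA) D_lin //; apply: proj_in.
apply: sqA => [|a x y ex ey|x y].
- by rewrite {2}e !(lin0 (DpL _)).
- move: ex ey; rewrite {2 4 6}e => ex ey; by rewrite !DpL ex ey.
rewrite {2}e; elim/(homog_ind grA): x => [|x x' ex ex'|a x xa].
- by rewrite (gmul0l bA) !(lin0 (DpL _)).
- by rewrite (gmulDl bA) !(linD (DpL _)) ex ex'.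
elim/(homog_ind grA): y => [|y y' ey ey'|b y yb].
- by rewrite (gmul0r bA) !(lin0 (DpL _)).
- by rewrite (gmulDr bA) !(linD (DpL _)) ey ey'.
rewrite -e (projH grA _ (comp_mul grA xa yb)); case: eqP => [ab|_]; last first.
  by rewrite !(lin_on0 (comp0 grA _) (@D_lin _)).
have key h : pi h = pi g -> D h (gmul A x y) = gmul A (D (q_val a) x) y.
  move=> eh; have -> : h = q_val a + (h - q_val a) by rewrite addrC subrK.
  apply: (D_mul _ _).1; first by rewrite qproj_val.
  suff -> : pi (h - q_val a) = b by [].
  by apply: (addrI a); rewrite ab -eh -{1}(qproj_val a) -qprojD addrC subrK.
by rewrite !key.
Qed.

(** As [D g] depends only on the class of [g], these maps glue to a centroid element of [A] itself,
    which is a scalar because [A] is central. *)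
Lemma centroid_scalar : exists lam : F, forall g v, v \in gcomp A (pi g) ->
  loop_at (c (dl g v)) (k + g) = (lam * t k g) *: v.
Proof.
pose d := glue (fun a (x : gcar A) => D (q_val a) x).
have dl_on a : lin_on (gcomp A a) (D (q_val a)).
  by rewrite -{1}(qproj_val a); apply: D_lin.
have /(proj2 csA) [lam lamE] : is_centroid A d.
  apply: cent_intro => // a b x y xa yb.
  have -> : D (q_val (a + b)) (gmul A x y) = D (q_val a + q_val b) (gmul A x y).
    apply: D_shift; rewrite ?qprojD !qproj_val //; exact: comp_mul.
  by apply: D_mul; rewrite qproj_val.
exists lam => g v vg; have := lamE v; rewrite /d (glueH grA dl_on vg).
rewrite -(D_shift _ vg) ?qproj_val // => e.
by rewrite c_dl // (linZ (loop_at_lin _)) loop_delta_at // e scalerA mulrC.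
Qed.

Lemma centroid_in : k \in sg_pred H -> exists lam : F, forall x, c x = lam *: loop_shift k x.
Proof.
move=> kH; have [lam lamE] := centroid_scalar; exists lam; apply: (lin_ext grL) => //.
  by move=> a x y; rewrite loop_shift_lin // scalerDr !scalerA mulrC.
move=> g x xg; rewrite (loop_compE (cD xg)) (loop_compE xg); have xA := loop_at_in gA x g.
rewrite lamE // loop_shift_dl // (loop_deltaZ gA); last exact: mem_shift.
by rewrite !scalerA.
Qed.

(** The coefficient of [c x] in degree [k + g] is a multiple of one in [A_(pi g)] and also lies in
    [A_(pi (k + g))], a different component when [k] is outside [H]. *)
Lemma centroid_out : k \notin sg_pred H -> forall x, c x = 0.
Proof.
move=> kH; have [lam lamE] := centroid_scalar; apply: (lin_ext grL) => //.
  by move=> a x y; rewrite scaler0 addr0.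
move=> g x xg; rewrite (loop_compE (cD xg)) (loop_compE xg); have xA := loop_at_in gA x g.
rewrite lamE // -(lamE g) //.
suff -> : loop_at (c (dl g (loop_at x g))) (k + g) = 0 by rewrite (loop_delta0 pi gA).
apply: (comp_disjoint grA (loop_at_in gA _ _) (h := pi g)).
  by rewrite lamE //; apply: (subZs (comp_sub grA _)).
by rewrite qproj_eqE addrK.
Qed.
End Homogeneous.

Lemma tloop_graded_central : graded_central L.
Proof.
move=> c cC cD; have [lam h] := centroid_in cC cD (sg0 H).
by exists (lam * t 0 0) => x; rewrite h loop_shift0 scalerA.
Qed.

Lemma tloop_nonzero : exists x : gcar L, x != 0.
Proof.
case: csA => -[[x x0] _] _; have [a [y [ya y0]]] := homog_nonzero grA x0.
rewrite -(qproj_val a) in ya; exists (dl (q_val a) y); apply: contraNneq y0 => e.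
by rewrite -(loop_delta_at t ya) e.
Qed.

Lemma tloop_sq_full : sq_full L.
Proof.
apply/(sq_fullP bL) => Q Q0 QL QM; apply: (homog_ind grL) => // [x y hx hy|g x xg].
  by rewrite -[x]scale1r; apply: QL.
have QZ a x' : Q x' -> Q (a *: x') by move=> h; rewrite -[_ *: _]addr0; apply: QL.
have dpL : lin (fun a => dl g (proj A (pi g) a)).
  by move=> a y z; rewrite (proj_lin grA) (loop_delta_lin gA) //; apply: proj_in.
rewrite (loop_compE xg) -(projE grA (loop_at_in gA x g)); move: (loop_at x g) => {x xg}.
apply: sqA => [|a x y hx hy|x y].
- by rewrite (lin0 dpL).
- by rewrite dpL; apply: QL.
have QD y' z' : Q y' -> Q z' -> Q (y' + z') by move=> h1 h2; rewrite -[y']scale1r; apply: QL.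
elim/(homog_ind grA): x => [|x x' ex ex'|a x xa].
- by rewrite (gmul0l bA) (lin0 dpL).
- by rewrite (gmulDl bA) (linD dpL); apply: QD.
elim/(homog_ind grA): y => [|y y' ey ey'|b y yb].
- by rewrite (gmul0r bA) (lin0 dpL).
- by rewrite (gmulDr bA) (linD dpL); apply: QD.
rewrite (projH grA _ (comp_mul grA xa yb)); case: eqP => [ab|_]; last by rewrite (loop_delta0 pi gA).
have xa' : x \in gcomp A (pi (q_val a)) by rewrite qproj_val.
(* Lifting the degree of [x] to [q_val a] forces the lift [g - q_val a] for [y], so that the product
   has degree exactly [g]. *)
have yb' : y \in gcomp A (pi (g - q_val a)).
  suff -> : pi (g - q_val a) = b by [].
  by apply: (addrI a); rewrite ab -{1}(qproj_val a) -qprojD addrC subrK.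
have := QZ (t (q_val a) (g - q_val a))^-1 _ (QM (dl (q_val a) x) (dl (g - q_val a) y)).
rewrite (loop_delta_mul piD) // scalerA mulVf ?coc_neq0 // scale1r.
by rewrite [q_val a + _]addrC subrK.
Qed.

Lemma tloop_graded_simple : graded_simple L.
Proof.
split; first exact: tloop_nonzero.
split; first exact: tloop_sq_full.
move=> I [sI idI] grI.
have I0 := sub0s sI.
case: (excluded_middle_informative (exists x, x \in I /\ x != 0)); last first.
  move=> h; left=> x xI; apply/eqP/negP => /negP x0; apply: h; exists x.
  by [].
move=> [x [xI x0]]; right.
have [g [y [yg yI y0]]] : exists g y, [/\ y \in gcomp L g, y \in I & y != 0].
  have [s [f [fI xE]]] := grI x xI.
  case: (excluded_middle_informative (exists g, f g != 0)) => [[g fg]|h].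
    by exists g, (f g); have [? ?] := fI g.
  case/eqP: x0; rewrite xE big1 // => g _; apply/eqP/negP => /negP hg; apply: h.
  by exists g.
(* [J] asks that all lifts of each component lie in [I]; then multiplication by an element of degree
   [b], which relates the lifts [h - q_val b] and [h], preserves [J]. *)
pose J : pred (gcar A) := fun a => asbool (forall g, dl g (proj A (pi g) a) \in I).
have JP a : reflect (forall g, dl g (proj A (pi g) a) \in I) (a \in J) by exact: asboolP.
have dpL h : lin (fun a => dl h (proj A (pi h) a)).
  by move=> a u v; rewrite (proj_lin grA) (loop_delta_lin gA) //; apply: proj_in.
have dpM a b h k u v : pi h = a -> pi k = b -> u \in gcomp A a -> v \in gcomp A b ->
    dl (h + k) (gmul A u v) = (t h k)^-1 *: gmul L (dl h u) (dl k v).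
  move=> <- <- ua vb; rewrite (loop_delta_mul piD) // scalerA mulVf ?coc_neq0 //.
  by rewrite scale1r.
have Jid : is_ideal A J.
  split; first split=> [|a u v /JP uJ /JP vJ]; try (apply/JP => h).
  - by rewrite (lin0 (dpL h)).
  - by rewrite dpL; apply: sI.2.
  move=> u v /JP uJ; split; apply/JP => h.
    elim/(homog_ind grA): v => [|v v' e e'|b v vb].
    - by rewrite (gmul0r bA) (lin0 (dpL h)).
    - by rewrite (gmulDr bA) (linD (dpL h)); apply: subDs.
    have ph : pi h = pi (h - q_val b) + b by rewrite -[X in _ + X](qproj_val b) -qprojD subrK.
    rewrite ph (proj_mulr grA bA) //.
    rewrite -{1}(subrK (q_val b) h) (dpM (pi (h - q_val b)) b) ?qproj_val //; last exact: proj_in.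
    by apply: (subZs sI); apply: (idI _ _ _).1.
  elim/(homog_ind grA): v => [|v v' e e'|b v vb].
  - by rewrite (gmul0l bA) (lin0 (dpL h)).
  - by rewrite (gmulDl bA) (linD (dpL h)); apply: subDs.
  have ph : pi h = b + pi (h - q_val b) by rewrite -[X in X + _](qproj_val b) -qprojD addrC subrK.
  rewrite ph (proj_mull grA bA) //.
  rewrite -{1}(subrK (q_val b) h) addrC (dpM b (pi (h - q_val b))) ?qproj_val //; last exact: proj_in.
  by apply: (subZs sI); apply: (idI _ _ _).2.
case: (proj2 (proj2 (proj1 csA)) J Jid) => [J0|J1]; last first.
  move=> z; rewrite (sum_proj grL z); apply: (sub_sums sI) => h _ _.
  rewrite (loop_at_proj piD gA) -(projE grA (loop_at_in gA z h)).
  by apply/JP; apply: J1.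
(* [J = 0]: the degree [g] component of [y] annihilates [A], so the annihilator of [A]
   is a nonzero ideal, contradicting [A A = A]. *)
pose N : pred (gcar A) := fun a => asbool (forall b, gmul A a b = 0 /\ gmul A b a = 0).
have NP a : reflect (forall b, gmul A a b = 0 /\ gmul A b a = 0) (a \in N) by exact: asboolP.
have Nid : is_ideal A N.
  split; first split.
  - by apply/NP => b; rewrite (gmul0l bA) (gmul0r bA).
  - move=> a u v /NP uN /NP vN; apply/NP => b.
    have [u1 u2] := uN b; have [v1 v2] := vN b.
    by rewrite bA.1 bA.2 u1 u2 v1 v2 scaler0 addr0.
  move=> u v /NP uN; have [-> ->] := uN v.
  by split; apply/NP => b; rewrite (gmul0l bA) (gmul0r bA).
have yA := loop_at_in gA y g.
have yN : loop_at y g \in N.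
  apply/NP; elim/(homog_ind grA) => [|b b' [e1 e2] [e1' e2']|b v vb].
  - by rewrite (gmul0l bA) (gmul0r bA).
  - by rewrite (gmulDl bA) (gmulDr bA) e1 e2 e1' e2' addr0.
  split; apply: J0; apply/JP => h.
    rewrite (projH grA _ (comp_mul grA yA vb)); case: eqP => [ab|_]; last by rewrite (loop_delta0 pi gA).
    (* Since [y] has the exact degree [g], any lift [h] of the degree of the product is reached by
       lifting [b] to [h - g], so all lifts of the product lie in [I]. *)
    have eb : pi (h - g) = b by apply: (addrI (pi g)); rewrite ab -qprojD addrC subrK.
    rewrite -(subrK g h) addrC (dpM (pi g) b) // -(loop_compE yg).
    by apply: (subZs sI); apply: (idI _ _ _).1.
  rewrite (projH grA _ (comp_mul grA vb yA)); case: eqP => [ab|_]; last by rewrite (loop_delta0 pi gA).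
  have eb : pi (h - g) = b by apply: (addIr (pi g)); rewrite ab -qprojD subrK.
  rewrite -(subrK g h) (dpM b (pi g)) // -(loop_compE yg).
  by apply: (subZs sI); apply: (idI _ _ _).2.
case: (proj2 (proj2 (proj1 csA)) N Nid) => [/(_ _ yN) e|N1].
  by case/eqP: y0; rewrite (loop_compE yg) e (loop_delta0 pi gA).
case/eqP: x0; apply: (loop_at_ext (pi := pi)) => h.
have : forall a : gcar A, a = 0.
  apply: sqA => // [a u v -> ->|u v]; first by rewrite scaler0 addr0.
  by have /NP /(_ v) [] := N1 u.
by move=> z; rewrite (z (loop_at x h)) (z (loop_at 0 h)).
Qed.

Lemma tloop_gcs : graded_central_simple L.
Proof. by split; [apply: tloop_graded_simple|apply: tloop_graded_central]. Qed.
End LoopCentroid.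

(** * The twisted group algebra of a subgroup *)

Section GroupAlgebra.
Variables (F : fieldType) (G : zmodType) (H : subgrp G).
Let P (g : G) : pred F^o := fun a => (g \in sg_pred H) || (a == 0).
Let PE g a : (a \in P g) = (g \in sg_pred H) || (a == 0). Proof. by []. Qed.
Let gen := grp_gen (F := F) H.
Let P_sub g : subspace (P g).
Proof.
split=> [|a x y]; rewrite !PE ?eqxx ?orbT //.
by case: (g \in sg_pred H) => //= /eqP -> /eqP ->; rewrite scaler0 addr0.
Qed.
Let genE f : f \in gen -> exists g (v : F^o), v \in P g /\ f = fdelta g v.
Proof. by move=> /asboolP [g [a [gH ->]]]; exists g, a; rewrite PE gH. Qed.
Let genI g (v : F^o) : v \in P g -> fdelta g v \in spanP gen.
Proof.
rewrite PE => /orP [gH|/eqP ->].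
  rewrite unfold_in; apply/asboolP => Q _ _; apply.
  by rewrite unfold_in; apply/asboolP; exists g, v.
suff -> : fdelta g (0 : F^o) = 0 by apply: rpred0.
by apply: functional_extensionality => k; rewrite /fdelta if_same.
Qed.
Let compE g (x : spanT gen) : x \in grp_comp H g <->
  (forall k, k != g -> sp_val x k = 0) /\ sp_val x g \in P g.
Proof.
rewrite unfold_in; split=> [/asboolP [h1 h2]|[h1 h2]]; last first.
  by apply/asboolP; split=> //; case/orP: h2 => [?|/eqP ?]; [left|right].
by split=> //; rewrite PE; case: h2 => [->|->] //; rewrite eqxx orbT.
Qed.
Let mL (y : F^o) : lin (fun x : F^o => x * y : F^o).
Proof. by move=> a x z; rewrite mulrDl scalerAl. Qed.
Let mR (x : F^o) : lin (fun y : F^o => x * y : F^o).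
Proof. by move=> a y z; rewrite mulrDr scalerAr. Qed.
Let mP g h (x y : F^o) : x \in P g -> y \in P h -> x * y \in P (g + h).
Proof.
rewrite !PE => /orP [gH|/eqP ->]; last by rewrite mul0r eqxx orbT.
by case/orP => [hH|/eqP ->]; [rewrite sgD|rewrite mulr0 eqxx orbT].
Qed.

Lemma grpalg_galg : is_galg (grpalg (F := F) H).
Proof. exact: (@funalg_galg _ _ _ (fun x y : F^o => x * y : F^o) P). Qed.

Variable t : G -> G -> F.
Local Notation K := (tgrpalg H t).

Lemma tgrpalg_galg : is_galg K.
Proof. by case: grpalg_galg => h1 h2; apply: twist_galg. Qed.

Definition grp_at (x : gcar K) (g : G) : F := sp_val (x : spanT gen) g.
Definition grp_delta (g : G) (a : F) : gcar K := insubd (0 : spanT gen) (fdelta g (a : F^o)).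

Lemma grp_at_lin g a x y : grp_at (a *: x + y) g = a * grp_at x g + grp_at y g. Proof. by []. Qed.
Lemma grp_delta_comp g a : g \in sg_pred H -> grp_delta g a \in gcomp K g.
Proof.
by move=> gH; apply: (fun_delta_comp (fun x y : F^o => x * y : F^o) genI compE); rewrite PE gH.
Qed.
Lemma grp_delta_at g a : g \in sg_pred H -> grp_at (grp_delta g a) g = a.
Proof. by move=> gH; rewrite /grp_at (fun_deltaE genI) ?fdelta_id // PE gH. Qed.
Lemma grp_compE g x : x \in gcomp K g -> x = grp_delta g (grp_at x g).
Proof. exact: (fun_compE (m := fun x y : F^o => x * y : F^o) genI compE). Qed.
Lemma grp_comp_out g x : x \in gcomp K g -> g \notin sg_pred H -> x = 0.
Proof.
move=> xg gH; have /compE [_] := xg; rewrite PE (negbTE gH) => /eqP e.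
apply: sp_ext => k; rewrite -[RHS]/(0 : F^o); have /compE [h _] := xg.
by have [->|/h] := eqVneq k g.
Qed.
Lemma grp_delta_mul g h a b : g \in sg_pred H -> h \in sg_pred H ->
  gmul K (grp_delta g a) (grp_delta h b) = t g h *: grp_delta (g + h) (a * b).
Proof.
move=> gH hH; case: grpalg_galg => b1 g1.
rewrite (twist_mulH g1 b1 _ (grp_delta_comp _ gH) (grp_delta_comp _ hH)); congr (_ *: _).
by apply: (fun_delta_mul (grp_comp H) P_sub genE genI mL mR mP); rewrite PE ?gH ?hH.
Qed.
End GroupAlgebra.

(** * The centroid as an algebra under composition *)

Section CentroidAlgebra.
Variables (F : fieldType) (G : zmodType) (A : galg F G).
Hypothesis gA : is_galg A.
Let bA : bilinear_mul A := proj1 gA.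
Local Notation C := (centroid_alg A).
Definition cval (c : gcar C) : gcar A -> gcar A := sp_val (c : spanT (cent_gen A)).
Definition cmk (c : gcar A -> gcar A) : gcar C :=
  insubd (0 : spanT (cent_gen A)) (c : funT (gcar A) (gcar A)).

Lemma cent_linear a c d : is_centroid A c -> is_centroid A d ->
  is_centroid A (fun x => a *: c x + d x).
Proof.
move=> [cL cM] [dL dM]; split=> [b x y|x y].
  by rewrite cL dL !scalerDr !scalerA [a * b]mulrC addrACA.
by rewrite bA.1 bA.2 -!(cM x y).1 -!(cM x y).2 -!(dM x y).1 -!(dM x y).2.
Qed.

Lemma cent0 : is_centroid A (fun=> 0).
Proof.
by split=> [a x y|x y]; rewrite ?scaler0 ?addr0 // (gmul0l bA) (gmul0r bA).
Qed.

Lemma cent_comp_closed c d : is_centroid A c -> is_centroid A d -> is_centroid A (c \o d).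
Proof.
move=> [cL cM] [dL dM]; split=> [a x y|x y] /=; first by rewrite dL cL.
by rewrite {1}(dM x y).1 (cM _ _).1 (dM x y).2 (cM _ _).2.
Qed.

(** The centroid is already a subspace, so the span in [cent_car] adds no new maps. *)
Lemma cval_cent c : is_centroid A (cval c).
Proof.
have := sp_valP (c : spanT (cent_gen A)); rewrite unfold_in => /asboolP h.
suff : (sp_val (c : spanT (cent_gen A))) \in cent_gen A by move=> /asboolP.
apply: h => [|a x y /asboolP hx /asboolP hy|//]; first exact/asboolP/cent0.
by apply/asboolP; apply: cent_linear.
Qed.

Lemma cmkE c : is_centroid A c -> cval (cmk c) = c.
Proof.
move=> hc; apply: (insubdK (0 : spanT (cent_gen A))).
rewrite unfold_in; apply/asboolP => Q _ _; apply.
by rewrite unfold_in; apply/asboolP.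
Qed.

Lemma cval_ext c d : cval c =1 cval d -> c = d.
Proof. by move=> h; apply: val_inj; apply: functional_extensionality. Qed.

Lemma cval_lin a c d x : cval (a *: c + d) x = a *: cval c x + cval d x.
Proof. by []. Qed.

Lemma cval_mul c d x : cval (gmul C c d) x = cval c (cval d x).
Proof.
have h := cent_comp_closed (cval_cent c) (cval_cent d).
by rewrite -[gmul C c d]/(cmk (cval c \o cval d)) cmkE.
Qed.

Lemma ccompP c g : reflect (centroid_deg A g (cval c)) (c \in gcomp C g).
Proof. exact: asboolP. Qed.

Lemma cval_sum (I : Type) (r : seq I) (f : I -> gcar C) x :
  cval (\sum_(i <- r) f i) x = \sum_(i <- r) cval (f i) x.
Proof. by elim: r => [|i r IH]; rewrite ?big_nil ?big_cons //= -IH. Qed.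
End CentroidAlgebra.

(** * The graded centroid of a loop algebra as a twisted group algebra *)

Section LoopCentroidAlgebra.
Variables (F : fieldType) (G : zmodType) (H : subgrp G) (A : galg F (quot H)) (t : G -> G -> F).
Hypothesis gA : is_galg A.
Hypothesis tC : sym2cocycle t.
Hypothesis csA : central_simple A.
Local Notation L := (tloop (qproj H) A t).
Local Notation C := (centroid_alg L).
Local Notation K := (tgrpalg H (restr H t)).
Let gL : is_galg L := tloop_galg (@qprojD G H) gA t.
Let bL : bilinear_mul L := proj1 gL.
Let grL : is_grading L := proj2 gL.

(** A homogeneous centroid element is 0 or a nonzero multiple of an injective shift, so one nonzero
    vector [x] decides whether it vanishes. *)
Lemma homog_centroid_sep c k x y : is_centroid L c -> centroid_deg L k c ->
  x != 0 -> c x = 0 -> c y = 0.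
Proof.
move=> cC cD x0 cx; case: (boolP (k \in sg_pred H)) => kH; last exact: (centroid_out gA tC csA cC cD kH).
have [lam h] := centroid_in gA tC csA cC cD kH.
move: cx; rewrite !h => /eqP; rewrite scaler_eq0 => /orP [/eqP ->|]; first by rewrite scale0r.
rewrite -(lin0 (loop_shift_lin gA kH)) (inj_eq (loop_shift_inj gA tC kH)) => /eqP e.
by rewrite e eqxx in x0.
Qed.

(** By [homog_centroid_sep] a component of [c] vanishes once it kills one fixed [x0] of degree [g0].
    Hence only the degrees [h - g0] with [h] in the support of [c x0] occur, the same finite list
    for all [x]. *)
Lemma centroid_fin c : is_centroid L c -> exists s : seq G, uniq s /\
  forall x, c x = \sum_(k <- s) centroid_component c k x.
Proof.
move=> cC; have cL := cent_lin cC.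
have [x1 /(homog_nonzero grL) [g0 [x0 [x0g x0n]]]] := tloop_nonzero t gA csA.
pose s := undup [seq h - g0 | h <- (gdec (c x0)).1]; exists s; split; first exact: undup_uniq.
apply: (lin_ext grL) => // [a x y|g x xg].
  rewrite scaler_sumr -big_split; apply: eq_bigr => k _.
  by rewrite (cent_lin (centroid_component_cent gL k cC)).
rewrite (eq_bigr (fun k => proj L (k + g) (c x))); last by move=> k _; apply: centroid_componentH.
apply: (proj_ext grL) => h; rewrite (lin_sum (proj_lin grL h)).
rewrite (eq_bigr (fun k => if k == h - g then proj L h (c x) else 0)); last first.
  move=> k _; rewrite (projH grL h (proj_in grL (k + g) (c x))) -(inj_eq (addIr g) k) subrK.
  by case: eqP => // ->.
rewrite big_single ?undup_uniq //; case: ifP => // /negbT hs.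
suff : centroid_component c (h - g) x = 0 by rewrite (centroid_componentH gL _ cL xg) subrK.
apply: (@homog_centroid_sep _ (h - g) x0 x (centroid_component_cent gL _ cC) _ x0n).
  exact: centroid_component_deg.
rewrite (centroid_componentH gL _ cL x0g); apply: proj_out.
apply: contra hs => hs; rewrite mem_undup; apply/mapP.
by exists (h - g + g0) => //; rewrite addrK.
Qed.

Lemma centroid_alg_galg : is_galg C.
Proof.
split; [split=> a x y z|split; [|split; [|split]]].
- by apply: cval_ext => u; rewrite cval_lin !cval_mul.
- by apply: cval_ext => u; rewrite cval_lin !cval_mul // cval_lin (cent_lin (cval_cent gL z)).
- move=> g; split=> [|a c d /ccompP hc /ccompP hd]; apply/ccompP => h x xh.
    exact: (comp0 grL).
  by rewrite cval_lin; apply: (comp_sub grL _).2; [apply: hc|apply: hd].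
- move=> c; have cC := cval_cent gL c; have [s [us sE]] := centroid_fin cC.
  exists s, (fun k => cmk (centroid_component (cval c) k)); split=> [k|].
    apply/ccompP; rewrite (cmkE (centroid_component_cent gL k cC)).
    exact: (centroid_component_deg gL _ (cent_lin cC)).
  apply: cval_ext => x; rewrite cval_sum sE; apply: eq_bigr => k _.
  by rewrite (cmkE (centroid_component_cent gL k cC)).
- move=> s f us fC s0 g gs; apply: cval_ext.
  apply: (lin_ext grL); [exact: (cent_lin (cval_cent gL _))|exact: (cent_lin (cval_cent gL _))|].
  move=> h x xh; have z : \sum_(k <- s) cval (f k) x = 0 by rewrite -cval_sum s0.
  (* Evaluation at [x] of degree [h] turns a relation in the centroid into one in [L] between
     elements of the distinct degrees [k + h]. *)
  pose f' k := cval (f (k - h)) x.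
  have f'E k : f' (k + h) = cval (f k) x by rewrite /f' addrK.
  change (cval (f g) x = 0); rewrite -f'E.
  apply: (grading_direct grL (s := [seq k + h | k <- s]) (f := f')).
  - by rewrite map_inj_uniq //; apply: addIr.
  - by move=> k; rewrite /f' -{2}(subrK h k); move/ccompP: (fC (k - h)); apply.
  - by rewrite big_map (eq_bigr _ (fun k _ => f'E k)).
  - by apply/mapP; exists g.
- move=> g h c d /ccompP cg /ccompP dh; apply/ccompP => k x xk.
  by rewrite cval_mul // -addrA; apply/cg/dh.
Qed.

Lemma centroid_tloop_iso : giso C K.
Proof.
apply: giso_sym; have gK := tgrpalg_galg H (restr H t).
have [x1 x1n] := tloop_nonzero t gA csA.
pose phi g (x : gcar K) : gcar C :=
  if g \in sg_pred H then (grp_at x g : F) *: cmk (loop_shift (t := t) (A := A) g) else 0.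
have phiE g x y : g \in sg_pred H -> cval (phi g x) y = grp_at x g *: loop_shift g y.
  by move=> gH; rewrite /phi gH -[in RHS](cmkE (loop_shift_cent gA tC gH)).
have tE g h : g \in sg_pred H -> h \in sg_pred H -> restr H t g h = t g h.
  by rewrite /restr => -> ->.
apply: (@giso_intro _ _ K C phi gK centroid_alg_galg).
- move=> g a x y _ _; rewrite /phi; case: ifP => _; last by rewrite scaler0 addr0.
  by rewrite grp_at_lin scalerDl scalerA.
- move=> g x xg; rewrite /phi; case: ifP => gH; last exact: (comp0 (proj2 centroid_alg_galg)).
  apply: (subZs (comp_sub (proj2 centroid_alg_galg) _)); apply/ccompP.
  by rewrite (cmkE (loop_shift_cent gA tC gH)); apply: loop_shift_deg.
- move=> g x xg; case: (boolP (g \in sg_pred H)) => gH e; last exact: grp_comp_out xg gH.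
  have : cval (phi g x) x1 = 0 by rewrite e.
  rewrite phiE // => /eqP; rewrite scaler_eq0 -(lin0 (loop_shift_lin gA gH)).
  rewrite (inj_eq (loop_shift_inj gA tC gH)) (negbTE x1n) orbF => /eqP z.
  rewrite (grp_compE xg) z.
  have z0 : 0 \in gcomp K g := comp0 (proj2 gK) g.
  by rewrite (grp_compE z0).
- move=> g y /ccompP yg; have yC := cval_cent gL y.
  case: (boolP (g \in sg_pred H)) => gH.
    have [lam lamE] := centroid_in gA tC csA yC yg gH.
    exists (grp_delta H (restr H t) g lam); first exact: grp_delta_comp.
    by apply: cval_ext => x; rewrite phiE // grp_delta_at // lamE.
  exists 0; first exact: (comp0 (proj2 gK) g).
  rewrite /phi (negbTE gH); apply: cval_ext => x.
  by rewrite (centroid_out gA tC csA yC yg gH).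
move=> g h x y xg yh; have bC := proj1 centroid_alg_galg.
case: (boolP (g \in sg_pred H)) => gH; last first.
  rewrite (grp_comp_out xg gH) (gmul0l (proj1 gK)) /phi (negbTE gH) (gmul0l bC).
  by case: ifP => // _; rewrite -[grp_at 0 _]/(0 : F) scale0r.
case: (boolP (h \in sg_pred H)) => hH; last first.
  rewrite (grp_comp_out yh hH) (gmul0r (proj1 gK)) /phi (negbTE hH) (gmul0r bC).
  by case: ifP => // _; rewrite -[grp_at 0 _]/(0 : F) scale0r.
have ghH := sgD gH hH.
apply: cval_ext => u; rewrite cval_mul // !phiE // (linZ (loop_shift_lin gA gH)) loop_shift_mul //.
rewrite {1}(grp_compE xg) {1}(grp_compE yh) grp_delta_mul // tE //.
rewrite -[t g h *: _]addr0 grp_at_lin grp_delta_at // -[grp_at 0 _]/(0 : F) addr0.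
by rewrite !scalerA; congr (_ *: _); rewrite mulrC.
Qed.
End LoopCentroidAlgebra.

(** * Descent to [G/H] of a cocycle trivialised on [H] *)

Section CocycleDescent.
Variables (F : fieldType) (G : zmodType) (H : subgrp G) (sg : G -> G -> F) (lam : G -> F).
Hypothesis sgC : sym2cocycle sg.
Hypothesis lam0 : forall h, h \in sg_pred H -> lam h != 0.
Hypothesis lamM : forall h k, h \in sg_pred H -> k \in sg_pred H ->
  sg h k * lam (h + k) = lam h * lam k.
Local Notation pi := (qproj H).

(** [lam] trivialises [sg] on [H x H]. The cochain [gam] on [G] is chosen compatible with [lam], so
    that [sg] divided by its coboundary is constant on [H x G]; the cocycle identity then makes the
    quotient invariant under [H], hence inflated from [G/H]. *)
Lemma cocycle_descent : exists (gam : G -> F) (mu : quot H -> quot H -> F),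
  [/\ forall g, gam g != 0, sym2cocycle mu,
      forall a b, sg a b * gam (a + b) = mu (pi a) (pi b) * (gam a * gam b) &
      forall h g, h \in sg_pred H -> sg h g * gam (h + g) = lam h * gam g].
Proof.
have sg0 := coc_neq0 sgC.
pose s g := q_val (pi g).
have sH g : g - s g \in sg_pred H by apply: qproj_sub_val.
(* This value is forced by [gamS] for the pair [g - s g], [s g] once [gam (s g)] is to be 1. *)
pose gam g := lam (g - s g) / sg (g - s g) (s g).
have gam0 g : gam g != 0 by rewrite mulf_neq0 ?invr_eq0 ?lam0.
have gamS h g : h \in sg_pred H -> sg h g * gam (h + g) = lam h * gam g.
  move=> hH; have e : s (h + g) = s g by rewrite /s qprojD (qproj0 hH) add0r.
  rewrite /gam e -addrA; set r := g - s g.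
  have rg : r + s g = g by rewrite subrK.
  have e1 := lamM hH (sH g); have e2 := cocA sgC h r (s g).
  rewrite rg in e2; rewrite -/r in e1.
  apply: (mulfI (mulf_neq0 (sg0 h r) (sg0 (h + r) (s g)))).
  transitivity (sg h g * (sg h r * lam (h + r))).
    by field; rewrite sg0.
  by rewrite e1 e2; field; rewrite sg0.
pose M a b := sg a b * gam (a + b) / (gam a * gam b).
have M0 a b : M a b != 0 by apply: (mulf_neq0 (mulf_neq0 (sg0 _ _) (gam0 _))); rewrite invr_eq0 (mulf_neq0 (gam0 a)).
have Msym a b : M a b = M b a by rewrite /M (coc_sym sgC) addrC [gam a * _]mulrC.
have MA a b c : M a b * M (a + b) c = M a (b + c) * M b c.
  rewrite /M -addrA; have e := cocA sgC a b c.
  transitivity (sg a b * sg (a + b) c * gam (a + (b + c)) / (gam a * gam b * gam c)).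
    by field; rewrite !gam0.
  by rewrite e; field; rewrite !gam0.
(* By [gamS] at [g] and at 0 the value depends on neither [h] nor [g]; it need not be 1, as [sg] is
   not normalised. *)
have MH h g : h \in sg_pred H -> M h g = sg 0 0 / gam 0.
  move=> hH; have e0 := gamS h 0 hH; rewrite (coc0r sgC) addr0 in e0.
  rewrite /M gamS //; apply: (mulIf (mulf_neq0 (gam0 h) (gam0 0))).
  transitivity (lam h * gam 0); first by field; rewrite !gam0.
  by rewrite -e0; field; rewrite gam0.
(* In the cocycle identity at [h], [g], [g'] the two factors with first argument [h] are this same
   constant and cancel. *)
have MHl h g g' : h \in sg_pred H -> M (h + g) g' = M g g'.
  move=> hH; have := MA h g g'; rewrite !(MH h) // => /mulfI; apply.
  by rewrite mulf_neq0 ?invr_eq0.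
have Ml a a' b : pi a = pi a' -> M a b = M a' b.
  by move=> /eqP; rewrite qproj_eqE => h; rewrite -(subrK a' a) MHl.
have ME a a' b b' : pi a = pi a' -> pi b = pi b' -> M a b = M a' b'.
  by move=> ha hb; rewrite (Ml a a' b ha) Msym (Ml b b' a' hb) Msym.
exists gam, (fun a b => M (q_val a) (q_val b)); split=> // [|a b].
  split=> [a b|]; first exact: M0.
  split=> [a b c|a b]; last exact: Msym.
  have E (x y : quot H) : M (q_val (x + y)) =1 M (q_val x + q_val y).
    by move=> z; apply: (Ml (q_val (x + y)) (q_val x + q_val y)); exact: qproj_val.
  by rewrite E [M (q_val a) (q_val (b + c))]Msym E [M _ (q_val a)]Msym MA.
rewrite (ME _ a _ b) ?qproj_val // /M; field.
by rewrite !gam0.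
Qed.
End CocycleDescent.

(** * Recovering the subgroup, the cocycle class and the base from a loop algebra *)

Section IsoTransfer.
Variables (F : fieldType) (G : zmodType).
Implicit Types A B : galg F G.

(** The support of the graded centroid. It is preserved by graded isomorphisms and equals [H] for
    the loop algebra of a central simple algebra, so it recovers [H]. *)
Definition cent_supp A (k : G) := exists c : gcar A -> gcar A,
  [/\ is_centroid A c, centroid_deg A k c & exists x, c x != 0].

Lemma giso_centroid A B (f : gcar A -> gcar B) (f' : gcar B -> gcar A) c k :
  lin f -> cancel f f' -> cancel f' f ->
  (forall x y, f (gmul A x y) = gmul B (f x) (f y)) ->
  (forall g x, x \in gcomp A g -> f x \in gcomp B g) ->
  (forall g y, y \in gcomp B g -> exists2 x, x \in gcomp A g & f x = y) ->
  is_centroid A c -> centroid_deg A k c ->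
  is_centroid B (fun y => f (c (f' y))) /\ centroid_deg B k (fun y => f (c (f' y))).
Proof.
move=> fL fK f'K fM fA fB [cL cM] cD.
have f'L : lin f' by move=> a x y; apply: (can_inj fK); rewrite fL !f'K.
have f'M x y : f' (gmul B x y) = gmul A (f' x) (f' y).
  by apply: (can_inj fK); rewrite fM !f'K.
split; last by move=> g _ /fB [x xg <-]; rewrite fK; apply/fA/cD.
split=> [a x y|x y]; first by rewrite f'L cL fL.
by rewrite f'M {1}(cM _ _).1 (cM _ _).2 !fM !f'K.
Qed.

Lemma giso_cent_supp A B k : giso A B -> cent_supp A k -> cent_supp B k.
Proof.
move=> [f [fL [[f' fK f'K] [fM [fA fB]]]]] [c [cC cD [x cx]]].
have [h1 h2] := giso_centroid fL fK f'K fM fA fB cC cD.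
exists (fun y => f (c (f' y))); split=> //; exists (f x); rewrite fK.
by rewrite -(lin0 (f := f)) // (inj_eq (can_inj fK)).
Qed.
End IsoTransfer.

Lemma cent_supp_tloop (F : fieldType) (G : zmodType) (H : subgrp G) (A : galg F (quot H))
    (t : G -> G -> F) k :
  is_galg A -> central_simple A -> sym2cocycle t ->
  cent_supp (tloop (qproj H) A t) k <-> k \in sg_pred H.
Proof.
move=> gA csA tC; split=> [[c [cC cD [x cx]]]|kH].
  by apply: contraT => kH; rewrite (centroid_out gA tC csA cC cD kH) eqxx in cx.
exists (loop_shift k); split; [exact: loop_shift_cent|exact: loop_shift_deg|].
have [x x0] := tloop_nonzero t gA csA; exists x.
by rewrite -(lin0 (loop_shift_lin gA kH)) (inj_eq (loop_shift_inj gA tC kH)).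
Qed.

Lemma tloop_iso_subgrp (F : fieldType) (G : zmodType) (H1 H2 : subgrp G)
    (A1 : galg F (quot H1)) (A2 : galg F (quot H2)) (t1 t2 : G -> G -> F) :
  is_galg A1 -> central_simple A1 -> is_galg A2 -> central_simple A2 ->
  sym2cocycle t1 -> sym2cocycle t2 ->
  giso (tloop (qproj H1) A1 t1) (tloop (qproj H2) A2 t2) ->
  sg_pred H1 =i sg_pred H2.
Proof.
move=> g1 c1 g2 c2 tC1 tC2 i k; apply/idP/idP.
  move=> /(cent_supp_tloop k g1 c1 tC1) /(giso_cent_supp i).
  by move=> /(cent_supp_tloop k g2 c2 tC2).
move=> /(cent_supp_tloop k g2 c2 tC2) /(giso_cent_supp (giso_sym i)).
by move=> /(cent_supp_tloop k g1 c1 tC1).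
Qed.

Section LoopIso.
Variables (F : fieldType) (G : zmodType) (H : subgrp G) (A1 A2 : galg F (quot H)).
Variables (t1 t2 : G -> G -> F).
Hypotheses (gA1 : is_galg A1) (gA2 : is_galg A2).
Hypotheses (csA1 : central_simple A1) (csA2 : central_simple A2).
Hypotheses (tC1 : sym2cocycle t1) (tC2 : sym2cocycle t2).
Local Notation pi := (qproj H).
Local Notation piD := (@qprojD G H).
Local Notation L1 := (tloop pi A1 t1).
Local Notation L2 := (tloop pi A2 t2).
Local Notation dl1 := (@loop_delta F G _ pi A1 t1).
Local Notation dl2 := (@loop_delta F G _ pi A2 t2).
Let gL1 : is_galg L1 := tloop_galg piD gA1 t1.
Let gL2 : is_galg L2 := tloop_galg piD gA2 t2.

(** The cochain [gam] of [cocycle_descent] serves twice: it relates the two cocycles, and it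
    rescales [f] so that the coefficient maps [E g] depend only on [pi g] and hence glue to a map on
    [A1], multiplicative for the twist by [mu]. *)
Lemma tloop_iso_twist : giso L1 L2 -> exists mu : quot H -> quot H -> F,
  [/\ sym2cocycle mu, cohomologous t1 (fun a b => mu (pi a) (pi b) * t2 a b) &
      giso (twist A1 mu) A2].
Proof.
move=> [f [fL [[f' fK f'K] [fM [fA fB]]]]].
have [x1 x1n] := tloop_nonzero t1 gA1 csA1.
have fI x : f x = 0 -> x = 0 by move=> e; apply: (can_inj fK); rewrite e (lin0 fL).
have /fun_choice [lam lamE] : forall h, exists l : F, h \in sg_pred H ->
    forall x, f (loop_shift h x) = l *: loop_shift h (f x).
  move=> h; case: (boolP (h \in sg_pred H)) => hH; last by exists 0.
  have [c1 c2] := giso_centroid fL fK f'K fM fA fB (loop_shift_cent gA1 tC1 hH) (loop_shift_deg gA1 hH).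
  have [l lE] := centroid_in gA2 tC2 csA2 c1 c2 hH.
  by exists l => _ x; rewrite -lE fK.
have lam0 h : h \in sg_pred H -> lam h != 0.
  move=> hH; apply: contraNneq x1n => l0; apply/eqP/(loop_shift_inj gA1 tC1 hH)/(can_inj fK).
  by rewrite !lamE // l0 !scale0r.
pose sg a b := t1 a b / t2 a b.
have n1 := coc_neq0 tC1; have n2 := coc_neq0 tC2.
have sgC : sym2cocycle sg.
  split=> [a b|]; first by rewrite mulf_neq0 ?invr_eq0.
  split=> [a b c|a b]; last by rewrite /sg (coc_sym tC1) (coc_sym tC2).
  by rewrite /sg mulf_div (cocA tC1) (cocA tC2) mulf_div.
have sgE a b : sg a b * t2 a b = t1 a b by rewrite /sg divfK.
have lamM h k : h \in sg_pred H -> k \in sg_pred H -> sg h k * lam (h + k) = lam h * lam k.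
  move=> hH kH; have hkH := sgD hH kH.
  have := lamE h hH (loop_shift k x1); rewrite (lamE k) // loop_shift_mul // (linZ fL) lamE //.
  rewrite (linZ (loop_shift_lin gA2 hH)) loop_shift_mul // !scalerA -sgE => /eqP.
  rewrite -subr_eq0 -scalerBl scaler_eq0 => /orP [|/eqP e].
    rewrite subr_eq0 => /eqP e; apply: (mulIf (n2 h k)); rewrite -e; ring.
  case/eqP: x1n; apply/fI/(loop_shift_inj gA2 tC2 hkH); by rewrite e (lin0 (loop_shift_lin gA2 hkH)).
have [gam [mu [gam0 muC muE gamS]]] := cocycle_descent sgC lam0 lamM.
exists mu; split=> //.
  exists gam; split=> // a b; rewrite -sgE; apply: (mulIf (gam0 (a + b))).
  transitivity (sg a b * gam (a + b) * t2 a b); first ring.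
  by rewrite muE; field; rewrite gam0.
pose E g v := (gam g)^-1 *: loop_at (f (dl1 g v)) g.
have fE g v : v \in gcomp A1 (pi g) -> f (dl1 g v) = gam g *: dl2 g (E g v).
  move=> vg; rewrite {1}(loop_compE (fA _ _ (loop_delta_comp t1 vg))) -(loop_deltaZ gA2).
    by rewrite scalerA divff ?scale1r.
  by apply: (subZs (comp_sub (proj2 gA2) _)); apply: loop_at_in.
have E_in g v : E g v \in gcomp A2 (pi g).
  by apply: (subZs (comp_sub (proj2 gA2) _)); apply: loop_at_in.
have E_lin g : lin_on (gcomp A1 (pi g)) (E g).
  move=> a x y xg yg; rewrite /E (loop_delta_lin gA1) // fL loop_at_lin scalerDr !scalerA.
  by rewrite [_^-1 * a]mulrC.
have EE g v : E g v = (gam g)^-1 *: loop_at (f (dl1 g v)) g by [].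
clearbody E.
have dl2_inj g v w : v \in gcomp A2 (pi g) -> w \in gcomp A2 (pi g) -> dl2 g v = dl2 g w -> v = w.
  by move=> vg wg e; rewrite -(loop_delta_at t2 vg) e loop_delta_at.
(* Degrees in one coset are linked by the shift by [g' - g]; commuting it past [f] costs
   [lam (g' - g)], which [gamS] balances against [gam g] and [gam g']. *)
have E_shift g g' v : pi g = pi g' -> v \in gcomp A1 (pi g) -> E g v = E g' v.
  move=> e vg; have hH : g' - g \in sg_pred H by rewrite -qproj_eqE e.
  have := lamE (g' - g) hH (dl1 g v); rewrite loop_shift_dl // (linZ fL) subrK !fE -?e //.
  rewrite (linZ (loop_shift_lin gA2 hH)) loop_shift_dl // subrK !scalerA -sgE.
  have <- : lam (g' - g) * gam g * t2 (g' - g) g = sg (g' - g) g * t2 (g' - g) g * gam g'.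
    by rewrite -gamS // subrK; ring.
  move/(scalerI _) => e'; apply: (@dl2_inj g'); rewrite -?e //; last first.
    by apply/esym/e'; rewrite !mulf_neq0 ?lam0.
  by rewrite e; apply: E_in.
have E_mul g h v w : v \in gcomp A1 (pi g) -> w \in gcomp A1 (pi h) ->
    mu (pi g) (pi h) *: E (g + h) (gmul A1 v w) = gmul A2 (E g v) (E h w).
  move=> vg wh; have vw : gmul A1 v w \in gcomp A1 (pi (g + h)).
    by rewrite qprojD; apply: comp_mul => //; case: gA1.
  have := fM (dl1 g v) (dl1 h w); rewrite (loop_delta_mul piD) // (linZ fL) !fE //.
  rewrite (gmulZl (proj1 gL2)) (gmulZr (proj1 gL2)) (loop_delta_mul piD) // !scalerA.
  have -> : t1 g h * gam (g + h) = (gam g * gam h * t2 g h) * mu (pi g) (pi h).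
    by rewrite -sgE mulrAC muE; ring.
  rewrite -[LHS]scalerA => /(scalerI _) e; apply: (@dl2_inj (g + h)).
  - by apply: (subZs (comp_sub (proj2 gA2) _)).
  - by rewrite qprojD; apply: comp_mul => //; case: gA2.
  by rewrite (loop_deltaZ gA2) // e // !mulf_neq0.
case: (gA1) => bA1 grA1.
apply: (@giso_intro _ _ (twist A1 mu) A2 (fun a => E (q_val a))) => //.
- exact: twist_galg.
- by move=> a; rewrite -[gcomp _ a]/(gcomp A1 a) -{1}(qproj_val a); apply: E_lin.
- by move=> a x _; rewrite -{2}(qproj_val a); apply: E_in.
- move=> a x xa e; have xa' : x \in gcomp A1 (pi (q_val a)) by rewrite qproj_val.
  have := fE _ _ xa'; rewrite e (loop_delta0 pi gA2) scaler0 => /fI e'.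
  by have := @loop_delta_at _ _ _ pi A1 t1 _ _ xa'; rewrite e' => <-.
- move=> a y ya; have ya' : y \in gcomp A2 (pi (q_val a)) by rewrite qproj_val.
  have [x xg xE] := fB _ _ (loop_delta_comp t2 ya'); have xA := loop_at_in gA1 x (q_val a).
  exists (gam (q_val a) *: loop_at x (q_val a)).
    by rewrite qproj_val in xA; apply: (subZs (comp_sub grA1 a)).
  by rewrite EE (loop_deltaZ gA1) // (linZ fL) -(loop_compE xg) xE
    (linZ (loop_at_lin _)) loop_delta_at // scalerA mulVf ?scale1r.
move=> a b x y xa yb; rewrite (twist_mulH grA1 bA1 _ xa yb).
have xa' : x \in gcomp A1 (pi (q_val a)) by rewrite qproj_val.
have yb' : y \in gcomp A1 (pi (q_val b)) by rewrite qproj_val.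
rewrite -E_mul // !qproj_val (lin_onZ _ (comp0 grA1 _) (@E_lin _)); last first.
  by rewrite qproj_val; apply: comp_mul.
congr (_ *: _); apply: E_shift; first by rewrite qprojD !qproj_val.
by rewrite qproj_val; apply: comp_mul.
Qed.

Lemma twist_iso_tloop (mu : quot H -> quot H -> F) :
  cohomologous t1 (fun a b => mu (pi a) (pi b) * t2 a b) ->
  giso (twist A1 mu) A2 -> giso L1 L2.
Proof.
move=> [gam [gam0 gamE]] [f [fL [[f' fK f'K] [fM [fA fB]]]]].
case: (gA1) => bA1 grA1.
pose phi g (x : gcar L1) : gcar L2 := gam g *: dl2 g (f (loop_at x g)).
have fin (x : gcar L1) g : f (loop_at x g) \in gcomp A2 (pi g) := fA (pi g) (loop_at x g) (loop_at_in gA1 x g).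
have phi_dl g v : v \in gcomp A1 (pi g) -> phi g (dl1 g v) = gam g *: dl2 g (f v).
  by move=> vg; rewrite /phi loop_delta_at.
apply: (@giso_intro _ _ L1 L2 phi gL1 gL2) => g.
- move=> a x y _ _; rewrite /phi loop_at_lin fL (loop_delta_lin gA2) // scalerDr !scalerA.
  by rewrite mulrC.
- by move=> x xg; apply: (subZs (comp_sub (proj2 gL2) _)); apply: loop_delta_comp.
- move=> x xg /eqP; rewrite scaler_eq0 (negbTE (gam0 g)) /= => /eqP e.
  rewrite (loop_compE xg); suff -> : loop_at x g = 0 by rewrite (loop_delta0 pi gA1).
  apply: (can_inj fK); rewrite (lin0 fL) -(loop_delta_at t2 (fin x g)) e.
  by [].
- move=> y yg; have [x xg xE] := fB _ _ (loop_at_in gA2 y g).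
  exists ((gam g)^-1 *: dl1 g x).
    by apply: (subZs (comp_sub (proj2 gL1) _)); apply: loop_delta_comp.
  rewrite /phi (linZ (loop_at_lin _)) loop_delta_at // (linZ fL) xE (loop_deltaZ gA2) //; last exact: loop_at_in.
  by rewrite scalerA divff // scale1r -(loop_compE yg).
move=> h x y xg yh; have xA := loop_at_in gA1 x g; have yA := loop_at_in gA1 y h.
have xyA : gmul A1 (loop_at x g) (loop_at y h) \in gcomp A1 (pi (g + h)).
  by rewrite qprojD; apply: comp_mul.
rewrite {1}(loop_compE xg) {1}(loop_compE yh) (loop_delta_mul piD) // -(loop_deltaZ gA1) // phi_dl; last first.
  exact: (subZs (comp_sub grA1 _)).
rewrite /phi (gmulZl (proj1 gL2)) (gmulZr (proj1 gL2)) (loop_delta_mul piD) //.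
rewrite -fM (twist_mulH grA1 bA1 _ xA yA) !(linZ fL) !(loop_deltaZ gA2) //; last 2 first.
- exact: fA.
- exact: fA.
rewrite !scalerA gamE; congr (_ *: _); field.
by rewrite gam0.
Qed.
End LoopIso.

(** * Extension of symmetric cocycles from a subgroup *)

(** Partial extensions carry only a preorder, as their values off the subgroup are arbitrary;
    maximality is therefore up to equivalence. Classical equality turns [T] into an [eqType]. *)
Lemma zorn_preorder (T : Type) (R : rel T) : reflexive R -> transitive R ->
  (forall C : pred T, {in C &, total R} -> exists z, forall x, C x -> R x z) ->
  exists z, forall x, R z x -> R x z.
Proof.
move=> Rxx Rtr Rch.
have eqTP : Equality.axiom (fun x y : T => asbool (x = y)) by move=> x y; apply: asboolP.
pose eT : eqType := HB.pack T (hasDecEq.Build T eqTP).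
have [||C _ /(@wochoice.wo_chainW eT) /Rch [z zC]|z _ zmax] :=
  @wochoice.Zorn's_lemma eT R predT.
- by move=> x _; apply: Rxx.
- by move=> y x z _ _ _; apply: Rtr.
- by exists z.
by exists z => x; apply: zmax.
Qed.

Section CocycleExtension.
Variables (F : fieldType) (G : zmodType).
Implicit Types (K : subgrp G) (t : G -> G -> F).

Definition pcocycle (P : pred G) t := [/\ forall a b, a \in P -> b \in P -> t a b != 0,
  forall a b c, a \in P -> b \in P -> c \in P ->
    t a b * t (a + b) c = t a (b + c) * t b c &
  forall a b, a \in P -> b \in P -> t a b = t b a].

Lemma sgMn K x n : x \in sg_pred K -> x *+ n \in sg_pred K.
Proof.
by move=> xK; elim: n => [|n IH]; rewrite ?mulr0n ?sg0 // mulrS; apply: sgD.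
Qed.

Lemma sgMz K x n : x \in sg_pred K -> x *~ n \in sg_pred K.
Proof.
move=> xK; case: n => n; rewrite ?NegzE ?mulrNz; first exact: sgMn.
by apply: sgN; apply: sgMn.
Qed.

Lemma mulz_rem (x : G) (m q r : int) (N : nat) :
  m = q * N + r -> x *~ r = x *~ m - x *+ N *~ q.
Proof.
by move=> ->; rewrite mulrzDr pmulrn -mulrzA [N%:Z * _]mulrC addrAC subrr add0r.
Qed.

Section Step.
Variables (K : subgrp G) (t : G -> G -> F) (g : G).
Hypothesis tC : pcocycle (sg_pred K) t.
Let Kp := sg_pred K.

(** [N] is the order of [g] modulo [K], with 0 standing for infinite order. This suits integer
    division: a remainder modulo 0 is the number itself and a quotient by 0 is 0, so no carries
    occur. *)
Lemma order_mod : exists N : nat, g *+ N \in Kp /\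
  forall m : int, g *~ m \in Kp -> (N %| m)%Z.
Proof.
case: (excluded_middle_informative (exists n, (0 < n)%N && (g *+ n \in Kp))) => [h|h].
  case: (ex_minnP h) => N /andP [N0 NK] min; exists N; split=> // m mK.
  have e := divz_eq m N; apply/dvdz_mod0P/eqP; rewrite -absz_eq0; apply/negP => /negP.
  have Nn0 : (N : int) != 0 by rewrite -lt0n.
  have := modz_ge0 m Nn0; have := ltz_mod m Nn0.
  have rK : g *~ (m %% N)%Z \in Kp.
    by rewrite (mulz_rem g e); apply: sgB => //; apply: sgMz.
  case: (m %% N)%Z rK => // r rK; rewrite /= => rN _ r0.
  have := min r; rewrite lt0n r0 rK => /(_ isT); rewrite leqNgt => /negP; apply.
  by [].

exists 0%N; split=> [|m mK]; first by rewrite mulr0n sg0.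
rewrite dvd0z; apply/negP => /negP m0; apply: h; exists `|m|%N; rewrite absz_gt0 m0 /=.
case: m mK {m0} => n //; rewrite NegzE mulrNz => h; rewrite abszN absz_nat.
by rewrite -[_ *+ _]opprK; apply: sgN.
Qed.

(** A pair [(x, a)] stands for the monomial [a X_x] of the twisted group algebra of [K]. *)
Let mulE (p q : G * F) : G * F := (p.1 + q.1, p.2 * q.2 * t p.1 q.1).
Let scE (l : F) (p : G * F) : G * F := (p.1, l * p.2).

Let mulEA p q r : p.1 \in Kp -> q.1 \in Kp -> r.1 \in Kp ->
  mulE p (mulE q r) = mulE (mulE p q) r.
Proof.
move=> pK qK rK; rewrite /mulE /= addrA; congr (_, _).
case: tC => _ /(_ p.1 q.1 r.1 pK qK rK) e _.
transitivity (p.2 * q.2 * r.2 * (t p.1 (q.1 + r.1) * t q.1 r.1)); first ring.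
by rewrite -e; ring.
Qed.

Let mulEC p q : p.1 \in Kp -> q.1 \in Kp -> mulE p q = mulE q p.
Proof.
by move=> pK qK; case: tC => _ _ h; rewrite /mulE addrC [p.2 * _]mulrC h.
Qed.

(* The product [X_(kx) X_(ky) X_(k0)^(eps x y)] in the twisted group algebra of [K]; its
   coefficient is the extended cocycle, so the cocycle identity is associativity. *)
Lemma pcocycle_transport (K' : subgrp G) (kap : G -> G) (eps : G -> G -> nat) (k0 : G) :
  k0 \in Kp -> (forall x, x \in sg_pred K' -> kap x \in Kp) ->
  (forall x y, x \in sg_pred K' -> y \in sg_pred K' ->
     kap (x + y) = kap x + kap y + k0 *+ eps x y) ->
  (forall x y, eps x y = eps y x) ->
  (forall x y z, x \in sg_pred K' -> y \in sg_pred K' -> z \in sg_pred K' ->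
     (eps x y + eps (x + y)%R z = eps x (y + z)%R + eps y z)%N) ->
  (forall x, x \in Kp -> kap x = x) ->
  (forall x y, x \in Kp -> y \in Kp -> eps x y = 0%N) ->
  exists t', pcocycle (sg_pred K') t' /\ forall a b, a \in Kp -> b \in Kp -> t' a b = t a b.
Proof.
move=> k0K kapK kapD epsC epsA kap_id eps0.
pose M := mulE (k0, 1).
have M1 p : (M p).1 = k0 + p.1 by [].
have iterK n p : p.1 \in Kp -> (iter n M p).1 \in Kp.
  by move=> pK; elim: n => //= n IH; apply: sgD.
have iter1 n p : (iter n M p).1 = p.1 + k0 *+ n.
  by elim: n => [|n IH]; rewrite ?mulr0n ?addr0 //= IH mulrS addrCA.
have iterM n p q : p.1 \in Kp -> q.1 \in Kp ->
    iter n M (mulE p q) = mulE (iter n M p) q.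
  move=> pK qK; elim: n => //= n IH; rewrite IH /M mulEA //.
  exact: iterK.
have iterS n l p : iter n M (scE l p) = scE l (iter n M p).
  elim: n => //= n ->; rewrite /M /mulE /scE /=; congr (_, _); ring.
have mulES l p q : mulE (scE l p) q = scE l (mulE p q).
  by rewrite /mulE /scE /=; congr (_, _); ring.
pose X x : G * F := (kap x, 1).
have XK x : x \in sg_pred K' -> (X x).1 \in Kp by exact: kapK.
pose E x y := iter (eps x y) M (mulE (X x) (X y)).
pose t' x y := (E x y).2.
have EE x y : x \in sg_pred K' -> y \in sg_pred K' -> E x y = scE (t' x y) (X (x + y)).
  move=> xK yK; rewrite /scE /X /= mulr1 kapD // -[RHS]/(_, (E x y).2) [LHS]surjective_pairing.
  by congr (_, _); rewrite /E iter1.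
have Esym x y : x \in sg_pred K' -> y \in sg_pred K' -> E x y = E y x.
  by move=> xK yK; rewrite /E epsC mulEC ?XK.
(* The exponent collected here is the total carry of the three terms, which [epsA] shows to be
   independent of the bracketing. *)
have key x y z : x \in sg_pred K' -> y \in sg_pred K' -> z \in sg_pred K' ->
    t' x y * t' (x + y) z =
    (iter (eps (x + y)%R z + eps x y)%N M (mulE (mulE (X x) (X y)) (X z))).2.
  move=> xK yK zK; rewrite iterD iterM ?XK //; last exact: sgD (XK _ xK) (XK _ yK).
  by rewrite -/(E x y) EE // mulES iterS.
have tn0 a b : a \in Kp -> b \in Kp -> t a b != 0 by case: tC => h _ _; apply: h.
have M2 p : p.1 \in Kp -> p.2 != 0 -> (M p).2 != 0.
  by move=> pK p0; rewrite /M /mulE /= mul1r mulf_neq0 ?tn0.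
exists t'; split; last first.
  by move=> a b aK bK; rewrite /t' /E eps0 //= !kap_id // !mul1r.
split=> [a b aK bK|a b c aK bK cK|a b aK bK].
- have e : (mulE (X a) (X b)).2 != 0 by rewrite /mulE /= !mul1r tn0 ?kapK.
  have eK : (mulE (X a) (X b)).1 \in Kp by apply: sgD; apply: XK.
  rewrite /t' /E; elim: (eps a b) => //= n IH; apply: M2 => //.
  exact: iterK.
(* The right bracketing is rewritten as [t' b c * t' (b + c) a], to which [key] applies as well. *)
- rewrite key // -[t' a _]/((E a (b + c)).2) Esym ?sgD // -/(t' (b + c) a).
  rewrite [RHS]mulrC key // addnC epsA // [eps a _]epsC.
  by rewrite -mulEA ?XK // mulEC ?XK //; apply: sgD (XK _ bK) (XK _ cK).
- by rewrite /t' Esym.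
Qed.

(** For positive [N], a commuting symbol [Y] with [Y^N = X_(N g)] is in effect adjoined to the
    twisted group algebra of [K], and [X_x] becomes [X_(x - i g) Y^i], with [i = i x] a remainder
    modulo [N]. Carries in adding remainders produce powers of [X_(N g)], so the structure constants
    stay in [F] without extraction of roots. *)
Lemma pcocycle_adjoin : exists (K' : subgrp G) t',
  [/\ pcocycle (sg_pred K') t', {subset Kp <= sg_pred K'}, g \in sg_pred K' &
      forall a b, a \in Kp -> b \in Kp -> t' a b = t a b].
Proof.
have [N [NK Ndvd]] := order_mod.
pose P : pred G := fun x => asbool (exists n : int, x - g *~ n \in Kp).
have P0 : 0 \in P by apply/asboolP; exists 0; rewrite subr0 sg0.
have PB x y : x \in P -> y \in P -> x - y \in P.
  move=> /asboolP [n hn] /asboolP [m hm]; apply/asboolP; exists (n - m).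
  have -> : x - y - g *~ (n - m) = (x - g *~ n) - (y - g *~ m).
    by rewrite mulrzBr !opprB addrACA [RHS]addrACA; congr (_ + _); rewrite addrC.
  exact: sgB.
pose K' := SubGrp P0 PB.
have /fun_choice [n nE] : forall x, exists n : int, x \in P -> x - g *~ n \in Kp.
  move=> x; case: (boolP (x \in P)) => [/asboolP [n h]|_]; last by exists 0.
  by exists n.
pose i x := (n x %% N)%Z.
have i_uniq x m : x - g *~ m \in Kp -> i x = (m %% N)%Z.
  move=> h; have xP : x \in P by apply/asboolP; exists m.
  apply/eqP; rewrite /i eqz_mod_dvd; apply: Ndvd.
  have -> : g *~ (n x - m) = (x - g *~ m) - (x - g *~ n x).
    by rewrite mulrzBr opprB addrCA addrAC subrr add0r.
  by apply: sgB => //; apply: nE.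
have i_in x : x \in P -> x - g *~ i x \in Kp.
  move=> xP; have e := divz_eq (n x) N.
  by rewrite (mulz_rem g e) opprB addrCA addrC; apply: sgD; [apply: nE|apply: sgMz].
have i_ge0 x : (N != 0)%N -> 0 <= i x by move=> h; apply: modz_ge0.
have iD x y : x \in P -> y \in P -> i (x + y) = ((i x + i y) %% N)%Z.
  move=> xP yP; apply: i_uniq; rewrite mulrzDr opprD addrACA.
  by apply: sgD; apply: i_in.
(* The number of carries, 0 or 1. *)
pose eps x y := `|((i x + i y) %/ N)%Z|%N.
have epsE x y : x \in P -> y \in P -> (eps x y)%:Z * N = i x + i y - i (x + y).
  move=> xP yP; rewrite iD // {1}(divz_eq (i x + i y) N) addrK /eps.
  have [->|N0] := eqVneq N 0%N; first by rewrite !mulr0.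
  have Np : 0 < (N : int) by rewrite ltz_nat lt0n.
  by rewrite gez0_abs // (divz_ge0 _ Np) Num.Theory.addr_ge0 ?i_ge0.
have PD x y : x \in P -> y \in P -> x + y \in P := @sgD _ K' x y.
have [|||||||t' [t'C t'E]] := @pcocycle_transport K' (fun x => x - g *~ i x) eps (g *+ N).
- by [].
- exact: i_in.
- move=> x y xP yP; have -> : g *+ N *+ eps x y = g *~ (i x + i y - i (x + y)).
    by rewrite -epsE // mulrC mulrzA -!pmulrn.
  by rewrite mulrzBr mulrzDr [x - _ + _]addrACA -opprD addrA subrK.
- by move=> x y; rewrite /eps addrC.
- move=> x y z xP yP zP; have [N0|N0] := eqVneq N 0%N; first by rewrite /eps N0 !divz0.
  apply/eqP; rewrite -eqz_nat; apply/eqP.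
  have Nz : (N : int) != 0 by rewrite eqz_nat.
  apply: (mulIf Nz); rewrite !PoszD !mulrDl !epsE // ?PD // [x + (y + z)]addrA.
  move: (i x) (i y) (i z) (i (x + y)) (i (y + z)) (i (x + y + z)) => *; ring.
- by move=> x xK; rewrite (i_uniq x 0) ?mod0z ?subr0.
- by move=> x y xK yK; rewrite /eps (i_uniq x 0) ?(i_uniq y 0) ?subr0 // mod0z div0z.
exists K', t'; split=> //; first by move=> x xK; apply/asboolP; exists 0; rewrite subr0.
by apply/asboolP; exists 1; rewrite subrr sg0.
Qed.
End Step.

Lemma cocycle_extend (H : subgrp G) t0 : pcocycle (sg_pred H) t0 ->
  exists t, sym2cocycle t /\
    forall a b, a \in sg_pred H -> b \in sg_pred H -> t a b = t0 a b.
Proof.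
move=> t0C.
(* Subgroups enter as maps [G -> bool]: [subgrp G] and [pred G] live in too large a universe. *)
pose ok (p : (G -> bool) * (G -> G -> F)) := [/\ exists K : subgrp G, sg_pred K = p.1,
  pcocycle p.1 p.2, {subset sg_pred H <= p.1} &
  forall a b, a \in sg_pred H -> b \in sg_pred H -> p.2 a b = t0 a b].
pose T := {p | ok p}.
pose le (p q : (G -> bool) * (G -> G -> F)) := {subset p.1 <= q.1} /\
  forall a b, a \in p.1 -> b \in p.1 -> q.2 a b = p.2 a b.
pose R (p q : T) := asbool (le (sval p) (sval q)).
have H_ok : ok (sg_pred H, t0) by split=> //; exists H.
have RP (p q : T) : reflect (le (sval p) (sval q)) (R p q) by exact: asboolP.
have [| | |[[P t] Pok] max] := @zorn_preorder T R.
- by move=> p; apply/RP; split.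
- move=> q p r /RP [s1 e1] /RP [s2 e2]; apply/RP; split=> [x /s1 /s2 //|a b aK bK].
  by rewrite e2 ?s1 // e1.
- move=> A totA.
  case: (excluded_middle_informative (exists p, A p)) => [[p0 Ap0]|none]; last first.
    by exists (exist _ _ H_ok) => s As; case: none; exists s.
  pose P : pred G := fun x => asbool (exists p, A p /\ x \in (sval p).1).
  have join p q : A p -> A q -> exists r, [/\ A r, R p r & R q r].
    move=> Ap Aq; have Rr r : R r r by apply/RP; split.
    by case/orP: (totA p q Ap Aq) => h; [exists q|exists p].
  have P2 x y : x \in P -> y \in P -> exists p, [/\ A p, x \in (sval p).1 &
      y \in (sval p).1].
    move=> /asboolP [p [Ap xp]] /asboolP [q [Aq yq]].
    have [r [Ar /RP [pr _] /RP [qr _]]] := join p q Ap Aq.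
    by exists r; split=> //; [apply: pr|apply: qr].
  have PI p x : A p -> x \in (sval p).1 -> x \in P.
    by move=> Ap xp; apply/asboolP; exists p.
  have pD (p : T) x y : x \in (sval p).1 -> y \in (sval p).1 -> x + y \in (sval p).1.
    by case: (proj2_sig p) => -[K <-] _ _ _; apply: sgD.
  have P0 : 0 \in P.
    by apply: (PI p0) => //; case: (proj2_sig p0) => -[K <-] _ _ _; apply: sg0.
  have PB x y : x \in P -> y \in P -> x - y \in P.
    move=> xP yP; have [p [Ap xp yp]] := P2 x y xP yP; apply: (PI p) => //.
    by case: (proj2_sig p) xp yp => -[K <-] _ _ _; apply: sgB.
  (* Members of the chain defined at a pair agree there by directedness; [tt] picks the common value
     and is arbitrary where no member is defined. *)
  have /fun_choice [tt ttE] : forall ab : G * G, exists v : F, forall p, A p ->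
      ab.1 \in (sval p).1 -> ab.2 \in (sval p).1 -> (sval p).2 ab.1 ab.2 = v.
    move=> [a b] /=; case: (excluded_middle_informative
      (exists p, [/\ A p, a \in (sval p).1 & b \in (sval p).1])) => [|h].
      move=> [p [Ap ap bp]]; exists ((sval p).2 a b) => q Aq aq bq.
      have [r [Ar /RP [_ pr] /RP [_ qr]]] := join p q Ap Aq.
      by rewrite -pr // -qr.
    by exists 0 => p Ap ap bp; case: h; exists p.
  pose t a b := tt (a, b).
  have tE p a b : A p -> a \in (sval p).1 -> b \in (sval p).1 ->
    t a b = (sval p).2 a b by move=> Ap ap bp; rewrite (ttE (a, b) p Ap ap bp).
  have P3 x y z : x \in P -> y \in P -> z \in P -> exists p, [/\ A p, x \in (sval p).1,
      y \in (sval p).1 & z \in (sval p).1].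
    move=> xP yP /asboolP [q [Aq zq]]; have [p [Ap xp yp]] := P2 x y xP yP.
    have [r [Ar /RP [pr _] /RP [qr _]]] := join p q Ap Aq.
    by exists r; split=> //; [apply: pr|apply: pr|apply: qr].
  have P_ok : ok (P, t).
    split=> /=; first by exists (SubGrp P0 PB).
    - split=> [a b aK bK|a b c aK bK cK|a b aK bK].
      + have [p [Ap ap bp]] := P2 a b aK bK; rewrite (tE p) //.
        by case: (proj2_sig p) => _ [h _ _] _ _; apply: h.
      + have [p [Ap ap bp cp]] := P3 a b c aK bK cK; rewrite !(tE p) ?pD //.
        by case: (proj2_sig p) => _ [_ h _] _ _; apply: h.
      + have [p [Ap ap bp]] := P2 a b aK bK; rewrite !(tE p) //.
        by case: (proj2_sig p) => _ [_ _ h] _ _; apply: h.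
    - by move=> x xH; apply: (PI p0) => //; case: (proj2_sig p0) => _ _ h _; apply: h.
    - move=> a b aH bH; case: (proj2_sig p0) => _ _ h1 h2.
      by rewrite (tE p0) ?h1 // h2.
  exists (exist _ _ P_ok) => p Ap; apply/RP; split=> /= [x xp|a b ap bp]; first exact: PI xp.
  exact: tE.
have {}max q : ok q -> le (P, t) q -> {subset q.1 <= P}.
  by move=> qok h; have /RP [] := max (exist _ q qok) (introT (RP (exist _ _ Pok) (exist _ q qok)) h).
case: Pok max => -[/= K <-] tC HK tE max {P}.
have KT x : x \in sg_pred K.
  have [K' [t' [t'C KK' xK' t'E]]] := pcocycle_adjoin x tC.
  have K'_ok : ok (sg_pred K', t').
    split=> //= [|y yH|a b aH bH]; [by exists K'|exact/KK'/HK|].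
    by rewrite t'E ?HK //; apply: tE.
  exact: (max _ K'_ok (conj KK' t'E)).
exists t; split=> //; case: tC => h1 h2 h3.
by split=> [a b|]; [apply: h1|split=> [a b c|a b]; [apply: h2|apply: h3]].
Qed.
End CocycleExtension.

(** * Central simplicity of the base of a graded-central-simple loop algebra *)

Section LoopDescent.
Variables (F : fieldType) (G : zmodType) (H : subgrp G) (A : galg F (quot H)) (t : G -> G -> F).
Hypothesis gA : is_galg A.
Hypothesis tC : sym2cocycle t.
Local Notation pi := (qproj H).
Local Notation L := (tloop pi A t).
Local Notation piD := (@qprojD G H).
Local Notation dl := (@loop_delta F G _ pi A t).
Let bA : bilinear_mul A := proj1 gA.
Let grA : is_grading A := proj2 gA.
Let gL : is_galg L := tloop_galg piD gA t.
Let bL : bilinear_mul L := proj1 gL.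
Let grL : is_grading L := proj2 gL.
Hypothesis gcsL : graded_central_simple L.
Hypothesis suppL : forall k, cent_supp L k -> k \in sg_pred H.

Lemma loop_at_mul (Q : gcar A -> Prop) x y k : Q 0 -> (forall u v, Q u -> Q v -> Q (u + v)) ->
  (forall a g h, Q (a *: gmul A (loop_at x g) (loop_at y h))) -> Q (loop_at (gmul L x y) k).
Proof.
move=> Q0 QD QM; rewrite (sum_proj grL x) (lin_sum (gmull_lin bL y)) (lin_sum (loop_at_lin k)).
elim/big_ind: _ => // g _.
rewrite (sum_proj grL y) (lin_sum (gmulr_lin bL _)) (lin_sum (loop_at_lin k)).
elim/big_ind: _ => // h _; rewrite !(loop_at_proj piD gA).
have xA := loop_at_in gA x g; have yA := loop_at_in gA y h.
rewrite (loop_delta_mul piD) // (linZ (loop_at_lin k)) loop_at_ldl; last by rewrite qprojD; apply: comp_mul.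
by case: ifP => _; rewrite ?scaler0.
Qed.

Lemma base_nonzero : nonzero A.
Proof.
have [[x x0] _] := proj1 gcsL.
case: (excluded_middle_informative (exists g, loop_at x g != 0)) => [[g h]|h]; first by exists (loop_at x g).
case/eqP: x0; apply: (loop_at_ext (pi := pi)) => g; apply/eqP/negP => /negP hg.
by apply: h; exists g.
Qed.

Lemma base_sq_full : sq_full A.
Proof.
have sqL := proj1 (sq_fullP bL) (proj1 (proj2 (proj1 gcsL))).
apply/(sq_fullP bA) => Q Q0 QL QM.
have QZ a u : Q u -> Q (a *: u) by move=> h; rewrite -[_ *: _]addr0; apply: QL.
have QD u v : Q u -> Q v -> Q (u + v) by move=> h1 h2; rewrite -[u]scale1r; apply: QL.
have QQ : forall x : gcar L, forall g, Q (loop_at x g).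
  apply: sqL => // [a x y hx hy g|x y g]; first by rewrite loop_at_lin; apply: QL.
  by apply: loop_at_mul => // a g1 g2; apply: QZ.
apply: (homog_ind grA) => // a x xa; rewrite -(qproj_val a) in xa.
by rewrite -(loop_delta_at t xa).
Qed.

(** The elements of [L] with all coefficients in [I] form a graded ideal, nonzero as soon as [I]
    contains a nonzero homogeneous element, and then equal to [L]. *)
Lemma ideal_homog (I : pred (gcar A)) a x : is_ideal A I -> x \in gcomp A a -> x \in I ->
  x != 0 -> forall y, y \in I.
Proof.
move=> [sI idI] xa xI x0; have I0 := sub0s sI.
pose J : pred (gcar L) := fun y => asbool (forall g, loop_at y g \in I).
have JP y : reflect (forall g, loop_at y g \in I) (y \in J) by exact: asboolP.
have Jid : is_ideal L J.
  split; first split=> [|b u v /JP uJ /JP vJ].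
  - by apply/JP => g.
  - by apply/JP => g; rewrite loop_at_lin; apply: sI.2.
  move=> u v /JP uJ; split; apply/JP => g.
    by apply: (@loop_at_mul (fun z => z \in I)) => // [? ?|b h k]; [apply: subDs|apply/(subZs sI)/(idI _ _ _).1].
  by apply: (@loop_at_mul (fun z => z \in I)) => // [? ?|b h k]; [apply: subDs|apply/(subZs sI)/(idI _ _ _).2].
have Jgr : is_graded_subspace L J.
  move=> u /JP uJ; exists (gdec u).1, (fun g => proj L g u); split=> [g|]; last exact: sum_proj.
  split; first exact: proj_in.
  apply/JP => h; rewrite (loop_at_proj piD gA) loop_at_ldl; last exact: loop_at_in.
  by case: ifP.
case: (proj2 (proj2 (proj1 gcsL)) J Jid Jgr) => h.
  rewrite -(qproj_val a) in xa; case/eqP: x0; rewrite -(loop_delta_at t xa) (h (dl (q_val a) x)) //.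
  by apply/JP => g; rewrite loop_at_ldl //; case: ifP.
apply: (homog_ind grA) => // [u v|b y yb]; first exact: subDs.
rewrite -(qproj_val b) in yb; rewrite -(loop_delta_at t yb).
by have /JP := h (dl (q_val b) y).
Qed.

Section Lift.
Variables (d : gcar A -> gcar A) (k : G).
Hypotheses (dC : is_centroid A d) (dD : centroid_deg A (pi k) d).
Let dL : lin d := cent_lin dC.

(** The lift of [d] to degree [k]. For [d] the identity and [k] in [H] it is [loop_shift k]. *)
Definition clift : gcar L -> gcar L := glue (fun g x => t k g *: dl (k + g) (d (loop_at x g))).

Let d_in g v : v \in gcomp A (pi g) -> d v \in gcomp A (pi (k + g)).
Proof. by rewrite qprojD; apply: dD. Qed.

Let clift_lin_on g : lin_on (gcomp L g) (fun x => t k g *: dl (k + g) (d (loop_at x g))).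
Proof.
move=> a x y _ _; rewrite loop_at_lin dL (loop_delta_lin gA); try by apply/d_in/loop_at_in.
by rewrite scalerDr !scalerA mulrC.
Qed.

Lemma clift_dl g v : v \in gcomp A (pi g) -> clift (dl g v) = t k g *: dl (k + g) (d v).
Proof.
by move=> vg; rewrite /clift (glueH grL clift_lin_on (loop_delta_comp t vg)) loop_delta_at.
Qed.

Lemma clift_cent : is_centroid L clift.
Proof.
apply: cent_intro => // g h x y xg yh.
have xA := loop_at_in gA x g; have yA := loop_at_in gA y h.
have xyA := comp_mul grA xA yA; have dM := proj2 dC (loop_at x g) (loop_at y h).
have dxyA : d (gmul A (loop_at x g) (loop_at y h)) \in gcomp A (pi (k + (g + h))).
  by apply: d_in; rewrite qprojD.
rewrite (loop_compE xg) (loop_compE yh) !loop_delta_at // (loop_delta_mul piD) //.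
rewrite (linZ (loop_at_lin _)) loop_delta_at ?qprojD // (linZ dL).
rewrite (loop_deltaZ gA) // (gmulZl bL) (gmulZr bL) !(loop_delta_mul piD) ?d_in //.
rewrite -dM.1 -dM.2 !scalerA -addrA [g + (k + h)]addrCA; split; congr (_ *: _).
  by rewrite [RHS](coc_shiftl tC) mulrC.
by rewrite [RHS](coc_shiftr tC) mulrC.
Qed.

Lemma clift_deg : centroid_deg L k clift.
Proof.
move=> g x xg; rewrite (loop_compE xg) clift_dl; last exact: loop_at_in.
by apply: (subZs (comp_sub grL _)); apply: loop_delta_comp; apply: d_in; apply: loop_at_in.
Qed.

Lemma clift0 : (forall x, clift x = 0) -> forall v, d v = 0.
Proof.
move=> c0; apply: (lin_ext grA) => //; first by move=> a x y; rewrite scaler0 addr0.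
move=> a v va; rewrite -(qproj_val a) in va; have := c0 (dl (q_val a) v).
rewrite clift_dl // => /eqP; rewrite scaler_eq0 (negbTE (coc_neq0 tC _ _)) /= => /eqP e.
by rewrite -(loop_delta_at t (d_in va)) e.
Qed.
End Lift.

Lemma base_cent_supp d a : is_centroid A d -> centroid_deg A a d -> a != 0 -> forall v, d v = 0.
Proof.
move=> dC; rewrite -(qproj_val a) => dD a0; apply: (clift0 dC dD) => x.
apply/eqP/negP => /negP hx; case/negP: a0; rewrite qproj0E; apply: suppL.
exists (clift d (q_val a)); split; [exact: clift_cent|exact: clift_deg|by exists x].
Qed.

Lemma base_cent0 d : is_centroid A d -> centroid_deg A 0 d -> exists lam : F, forall v, d v = lam *: v.
Proof.
move=> dC dD0; have dD : centroid_deg A (pi 0) d := dD0.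
have [lam lamE] := proj2 gcsL _ (clift_cent dC dD) (clift_deg dC dD).
(* The lift of [d] to degree 0 carries the extra factor [t 0 g], equal to [t 0 0]. *)
exists (lam / t 0 0); apply: (lin_ext grA); first exact: cent_lin.
  by move=> a x y; rewrite scalerDr !scalerA mulrC.
move=> a v va; rewrite -(qproj_val a) in va; have := lamE (dl (q_val a) v).
rewrite (clift_dl dC dD) // add0r (coc0l tC).
have dva : d v \in gcomp A (pi (q_val a)) by rewrite -(add0r (q_val a)) qprojD; apply: dD.
move=> /(congr1 (fun x => loop_at x (q_val a))); rewrite !(linZ (loop_at_lin _)) !loop_delta_at // => e.
rewrite mulrC -scalerA -e scalerA mulVf ?scale1r //; exact: coc_neq0.
Qed.

(** On homogeneous [x], every component of [c x] outside the degree of [x] comes from a component of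
    [c] of nonzero degree, which vanishes; so [c] is its own component of degree 0. *)
Lemma base_central : central A.
Proof.
move=> c cC; have cL := cent_lin cC.
have [lam lamE] := base_cent0 (centroid_component_cent gA 0 cC) (@centroid_component_deg _ _ _ gA _ 0 cL).
exists lam => x; rewrite -lamE; move: x; apply: (lin_ext grA) => //.
  exact: (cent_lin (centroid_component_cent gA 0 cC)).
move=> a x xa; rewrite (centroid_componentH gA 0 cL xa) add0r; apply: (proj_ext grA) => b.
have [->|ab] := eqVneq a b; first by rewrite (projE grA (proj_in grA _ _)).
rewrite [RHS](proj_ne grA (proj_in grA _ _) ab).
rewrite -[b](subrK a) -(centroid_componentH gA _ cL xa).
by apply: (base_cent_supp (centroid_component_cent gA _ cC)
  (@centroid_component_deg _ _ _ gA _ (b - a) cL)); rewrite subr_eq0 eq_sym.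
Qed.

Definition gdeg (x : gcar A) : seq (quot H) := [seq a <- (gdec x).1 | proj A a x != 0].
Lemma mem_gdeg x a : (a \in gdeg x) = (proj A a x != 0).
Proof.
rewrite mem_filter; case: eqP => //= /eqP h; apply: contraT => /proj_out e.
by rewrite e eqxx in h.
Qed.
Lemma gdeg_uniq x : uniq (gdeg x).
Proof. by apply: filter_uniq; case: (gdecP grA x). Qed.
Lemma gdeg0 x : gdeg x = [::] -> x = 0.
Proof.
move=> e; apply: (proj_ext grA) => a; rewrite (lin0 (proj_lin grA a)).
by apply/eqP/negPn; rewrite -mem_gdeg e.
Qed.

(* An element [x0] of [I] with the least number of homogeneous components must be
   homogeneous: otherwise sending the component of degree [a1] of [w] to that of degree [a2],
   for [w] in the ideal generated by [x0], defines a centroid element of degree [a2 - a1]. *)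
Lemma base_simple_ideal (I : pred (gcar A)) : is_ideal A I ->
  (forall x, x \in I -> x = 0) \/ (forall x, x \in I).
Proof.
move=> Iid; have [sI idI] := Iid.
case: (excluded_middle_informative (exists x, x \in I /\ x != 0)); last first.
  move=> h; left=> x xI; apply/eqP/negP => /negP x0; apply: h.
  by exists x.
move=> [x [xI xn]]; right.
pose Pn n := asbool (exists x, [/\ x \in I, x != 0 & size (gdeg x) = n]).
have exn : exists n, Pn n by exists (size (gdeg x)); apply/asboolP; exists x.
case: (ex_minnP exn) => n /asboolP [x0 [x0I x0n sz]] min {x xI xn}.
have {}min w : w \in I -> (size (gdeg w) < n)%N -> w = 0.
  move=> wI ws; apply/eqP/negP => /negP w0; move: ws; rewrite ltnNge => /negP; apply.
  by apply: min; apply/asboolP; exists w.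
case S_eq : (gdeg x0) => [|a1 S].
  by rewrite (gdeg0 S_eq) eqxx in x0n.
have a1S : proj A a1 x0 != 0 by rewrite -mem_gdeg S_eq mem_head.
case: S => [|a2 S] in S_eq.
  have x0H : x0 \in gcomp A a1.
    suff -> : x0 = proj A a1 x0 by apply: proj_in.
    apply: (proj_ext grA) => b; have [->|ne] := eqVneq a1 b.
      by rewrite (projE grA (proj_in grA _ _)).
    rewrite [RHS](proj_ne grA (proj_in grA _ _) ne); apply/eqP/negPn.
    by rewrite -mem_gdeg S_eq inE eq_sym.
  exact: (ideal_homog Iid x0H).
have a12 : a1 != a2 by have := gdeg_uniq x0; rewrite S_eq /= inE negb_or; case/and3P => /andP [].
have a2S : proj A a2 x0 != 0 by rewrite -mem_gdeg S_eq !inE eqxx orbT.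
pose k := a2 - a1.
(* The graph of the centroid element to be built. The support of the witness [w] is confined to that
   of [x0] translated by [g - a1]. *)
pose W g y z := exists w, [/\ w \in I, forall h, proj A h w != 0 -> h - (g - a1) \in gdeg x0,
  proj A g w = y & proj A (k + g) w = z].
have pL := proj_lin grA.
have W_lin g b y z y' z' : W g y z -> W g y' z' -> W g (b *: y + y') (b *: z + z').
  move=> [w [wI ws <- <-]] [w' [wI' ws' <- <-]]; exists (b *: w + w').
  split=> [|h||]; [exact: sI.2| |by rewrite pL|by rewrite pL].
  have [w0|/ws //] := eqVneq (proj A h w) 0; rewrite pL w0 scaler0 add0r; exact: ws'.
have W00 g : W g 0 0.
  by exists 0; split; rewrite ?(lin0 (pL _)) ?(sub0s sI) // => h; rewrite (lin0 (pL _)) eqxx.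
(* If the component of [w] in degree [g] vanishes, the translate of [a1] drops out of the support,
   so [w] is shorter than [x0] and must be 0. *)
have W0 g z : W g 0 z -> z = 0.
  move=> [w [wI ws w0 <-]]; suff -> : w = 0 by rewrite (lin0 (pL _)).
  apply: min => //; rewrite -sz S_eq.
  apply: (@leq_ltn_trans (size [seq h + (g - a1) | h <- a2 :: S])); last by rewrite size_map.
  apply: uniq_leq_size; first exact: gdeg_uniq.
  move=> h; rewrite mem_gdeg => hw; have := ws h hw; rewrite S_eq inE => /orP [/eqP e|hS].
    by case/eqP: hw; rewrite -[h](subrK (g - a1)) e addrC subrK w0.
  by apply/mapP; exists (h - (g - a1)) => //; rewrite subrK.
have W_uniq g y z z' : W g y z -> W g y z' -> z = z'.
  move=> h h'; have := W_lin g (-1) _ _ _ _ h h'; rewrite !scaleN1r addNr => /W0 /eqP.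
  by rewrite addrC subr_eq0 => /eqP.
have shift j g h : j - (h + (g - a1)) = j - h - (g - a1) by rewrite opprD addrA.
have W_mulr g h y z b : b \in gcomp A h -> W g y z -> W (g + h) (gmul A y b) (gmul A z b).
  move=> bh [w [wI ws <- <-]]; exists (gmul A w b); split.
  - exact: (idI _ _ wI).1.
  - move=> j; rewrite -{1}[j](subrK h) (proj_mulr grA bA) // => hj.
    rewrite [g + h]addrC -[h + g - a1]addrA shift; apply: ws; apply: contraNneq hj => ->.
    by rewrite (gmul0l bA).
  - by rewrite (proj_mulr grA bA).
  - by rewrite addrA (proj_mulr grA bA).
have W_mull g h y z b : b \in gcomp A h -> W g y z -> W (h + g) (gmul A b y) (gmul A b z).
  move=> bh [w [wI ws <- <-]]; exists (gmul A b w); split.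
  - exact: (idI _ _ wI).2.
  - move=> j; rewrite -{1}[j](subrK h) addrC (proj_mull grA bA) // => hj.
    rewrite -[h + g - a1]addrA shift; apply: ws; apply: contraNneq hj => ->.
    by rewrite (gmul0r bA).
  - by rewrite (proj_mull grA bA).
  - by rewrite addrCA (proj_mull grA bA).
(* The domain of the relation [W]. It is an ideal containing the nonzero homogeneous element
   [proj A a1 x0], so it is all of [A] by [ideal_homog]. *)
pose J : pred (gcar A) := fun y => asbool (forall g, exists z, W g (proj A g y) z).
have JP y : reflect (forall g, exists z, W g (proj A g y) z) (y \in J) by exact: asboolP.
have J_lin b y y' : y \in J -> y' \in J -> b *: y + y' \in J.
  move=> /JP yJ /JP yJ'; apply/JP => g; have [z zW] := yJ g; have [z' zW'] := yJ' g.
  by exists (b *: z + z'); rewrite pL; apply: W_lin.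
have J0 : 0 \in J by apply/JP => g; exists 0; rewrite (lin0 (pL g)).
have JD y y' : y \in J -> y' \in J -> y + y' \in J.
  by move=> h h'; rewrite -[y]scale1r; apply: J_lin.
have Jid : is_ideal A J.
  split=> // u v uJ; split.
    elim/(homog_ind grA): v => [|v v' hv hv'|h v vh].
    - by rewrite (gmul0r bA).
    - by rewrite (gmulDr bA); apply: JD.
    apply/JP => g; have /JP /(_ (g - h)) [z zW] := uJ; exists (gmul A z v).
    by rewrite -[g](subrK h) (proj_mulr grA bA) //; apply: W_mulr.
  elim/(homog_ind grA): v => [|v v' hv hv'|h v vh].
  - by rewrite (gmul0l bA).
  - by rewrite (gmulDl bA); apply: JD.
  apply/JP => g; have /JP /(_ (g - h)) [z zW] := uJ; exists (gmul A v z).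
  by rewrite -[g](subrK h) addrC (proj_mull grA bA) //; apply: W_mull.
have W1 : W a1 (proj A a1 x0) (proj A a2 x0).
  exists x0; split=> //; last by rewrite /k subrK.
  by move=> h; rewrite subrr subr0 mem_gdeg.
have x1J : proj A a1 x0 \in J.
  apply/JP => g; rewrite (projH grA g (proj_in grA a1 x0)); case: eqP => [<-|_].
    by exists (proj A a2 x0).
  by exists 0.
have JT := ideal_homog Jid (proj_in grA a1 x0) x1J a1S.
have /fun_choice [C CW] : forall gy : quot H * gcar A, exists z, W gy.1 (proj A gy.1 gy.2) z.
  by move=> [g y]; have /JP := JT y.
have CH g y : y \in gcomp A g -> W g y (C (g, y)).
  by move=> yg; have := CW (g, y); rewrite /= (projE grA yg).
pose phi g y := C (g, y).
have phiL g : lin_on (gcomp A g) (phi g).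
  move=> b y y' yg yg'; apply: (W_uniq g (b *: y + y')); last by apply: W_lin; apply: CH.
  by apply: CH; apply: (comp_sub grA g).2.
have cC : is_centroid A (glue phi).
  apply: cent_intro => // g h y y' yg yh; have yyW := CH _ _ (comp_mul grA yg yh).
  split; apply: (W_uniq _ _ _ _ yyW).
    by apply: W_mulr => //; apply: CH.
  by apply: W_mull => //; apply: CH.
have cD : centroid_deg A k (glue phi).
  move=> g y yg; rewrite (glueH grA phiL yg) /phi; have [w [_ _ _ <-]] := CH g y yg.
  exact: proj_in.
(* [glue phi] has nonzero degree [k], hence is 0; but it takes [proj A a1 x0] to [proj A a2 x0]. *)
case/eqP: a2S; have k0 : k != 0 by rewrite subr_eq0 eq_sym.
have := base_cent_supp cC cD k0 (proj A a1 x0).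
rewrite (glueH grA phiL (proj_in grA a1 x0)) => <-.
by apply: (W_uniq _ _ _ _ W1); apply: CH; apply: proj_in.
Qed.

Lemma base_central_simple : central_simple A.
Proof.
split; last exact: base_central.
split; first exact: base_nonzero.
split; [exact: base_sq_full|exact: base_simple_ideal].
Qed.
End LoopDescent.

(** * Homogeneous centroid elements of a graded-central-simple algebra *)

Section GradedCentroid.
Variables (F : fieldType) (G : zmodType) (B : galg F G).
Hypothesis gB : is_galg B.
Let bB : bilinear_mul B := proj1 gB.
Let grB : is_grading B := proj2 gB.
Hypothesis gcsB : graded_central_simple B.
Implicit Types c d : gcar B -> gcar B.

(** On a product, [c] may act on one factor and [d] on the other, in either order; products span
    [B]. *)
Lemma centroid_comm c d x : is_centroid B c -> is_centroid B d -> c (d x) = d (c x).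
Proof.
move=> cC dC; move: (cent_lin cC) (cent_lin dC) (proj2 cC) (proj2 dC) => cL dL cM dM.
move: x; apply: (proj1 (sq_fullP bB) (proj1 (proj2 (proj1 gcsB)))).
- by rewrite (lin0 cL) (lin0 dL) (lin0 cL).
- by move=> a x y ex ey; rewrite dL cL ex ey -dL -cL.
by move=> x y; rewrite (dM x y).2 (cM _ _).1 (cM x y).1 (dM _ _).2.
Qed.

Lemma centroid_proj c k g x : is_centroid B c -> centroid_deg B k c ->
  proj B (k + g) (c x) = c (proj B g x).
Proof.
move=> cC cD; have cL := cent_lin cC; elim/(homog_ind grB): x => [|x y ex ey|h x xh].
- by rewrite !(lin0 (proj_lin grB _)) (lin0 cL) (lin0 (proj_lin grB _)).
- by rewrite !(linD (proj_lin grB _), linD cL) ex ey.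
rewrite (projH grB g xh) (projH grB _ (cD _ _ xh)) (inj_eq (addrI k)).
by case: ifP => // _; rewrite (lin0 cL).
Qed.

Lemma centroid_inj c k : is_centroid B c -> centroid_deg B k c -> (exists x, c x != 0) ->
  forall x, c x = 0 -> x = 0.
Proof.
move=> cC cD [x1 cx1]; have cL := cent_lin cC; have cM := proj2 cC.
pose I : pred (gcar B) := fun x => asbool (c x = 0).
have IP x : reflect (c x = 0) (x \in I) by exact: asboolP.
have Iid : is_ideal B I.
  split; first split=> [|a x y /IP xI /IP yI]; try apply/IP.
  - by rewrite (lin0 cL).
  - by rewrite cL xI yI scaler0 addr0.
  move=> x y /IP xI; split; apply/IP.
    by rewrite (cM _ _).1 xI (gmul0l bB).
  by rewrite (cM _ _).2 xI (gmul0r bB).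
have Igr : is_graded_subspace B I.
  move=> x /IP xI; exists (gdec x).1, (fun g => proj B g x); split=> [g|]; last exact: sum_proj.
  split; first exact: proj_in.
  by apply/IP; rewrite -(centroid_proj g x cC cD) xI (lin0 (proj_lin grB _)).
case: (proj2 (proj2 (proj1 gcsB)) I Iid Igr) => h x.
  by move=> cx; apply: h; apply/IP.
by have /IP e := h x1; rewrite e eqxx in cx1.
Qed.

Lemma centroid_surj c k : is_centroid B c -> centroid_deg B k c -> (exists x, c x != 0) ->
  forall y, exists x, c x = y.
Proof.
move=> cC cD [x1 cx1]; have cL := cent_lin cC; have cM := proj2 cC.
pose I : pred (gcar B) := fun y => asbool (exists x, c x = y).
have IP y : reflect (exists x, c x = y) (y \in I) by exact: asboolP.
have Iid : is_ideal B I.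
  split; first split.
  - by apply/IP; exists 0; rewrite (lin0 cL).
  - by move=> a _ _ /IP [x <-] /IP [y <-]; apply/IP; exists (a *: x + y); rewrite cL.
  move=> _ y /IP [x <-]; split; apply/IP; first by exists (gmul B x y); rewrite (cM _ _).1.
  by exists (gmul B y x); rewrite (cM _ _).2.
have Igr : is_graded_subspace B I.
  move=> _ /IP [x <-].
  exists [seq k + g | g <- (gdec x).1], (fun g => c (proj B (g - k) x)); split=> [g|].
    split; last by apply/IP; exists (proj B (g - k) x).
    by rewrite -{2}[g](subrK k) [g - k + k]addrC; apply: cD; apply: proj_in.
  rewrite {1}(sum_proj grB x) (lin_sum cL) big_map; apply: eq_bigr => g _.
  by rewrite [k + g]addrC addrK.
case: (proj2 (proj2 (proj1 gcsB)) I Iid Igr) => h.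
  by case/eqP: cx1; apply: h; apply/IP; exists x1.
by move=> y; apply/IP.
Qed.

Lemma centroid_inv c k : is_centroid B c -> centroid_deg B k c -> (exists x, c x != 0) ->
  exists d, [/\ is_centroid B d, centroid_deg B (- k) d, cancel c d & cancel d c].
Proof.
move=> cC cD cn; have cL := cent_lin cC; have cM := proj2 cC.
have [d dK] := fun_choice (centroid_surj cC cD cn).
have cI : injective c.
  move=> x y e; apply/subr0_eq/(centroid_inj cC cD cn).
  by rewrite (linB cL) e subrr.
have Kd : cancel c d by move=> x; apply: cI; rewrite dK.
exists d; split=> //.
  split=> [a x y|x y]; first by apply: cI; rewrite cL !dK.
  by split; apply: cI; [rewrite (cM _ _).1 !dK|rewrite (cM _ _).2 !dK].
move=> g x xg; suff -> : d x = proj B (- k + g) (d x) by apply: proj_in.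
apply: cI; rewrite -(centroid_proj _ _ cC cD) !dK addrA subrr add0r.
by rewrite (projE grB xg).
Qed.

(** The composite of [d] with the inverse of [c] has degree 0, hence is a scalar by graded
    centrality. *)
Lemma centroid_line c d k : is_centroid B c -> centroid_deg B k c -> (exists x, c x != 0) ->
  is_centroid B d -> centroid_deg B k d -> exists lam : F, forall x, d x = lam *: c x.
Proof.
move=> cC cD cn dC dD; have [c' [c'C c'D cK c'K]] := centroid_inv cC cD cn.
have [||lam lamE] := proj2 gcsB (fun x => c' (d x)).
- exact: (cent_comp_closed c'C dC).
- by move=> g x xg; rewrite -[0 + g]/(0 + g) -(addNr k) -addrA; apply/c'D/dD.
by exists lam => x; rewrite -[LHS]c'K lamE (linZ (cent_lin cC)).
Qed.

Definition supp_pred : pred G := fun k => asbool (cent_supp B k).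
Lemma suppP k : reflect (cent_supp B k) (k \in supp_pred). Proof. exact: asboolP. Qed.

Lemma supp0 : 0 \in supp_pred.
Proof.
have [[x x0] _] := proj1 gcsB.
apply/suppP; exists id; split=> [|g y yg|]; [by split|by rewrite add0r|by exists x].
Qed.

Lemma suppB k l : k \in supp_pred -> l \in supp_pred -> k - l \in supp_pred.
Proof.
move=> /suppP [c [cC cD cn]] /suppP [d [dC dD dn]]; apply/suppP.
have [d' [d'C d'D dK d'K]] := centroid_inv dC dD dn; have [x cx] := cn.
exists (c \o d'); split.
- exact: cent_comp_closed.
- by move=> g y yg; rewrite -addrA; apply/cD/d'D.
- by exists (d x); rewrite /= dK.
Qed.

Definition cent_subgrp : subgrp G := SubGrp supp0 suppB.
Local Notation H := cent_subgrp.

(** A nonzero [u h] is chosen in each homogeneous line of the centroid. The structure constants are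
    symmetric by [centroid_comm], and associativity of composition is their cocycle identity on [H];
    they are then extended to [G]. *)
Lemma centroid_cocycle : exists (u : G -> gcar B -> gcar B) (t : G -> G -> F),
  [/\ sym2cocycle t,
      forall h, h \in sg_pred H -> is_centroid B (u h) /\ centroid_deg B h (u h) &
      forall h k x, h \in sg_pred H -> k \in sg_pred H -> u h (u k x) = t h k *: u (h + k) x] /\
  (forall x, u 0 x = t 0 0 *: x).
Proof.
have /fun_choice [u uE] : forall h, exists c, h \in sg_pred H ->
    [/\ is_centroid B c, centroid_deg B h c & exists x, c x != 0].
  move=> h; case: (boolP (h \in sg_pred H)) => [/suppP [c ?]|_]; last by exists id.
  by exists c.
have uI h x : h \in sg_pred H -> u h x = 0 -> x = 0.
  by move=> /uE [c1 c2 c3]; apply: (centroid_inj c1 c2 c3).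
have [[x1 x1n] _] := proj1 gcsB.
have un h : h \in sg_pred H -> u h x1 != 0.
  by move=> hH; apply: contraNneq x1n => /(uI h x1 hH) ->.
have /fun_choice [t0 t0E] : forall hk : G * G, exists l : F, hk.1 \in sg_pred H ->
    hk.2 \in sg_pred H -> forall x, u hk.1 (u hk.2 x) = l *: u (hk.1 + hk.2) x.
  move=> [h k] /=; case: (boolP (h \in sg_pred H)) => hH; last by exists 0.
  case: (boolP (k \in sg_pred H)) => kH; last by exists 0.
  have [c1 c2 c3] := uE h hH; have [d1 d2 d3] := uE k kH.
  have [e1 e2 e3] := uE (h + k) (sgD hH kH).
  have [||l lE] := centroid_line e1 e2 e3 (d := u h \o u k).
  - exact: cent_comp_closed.
  - by move=> g x xg; rewrite -addrA; apply/c2/d2.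
  by exists l => _ _ x; rewrite -lE.
pose t' h k := t0 (h, k).
have tE h k x : h \in sg_pred H -> k \in sg_pred H -> u h (u k x) = t' h k *: u (h + k) x.
  by move=> hH kH; apply: (t0E (h, k)).
have scal h (a b : F) : h \in sg_pred H -> a *: u h x1 = b *: u h x1 -> a = b.
  move=> hH /eqP; rewrite -subr_eq0 -scalerBl scaler_eq0 (negbTE (un h hH)) orbF subr_eq0.
  by move/eqP.
have uC h k x : h \in sg_pred H -> k \in sg_pred H -> u h (u k x) = u k (u h x).
  by move=> /uE [c1 _ _] /uE [d1 _ _]; exact: (centroid_comm x c1 d1).
have uL h : h \in sg_pred H -> lin (u h) by move=> /uE [c1 _ _]; exact: (cent_lin c1).
have t'C : pcocycle (sg_pred H) t'.
  split=> [h k hH kH|a b c aH bH cH|h k hH kH].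
  - apply: contraNneq x1n => e; have := tE h k x1 hH kH; rewrite e scale0r.
    by move=> /(uI h _ hH) /(uI k _ kH) ->.
  - have abH := sgD aH bH; have bcH := sgD bH cH; have abcH := sgD aH bcH.
    apply: (scal (a + (b + c))) => //.
    have := tE a b (u c x1) aH bH; rewrite (tE b c) // (linZ (uL a aH)) !tE // !scalerA addrA.
    by move=> e; rewrite -e mulrC.
  - apply: (scal (h + k)); first exact: sgD.
    by rewrite -tE // uC // tE // addrC.
have [t [tC t_ext]] := cocycle_extend t'C.
have z0 := sg0 H.
(* [u 0] is injective, and it sends both [u 0 x] and [t 0 0 *: x] to the same element. *)
have u0 x : u 0 x = t 0 0 *: x.
  apply/subr0_eq/(uI 0 _ z0); rewrite (linB (uL 0 z0)) tE // addr0 (linZ (uL 0 z0)).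
  by rewrite t_ext // subrr.
exists u, t; split=> //; split=> // [h /uE [] //|h k x hH kH].
by rewrite t_ext // tE.
Qed.
End GradedCentroid.

(** * The base algebra on coset representatives *)

Section Construction.
Variables (F : fieldType) (G : zmodType) (B : galg F G).
Hypothesis gB : is_galg B.
Let bB : bilinear_mul B := proj1 gB.
Let grB : is_grading B := proj2 gB.
Variables (H : subgrp G) (u : G -> gcar B -> gcar B) (t : G -> G -> F).
Hypothesis tC : sym2cocycle t.
Hypothesis uP : forall h, h \in sg_pred H -> is_centroid B (u h) /\ centroid_deg B h (u h).
Hypothesis uM : forall h k x, h \in sg_pred H -> k \in sg_pred H ->
  u h (u k x) = t h k *: u (h + k) x.
Hypothesis u0 : forall x, u 0 x = t 0 0 *: x.
Local Notation pi := (qproj H).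

(* In the twist of [B] by [1 / t] the maps [hshift h] form an action of [H] by centroid elements. *)
Definition hshift (h g : G) (x : gcar B) : gcar B := (t h g)^-1 *: u h x.

Lemma hshift_lin h g : h \in sg_pred H -> lin (hshift h g).
Proof.
move=> hH a x y; rewrite /hshift (cent_lin (uP hH).1) scalerDr !scalerA.
by rewrite [_^-1 * a]mulrC.
Qed.

Lemma hshift_in h g x : h \in sg_pred H -> x \in gcomp B g -> hshift h g x \in gcomp B (h + g).
Proof. by move=> hH xg; apply: (subZs (comp_sub grB _)); apply: (uP hH).2. Qed.

Lemma hshift0 g x : hshift 0 g x = x.
Proof. by rewrite /hshift u0 (coc0l tC) scalerA mulVf ?scale1r ?coc_neq0. Qed.

(** The factor [(t h g)^-1] turns the projective action [u] into a genuine one, at the price of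
    depending on the degree [g] of the argument. *)
Lemma hshiftD k h g x : h \in sg_pred H -> k \in sg_pred H -> hshift k (h + g) (hshift h g x) = hshift (k + h) g x.
Proof.
move=> hH kH; rewrite /hshift (linZ (cent_lin (uP kH).1)) uM // !scalerA; congr (_ *: _).
have n := coc_neq0 tC; apply: (mulIf (n (k + h) g)).
rewrite mulVf // -!mulrA (cocA tC); field.
by rewrite !n.
Qed.

Definition untwist_mul (g h : G) (x y : gcar B) : gcar B := (t g h)^-1 *: gmul B x y.

Lemma hshift_mull h g g' x y : h \in sg_pred H ->
  untwist_mul (h + g) g' (hshift h g x) y = hshift h (g + g') (untwist_mul g g' x y).
Proof.
move=> hH; have [uC _] := uP hH; have uL := cent_lin uC.
rewrite /untwist_mul /hshift (gmulZl bB) (linZ uL) (proj2 uC x y).1 !scalerA -!invfM; congr (_^-1 *: _).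
by rewrite mulrC (cocA tC).
Qed.

Lemma hshift_mulr h g g' x y : h \in sg_pred H ->
  untwist_mul g (h + g') x (hshift h g' y) = hshift h (g + g') (untwist_mul g g' x y).
Proof.
move=> hH; have [uC _] := uP hH; have uL := cent_lin uC.
rewrite /untwist_mul /hshift (gmulZr bB) (linZ uL) (proj2 uC x y).2 !scalerA -!invfM; congr (_^-1 *: _).
by rewrite mulrC (coc_shiftr tC) mulrC.
Qed.

Let s g := q_val (pi g).
Let sH g : s g - g \in sg_pred H.
Proof. by rewrite -opprB; apply: sgN; apply: qproj_sub_val. Qed.
Let sH' g : g - s g \in sg_pred H. Proof. exact: qproj_sub_val. Qed.

Definition to_rep (g : G) : gcar B -> gcar B := hshift (s g - g) g.

Lemma to_rep_lin g : lin (to_rep g). Proof. exact: hshift_lin. Qed.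
Lemma to_rep_in g x : x \in gcomp B g -> to_rep g x \in gcomp B (q_val (pi g)).
Proof. by move=> xg; rewrite -/(s g) -[X in gcomp B X](subrK g (s g)); apply: hshift_in. Qed.
Lemma to_repK g x : hshift (g - s g) (s g) (to_rep g x) = x.
Proof.
by have := @hshiftD (g - s g) (s g - g) g x (sH g) (sH' g); rewrite subrK addrA subrK subrr hshift0.
Qed.
Lemma to_repK' g y : to_rep g (hshift (g - s g) (s g) y) = y.
Proof.
by have := @hshiftD (s g - g) (g - s g) (s g) y (sH' g) (sH g); rewrite subrK addrA subrK subrr hshift0.
Qed.

(** The product of elements of degrees [q_val a] and [q_val b] need not have a chosen representative
    as its degree, so [to_rep] moves it back. Gluing makes the product bilinear on all of [B]. *)
Definition rep_mul : gcar B -> gcar B -> gcar B :=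
  fun x y => glue to_rep (gmul (twist B (fun a b => (t a b)^-1)) x y).

Let untwist_mulE g h x y : x \in gcomp B g -> y \in gcomp B h ->
  gmul (twist B (fun a b => (t a b)^-1)) x y = untwist_mul g h x y.
Proof. exact: twist_mulH. Qed.

Let to_rep_lin_on g : lin_on (gcomp B g) (to_rep g). Proof. exact/lin_lin_on/to_rep_lin. Qed.

Lemma rep_mulE g h x y : x \in gcomp B g -> y \in gcomp B h -> rep_mul x y = to_rep (g + h) (untwist_mul g h x y).
Proof.
move=> xg yh; rewrite /rep_mul (untwist_mulE xg yh) (glueH grB to_rep_lin_on (g := g + h)) //.
by apply: (subZs (comp_sub grB _)); apply: comp_mul.
Qed.

(** [hshift] is an action that passes through the untwisted product in each factor, so transport to
    representatives may be done before or after multiplying. *)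
Lemma to_rep_mul g h x y : x \in gcomp B g -> y \in gcomp B h ->
  rep_mul (to_rep g x) (to_rep h y) = to_rep (g + h) (untwist_mul g h x y).
Proof.
move=> xg yh; rewrite (rep_mulE (to_rep_in xg) (to_rep_in yh)) -/(s g) -/(s h).
set a := s g - g; set b := s h - h.
have aH : a \in sg_pred H by exact: sH.
have bH : b \in sg_pred H by exact: sH.
have -> : untwist_mul (s g) (s h) (to_rep g x) (to_rep h y) = hshift (a + b) (g + h) (untwist_mul g h x y).
  have ea : s g = a + g by rewrite subrK.
  have eb : s h = b + h by rewrite subrK.
  rewrite {1}ea {1}eb /to_rep -/a -/b hshift_mull // hshift_mulr // [g + (b + h)]addrCA.
  by rewrite hshiftD.
have abH := sgD aH bH.
have e : s g + s h = a + b + (g + h) by rewrite addrACA !subrK.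
rewrite /to_rep {3}e hshiftD //; congr (hshift _ _ _).
have -> : s (s g + s h) = s (g + h) by rewrite /s !qprojD !qproj_val.
by rewrite e; move: (a + b) => c; rewrite opprD addrA addrAC subrK.
Qed.

Let P (a : quot H) : pred (gcar B) := gcomp B (q_val a).
Let gen : pred (funT (quot H) (gcar B)) :=
  fun f => asbool (exists a v, v \in P a /\ f = fdelta a v).
Let comp (a : quot H) : pred (spanT gen) :=
  fun x => asbool ((forall b, b != a -> sp_val x b = 0) /\ sp_val x a \in P a).
Let P_sub a : subspace (P a). Proof. exact: (comp_sub grB). Qed.
Let genE f : f \in gen -> exists a v, v \in P a /\ f = fdelta a v.
Proof. by move=> /asboolP. Qed.
Let genI a v : v \in P a -> fdelta a v \in spanP gen.
Proof.
move=> vP; rewrite unfold_in; apply/asboolP => Q _ _; apply.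
by rewrite unfold_in; apply/asboolP; exists a, v.
Qed.
Let compE a (x : spanT gen) : x \in comp a <->
  (forall b, b != a -> sp_val x b = 0) /\ sp_val x a \in P a.
Proof. by rewrite unfold_in; split=> [/asboolP|h]; last exact/asboolP. Qed.
Let twB := twist_galg grB bB (fun a b => (t a b)^-1).
Let to_repL : lin (glue (A := B) to_rep). Proof. exact: glue_lin. Qed.
Let mL y : lin (fun x => rep_mul x y).
Proof. by move=> a x z; rewrite /rep_mul (proj1 twB).1 to_repL. Qed.
Let mR x : lin (rep_mul x).
Proof. by move=> a y z; rewrite /rep_mul (proj1 twB).2 to_repL. Qed.
Let mP a b x y : x \in P a -> y \in P b -> rep_mul x y \in P (a + b).
Proof.
move=> xa yb; rewrite (rep_mulE xa yb); suff -> : a + b = pi (q_val a + q_val b).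
  by apply: to_rep_in; apply: (subZs (comp_sub grB _)); apply: comp_mul.
by rewrite qprojD !qproj_val.
Qed.

Definition base_alg : galg F (quot H) := funalg rep_mul comp.
Local Notation A := base_alg.

Lemma base_alg_galg : is_galg A.
Proof. exact: (funalg_galg P_sub genE genI compE mL mR mP). Qed.

Local Notation L := (tloop pi A t).
Local Notation dl := (@loop_delta F G _ pi A t).
Local Notation adl := (@fun_delta F _ (gcar B) gen).

(** An element of degree [g] goes to its transport to the representative of [pi g], placed in degree
    [g]; the index [g] allows the transport to be undone. The twist by [t] cancels the inverse of
    [t] in [untwist_mul]. *)
Lemma base_alg_iso : giso B L.
Proof.
have gA := base_alg_galg; have gL := tloop_galg (@qprojD G H) gA t.
have adl_in a v : v \in P a -> adl a v \in gcomp A a by exact: (fun_delta_comp rep_mul genI compE).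
have adl_lin a : lin_on (P a) (adl a) by exact: (fun_delta_lin P_sub genI).
pose phi g x : gcar L := dl g (adl (pi g) (to_rep g x)).
apply: (@giso_intro _ _ B L phi gB gL) => g.
- move=> a x y xg yg; rewrite /phi to_rep_lin adl_lin ?(loop_delta_lin gA) //; try exact: to_rep_in.
    by apply/adl_in/to_rep_in.
  by apply/adl_in/to_rep_in.
- by move=> x xg; apply: loop_delta_comp; apply/adl_in/to_rep_in.
- move=> x xg e; have rx := to_rep_in xg.
  have : loop_at (phi g x) g = 0 by rewrite e.
  rewrite /phi loop_delta_at ?adl_in // => /(congr1 (fun z : spanT gen => sp_val z (pi g))).
  rewrite (fun_delta_at genI rx) => e'; rewrite -(to_repK g x) e'.
  exact: (lin0 (hshift_lin _ (sH' g))).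
- move=> y yg; have yA := loop_at_in gA y g.
  have bP : sp_val (loop_at y g : spanT gen) (pi g) \in P (pi g) by apply: (sp_in P_sub genE genI).
  exists (hshift (g - s g) (s g) (sp_val (loop_at y g : spanT gen) (pi g))).
    by rewrite -[X in gcomp B X](subrK (s g) g); apply: hshift_in.
  by rewrite /phi to_repK' [RHS](loop_compE yg) [in RHS](fun_compE genI compE yA).
move=> h x y xg yh; have rx := to_rep_in xg; have ry := to_rep_in yh.
rewrite /phi (loop_delta_mul (@qprojD G H)) ?adl_in //.
have -> : gmul A (adl (pi g) (to_rep g x)) (adl (pi h) (to_rep h y)) =
    adl (pi g + pi h) (rep_mul (to_rep g x) (to_rep h y)) by apply: (fun_delta_mul comp P_sub genE genI mL mR mP).
rewrite (to_rep_mul xg yh) -qprojD /untwist_mul (linZ (to_rep_lin _)).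
have rxy := to_rep_in (comp_mul grB xg yh).
rewrite (lin_onZ _ (sub0s (P_sub _)) (@adl_lin _)) // (loop_deltaZ gA) ?adl_in //.
by rewrite scalerA divff ?scale1r // coc_neq0.
Qed.
End Construction.

(** * Invariance under graded isomorphism and conclusion *)

Lemma giso_gcs (F : fieldType) (G : zmodType) (A B : galg F G) :
  is_galg A -> is_galg B -> giso A B -> graded_central_simple A -> graded_central_simple B.
Proof.
move=> gA gB [f [fL [[f' fK f'K] [fM [fA fB]]]]] [[[x0 x0n] [sq idl]] ce].
have f'L : lin f' by move=> a x y; apply: (can_inj fK); rewrite fL !f'K.
have f'M x y : f' (gmul B x y) = gmul A (f' x) (f' y).
  by apply: (can_inj fK); rewrite fM !f'K.
have f'A g x : x \in gcomp B g -> f' x \in gcomp A g by move=> /fB [y yg <-]; rewrite fK.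
split; [split; [|split]|].
- exists (f x0); apply: contraNneq x0n => e; rewrite -(fK x0) e.
  by rewrite (lin0 f'L).
- move=> x; have [s e] := sq (f' x); exists [seq (p.1.1, f p.1.2, f p.2) | p <- s].
  rewrite -[x]f'K e (lin_sum fL) big_map; apply: eq_bigr => p _.
  by rewrite (linZ fL) fM.
- move=> I [sI idI] grI; pose J : pred (gcar A) := fun x => f x \in I.
  have JE x : (x \in J) = (f x \in I) by [].
  have Jid : is_ideal A J.
    split; first split=> [|a x y]; rewrite ?JE.
    - by rewrite (lin0 fL); case: sI.
    - by rewrite fL; apply: sI.2.
    by move=> x y xJ; rewrite !JE !fM; apply: idI.
  have Jgr : is_graded_subspace A J.
    move=> x; rewrite JE => /grI [s [h [hI e]]]; exists s, (fun g => f' (h g)); split=> [g|].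
      by rewrite JE f'K; have [h1 h2] := hI g; split=> //; apply: f'A.
    by apply: (can_inj fK); rewrite e (lin_sum fL); apply: eq_bigr => g _; rewrite f'K.
  case: (idl J Jid Jgr) => h; [left=> x xI|right=> x].
    by apply: (can_inj f'K); rewrite (lin0 f'L) (h (f' x)) ?JE ?f'K.
  by have := h (f' x); rewrite JE f'K.
- move=> c cC cD.
  have fAB g y : y \in gcomp A g -> exists2 x, x \in gcomp B g & f' x = y.
    by move=> yg; exists (f y); [apply: fA|rewrite fK].
  have [c'C c'D] := giso_centroid f'L f'K fK f'M f'A fAB cC cD.
  have [lam lamE] := ce _ c'C c'D; exists lam => x; apply: (can_inj f'K).
  by rewrite (linZ f'L) -lamE f'K.
Qed.

Lemma graded_central_simple_loop (F : fieldType) (G : zmodType) (B : galg F G) :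
  is_galg B -> graded_central_simple B ->
  exists (H : subgrp G) (A : galg F (quot H)) (t : G -> G -> F),
    is_galg A /\ central_simple A /\ sym2cocycle t /\ giso B (tloop (qproj H) A t).
Proof.
move=> gB gcsB; have [u [t [[tC uP uM] u0]]] := centroid_cocycle gB gcsB.
pose A := base_alg (cent_subgrp gB gcsB) u t.
exists (cent_subgrp gB gcsB), A, t.
have gA : is_galg A by exact: base_alg_galg.
have iso : giso B (tloop (qproj (cent_subgrp gB gcsB)) A t) by exact: base_alg_iso.
split=> //; split; last by split.
have gL := tloop_galg (@qprojD G (cent_subgrp gB gcsB)) gA t.
apply: (base_central_simple gA tC (giso_gcs gB gL iso gcsB)).
(* The subgroup was defined as the centroid support of [B], which is also that of the isomorphic
   loop algebra. *)
by move=> k /(giso_cent_supp (giso_sym iso)) h; apply/suppP.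
Qed.

(* G abelian, written additively (zmodType); F a field.
   quot H = G/H, qproj H = canonical projection pi : G -> G/H,
   tloop pi A t = L^t_pi(A), twist A mu = A^mu, tgrpalg H t' = F^{t'}H,
   centroid_alg B = C(B) with its G-grading, giso = graded isomorphism. *)
Theorem theorem5p2 (F : fieldType) (G : zmodType) :
  (* (1) *)
  (forall B : galg F G, is_galg B -> graded_central_simple B ->
     exists (H : subgrp G) (A : galg F (quot H)) (t : G -> G -> F),
       is_galg A /\ central_simple A /\ sym2cocycle t /\
       giso B (tloop (qproj H) A t))
  /\
  (* (2) *)
  (forall (H : subgrp G) (A : galg F (quot H)) (t : G -> G -> F),
     is_galg A -> central_simple A -> sym2cocycle t ->
     graded_central_simple (tloop (qproj H) A t) /\
     giso (centroid_alg (tloop (qproj H) A t)) (tgrpalg H (restr H t)))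
  /\
  (* (3), "only if" part concerning the subgroups: H1 = H2 *)
  (forall (H1 H2 : subgrp G) (A1 : galg F (quot H1)) (A2 : galg F (quot H2))
          (t1 t2 : G -> G -> F),
     is_galg A1 -> central_simple A1 -> is_galg A2 -> central_simple A2 ->
     sym2cocycle t1 -> sym2cocycle t2 ->
     giso (tloop (qproj H1) A1 t1) (tloop (qproj H2) A2 t2) ->
     sg_pred H1 =i sg_pred H2)
  /\
  (* (3), for H1 = H2 = H *)
  (forall (H : subgrp G) (A1 A2 : galg F (quot H)) (t1 t2 : G -> G -> F),
     is_galg A1 -> central_simple A1 -> is_galg A2 -> central_simple A2 ->
     sym2cocycle t1 -> sym2cocycle t2 ->
     (giso (tloop (qproj H) A1 t1) (tloop (qproj H) A2 t2) <->
      exists mu : quot H -> quot H -> F,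
        sym2cocycle mu /\
        cohomologous t1 (fun a b => mu (qproj H a) (qproj H b) * t2 a b) /\
        giso (twist A1 mu) A2)).
Proof.
split; first exact: graded_central_simple_loop.
split=> [H A t gA csA tC|].
  by split; [apply: tloop_gcs|apply: centroid_tloop_iso].
split=> [H1 H2 A1 A2 t1 t2 g1 c1 g2 c2 tC1 tC2|H A1 A2 t1 t2 g1 c1 g2 c2 tC1 tC2].
  exact: tloop_iso_subgrp.
split=> [/(tloop_iso_twist g1 g2 c1 c2 tC1 tC2) [mu [? ? ?]]|[mu [_ [coh iso]]]].
  by exists mu.
exact: (twist_iso_tloop g1 g2 coh iso).
Qed.
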